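(* Let $G=(V,E)$ be a directed graph with non-negative edge weights and $n=|V|$ nodes, and let $c \geq 1$. There is a randomized preprocessing algorithm that computes a data structure $\mathcal{D}$ in time $O(n^3 \log^2 n)$, and a deletion algorithm that, given $\mathcal{D}$ and a single nonempty set of nodes $D \subseteq V$, computes $\mathrm{dist}_{G \setminus D}(s,t)$ for all pairs of nodes $s,t \in V\setminus D$ in time $O(n^{2.5}\sqrt{|D|}\log n)$. The running time bounds and the correctness each hold with probability at least $1 - 1/n^c$.
   Context: For $S \subseteq V$, $G \setminus S$ denotes the subgraph of $G$ induced by $V \setminus S$. The length of a path is the sum of its edge weights, and $\mathrm{dist}_H(s,t)$ is the minimum length of a path from $s$ to $t$ in $H$ ($\infty$ if none exists). *)

(* Defs.v *)
From mathcomp Require Import all_boot all_order all_algebra.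
From mathcomp Require Import boolp classical_sets reals constructive_ereal ereal exp.

Set Implicit Arguments.
Unset Strict Implicit.
Unset Printing Implicit Defensive.

Import Order.TTheory GRing.Theory Num.Theory.
Local Open Scope ring_scope.

(** * Weighted directed graphs and distances *)

(* [wt u v] is only meaningful when [arc u v] holds. *)
Record wdigraph (R : realType) (V : finType) := WDigraph {
  arc : rel V;
  wt : V -> V -> R }.

Definition nonneg_weights (R : realType) (V : finType) (G : wdigraph R V) :=
  forall u v, arc G u v -> 0 <= wt G u v.

Definition remove (R : realType) (V : finType) (G : wdigraph R V) (S : {set V})
    : wdigraph R {x : V | x \notin S} :=
  WDigraph (fun u v => arc G (val u) (val v)) (fun u v => wt G (val u) (val v)).

(* A path from [s] is given by the sequence [p] of its nodes after [s]. *)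
Definition path_from_to (R : realType) (V : finType) (G : wdigraph R V)
    (s t : V) (p : seq V) : bool :=
  path (arc G) s p && (last s p == t).

Definition path_length (R : realType) (V : finType) (G : wdigraph R V)
    (s : V) (p : seq V) : R :=
  \sum_(e <- zip (s :: p) p) wt G e.1 e.2.

Definition is_dist (R : realType) (V : finType) (G : wdigraph R V)
    (s t : V) (d : \bar R) : Prop :=
  match d with
  | EFin r => (exists2 p, path_from_to G s t p & path_length G s p = r) /\
              (forall p, path_from_to G s t p -> r <= path_length G s p)
  | +oo%E => forall p, ~~ path_from_to G s t p
  | -oo%E => False
  end.

(** * The model of computation

    A random access machine with two kinds of data:
    - words, i.e. natural numbers below [M], held in registers and in arrays;
    - weights, held in arrays only, on which the sole operations are addition
      and comparison (plus the constants 0 and +oo).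
    A program mentions finitely many registers and arrays, fixed in advance;
    only array indices are computed. *)

Inductive wordexp :=
| Const of nat
| Reg of nat
| Get of nat & wordexp                  (* array, index *)
| Add of wordexp & wordexp
| Sub of wordexp & wordexp
| Mul of wordexp & wordexp
| Div of wordexp & wordexp
| Mod of wordexp & wordexp.

Inductive weightexp :=
| WZero
| WInfty
| WGet of nat & wordexp                 (* array, index *)
| WAdd of weightexp & weightexp.

Inductive test :=
| Le of wordexp & wordexp
| WLe of weightexp & weightexp
| Not of test
| And of test & test.

Inductive prog :=
| Skip
| Seq of prog & prog
| If of test & prog & prog
| While of test & prog
| Assign of nat & wordexp               (* register, value *)
| Store of nat & wordexp & wordexp      (* array, index, value *)
| WStore of nat & wordexp & weightexp   (* array, index, value *)
| Flip of nat.                          (* register := fair random bit *)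

(* [coins] holds the outcomes of the coin flips yet to be made. *)
Record state (R : realType) := State {
  reg : nat -> nat;
  arr : nat -> nat -> nat;
  warr : nat -> nat -> \bar R;
  coins : seq bool }.

Definition upd (T : Type) (f : nat -> T) (x : nat) (v : T) : nat -> T :=
  fun y => if y == x then v else f y.

Section Semantics.
Variables (R : realType) (M : nat).

Fixpoint word_val (st : state R) (e : wordexp) : nat :=
  match e with
  | Const a => a %% M
  | Reg x => reg st x
  | Get a i => arr st a (word_val st i)
  | Add e1 e2 => (word_val st e1 + word_val st e2) %% M
  | Sub e1 e2 => word_val st e1 - word_val st e2
  | Mul e1 e2 => (word_val st e1 * word_val st e2) %% M
  | Div e1 e2 => word_val st e1 %/ word_val st e2
  | Mod e1 e2 => word_val st e1 %% word_val st e2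
  end%N.

Fixpoint weight_val (st : state R) (e : weightexp) : \bar R :=
  match e with
  | WZero => 0
  | WInfty => +oo
  | WGet a i => warr st a (word_val st i)
  | WAdd e1 e2 => weight_val st e1 + weight_val st e2
  end%E.

Fixpoint test_val (st : state R) (b : test) : bool :=
  match b with
  | Le e1 e2 => (word_val st e1 <= word_val st e2)%N
  | WLe e1 e2 => (weight_val st e1 <= weight_val st e2)%E
  | Not b1 => ~~ test_val st b1
  | And b1 b2 => test_val st b1 && test_val st b2
  end.

(* [exec p st t st']: started in [st], the program [p] halts after [t] steps in
   [st'].  Elementary commands and tests take one step each; the expressions of
   a program have bounded size, so charging for their subexpressions would only
   change constant factors.  [Flip] is stuck when [coins] is empty. *)
Inductive exec : prog -> state R -> nat -> state R -> Prop :=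
| ExecSkip st : exec Skip st 1 st
| ExecSeq p1 p2 st0 t1 st1 t2 st2 :
    exec p1 st0 t1 st1 -> exec p2 st1 t2 st2 ->
    exec (Seq p1 p2) st0 (t1 + t2) st2
| ExecIf b p1 p2 st t st' :
    exec (if test_val st b then p1 else p2) st t st' ->
    exec (If b p1 p2) st t.+1 st'
| ExecWhile b p st t st' :
    exec (If b (Seq p (While b p)) Skip) st t st' ->
    exec (While b p) st t st'
| ExecAssign x e st :
    exec (Assign x e) st 1
      (State (upd (reg st) x (word_val st e)) (arr st) (warr st) (coins st))
| ExecStore a i e st :
    exec (Store a i e) st 1
      (State (reg st)
             (upd (arr st) a (upd (arr st a) (word_val st i) (word_val st e)))
             (warr st) (coins st))
| ExecWStore a i e st :
    exec (WStore a i e) st 1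
      (State (reg st) (arr st)
             (upd (warr st) a
                (upd (warr st a) (word_val st i) (weight_val st e)))
             (coins st))
| ExecFlip x st b r :
    coins st = b :: r ->
    exec (Flip x) st 1
      (State (upd (reg st) x (nat_of_bool b)) (arr st) (warr st) r).

Definition halts_with (p : prog) (st : state R) (Q : nat -> state R -> Prop) :=
  exists t st', exec p st t st' /\ Q t st'.

End Semantics.

(* Machine words have [k * b] bits, where [b] is the bit length of [n]. *)
Definition word_bound (k n : nat) : nat := (2 ^ (k * (trunc_log 2 n).+1))%N.

(* [coin_prob E] is the probability that an infinite sequence of independent
   fair coin flips has a finite prefix satisfying [E], for [E] stable under
   extension of the prefix: the probabilities over prefixes of length [m] then
   increase to it.  The events below, that a run halts with a given property of
   time, registers and arrays, are of this kind. *)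
Definition coin_prob (R : realType) (E : seq bool -> Prop) : R :=
  sup (range (fun m : nat =>
    #|[pred r : m.-tuple bool | `[< E r >]]|%:R / 2 ^+ m : R)).

(** * Input and output conventions *)

(* Row-major adjacency matrix, with +oo for the missing arcs. *)
Definition adj_matrix (R : realType) (n : nat) (G : wdigraph R 'I_n) (i : nat)
    : \bar R :=
  match insub (i %/ n)%N : option 'I_n, insub (i %% n)%N : option 'I_n with
  | Some u, Some v => if arc G u v then (wt G u v)%:E else +oo%E
  | _, _ => 0%E
  end.

(* Register 0 holds [n], weight array 0 holds the adjacency matrix. *)
Definition preprocess_start (R : realType) (n : nat) (G : wdigraph R 'I_n)
    (r : seq bool) : state R :=
  State (upd (fun=> 0%N) 0%N n) (fun _ _ => 0%N)
        (upd (fun _ _ => 0%E) 0%N (adj_matrix G)) r.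

Definition indicator (n : nat) (D : {set 'I_n}) (i : nat) : nat :=
  if insub i : option 'I_n is Some v then nat_of_bool (v \in D) else 0%N.

(* The data structure is the contents of the arrays at the end of the
   preprocessing.  The deletion algorithm receives it with word array 0
   replaced by the indicator vector of [D], and with [n] in register 0.  It has
   no coins: all the randomness is in the data structure. *)
Definition delete_start (R : realType) (n : nat) (ds : state R)
    (D : {set 'I_n}) : state R :=
  State (upd (fun=> 0%N) 0%N n) (upd (arr ds) 0%N (indicator D)) (warr ds) [::].

(* The answers are output in weight array 1, in row-major order. *)
Definition outputs_distances (R : realType) (n : nat) (G : wdigraph R 'I_n)
    (D : {set 'I_n}) (st : state R) : Prop :=
  forall s t : {x : 'I_n | x \notin D},
    is_dist (remove G D) s t (warr st 1 (val s * n + val t)%N).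

(* Main.v *)
Require Import Defs.
From mathcomp Require Import all_boot all_order all_algebra.
From mathcomp Require Import reals constructive_ereal exp.
From mathcomp Require Import zify lra ring.

(** The nodes are taken out of the graph one at a time, as centres
    [c_0, ..., c_(n-1)].  For [c_i], Bellman-Ford with
    [h_i = n * lam / (i + 1)] rounds gives its distances to and from all nodes
    along walks of at most [h_i] arcs avoiding [c_0, ..., c_(i-1)]; here [lam] is
    [O(log n)], so the total time is harmonic in [i].  Given [D], let [p] be a
    shortest simple path from [s] to [t] avoiding [D], and [c_i] the first centre
    on [p].  If [p] has at most [h_i] arcs, the distance is the minimum over [i]
    of the sum of the distances to and from [c_i], once these are corrected for
    the deletion of [D].  The even centres are uniform samples: with high
    probability, a path with [m > lam] nodes contains one of the first
    [n * lam / (2 * m)] samples, hence is met while [h_i >= m]; and [h_i >= lam]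
    always.

    A stored distance is affected only if the path realising it meets [D].  Each
    node [x] carries a counter, increased by [i + 1] for every path stored for
    [c_i] through [x].  The odd centres are the nodes with the largest counter.
    By a potential argument on [\sum_x b ^ cnt x], with [b] slightly above 1, all
    counters remain [O(n^2 log^2 n)].  As an affected entry of [c_i] contributes
    [i + 1] to the counters of [D], the number of affected entries is at most
    [2 * n * q + O(|D| * n^2 * log^2 n) / q] for every [q], that is
    [O(n^(3/2) * sqrt |D| * log n)].  Each is recomputed in time [O(n)] by
    Dijkstra's algorithm restricted to the affected nodes.  The minimum over [i]
    is split at the slots [i] affected at [s] or at [t]; the runs of unaffected
    slots in between are answered by tables of range minima. *)

Set Implicit Arguments.
Unset Strict Implicit.
Unset Printing Implicit Defensive.

Import Order.TTheory GRing.Theory Num.Theory.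
Local Open Scope nat_scope.

(** * Reasoning about programs *)

(** The hubs depend on the counters and hence on the samples, so the set of nodes removed at a given
    slot is not independent of the coins. The argument never conditions on it: a sample, whether
    accepted as a centre or found already removed, is out of the graph after its slot, so a path
    through an early sample has met a centre by then. The path itself is fixed from the graph and
    [D] before the coins are flipped, and a union bound over all pairs leaves only independent
    samples.

    The increment [i + 1] cancels the factor [1 / (i + 1)] in the number of rounds: every slot has
    the same bound [slot_cap] on the total that it adds to the counters, so one base serves the
    whole potential. A sample slot may raise the potential by a quarter of its largest term; the hub
    slot that follows removes this term and adds at most half of it. This is why samples and hubs
    alternate.

    The coins influence correctness only; both time bounds hold for every outcome. *)

Fixpoint regs_of (p : prog) : seq nat :=
  match p with
  | Seq p q | If _ p q => regs_of p ++ regs_of q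
  | While _ p => regs_of p
  | Assign x _ | Flip x => [:: x]
  | _ => [::]
  end.

Fixpoint arrs_of (p : prog) : seq nat :=
  match p with
  | Seq p q | If _ p q => arrs_of p ++ arrs_of q
  | While _ p => arrs_of p
  | Store a _ _ => [:: a]
  | _ => [::]
  end.

Fixpoint warrs_of (p : prog) : seq nat :=
  match p with
  | Seq p q | If _ p q => warrs_of p ++ warrs_of q
  | While _ p => warrs_of p
  | WStore a _ _ => [:: a]
  | _ => [::]
  end.

Fixpoint coinless (p : prog) : bool :=
  match p with
  | Seq p q | If _ p q => coinless p && coinless q
  | While _ p => coinless p
  | Flip _ => false
  | _ => true
  end.

Definition For (x y : nat) (p : prog) : prog :=
  Seq (Assign x (Const 0))
      (While (Not (Le (Reg y) (Reg x)))
             (Seq p (Assign x (Add (Reg x) (Const 1))))).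

Section Logic.
Variables (R : realType) (M : nat).
Implicit Types (st : state R) (p q : prog).

Definition setr st x v := State (upd (reg st) x v) (arr st) (warr st) (coins st).
Definition seta st a i v :=
  State (reg st) (upd (arr st) a (upd (arr st a) i v)) (warr st) (coins st).
Definition setw st a i v :=
  State (reg st) (arr st) (upd (warr st) a (upd (warr st a) i v)) (coins st).

Lemma getE st a e : word_val M st (Get a e) = arr st a (word_val M st e).
Proof. by []. Qed.

Lemma wgetE st a e : weight_val M st (WGet a e) = warr st a (word_val M st e).
Proof. by []. Qed.

(** Syntactic framing: what a program never names as a target survives its execution. Loop
    invariants then mention only the data that really change; everything else is recovered by
    computing the lists of targets. *)
Record frame p st st' : Prop := Frame {
  frame_reg : forall x, x \notin regs_of p -> reg st' x = reg st x;
  frame_arr : forall a, a \notin arrs_of p -> arr st' a = arr st a;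
  frame_warr : forall a, a \notin warrs_of p -> warr st' a = warr st a;
  frame_coins : coinless p -> coins st' = coins st }.

Lemma frame_refl p st : frame p st st.
Proof. by split. Qed.

Lemma frame_sub p q st st' :
  {subset regs_of p <= regs_of q} -> {subset arrs_of p <= arrs_of q} ->
  {subset warrs_of p <= warrs_of q} -> (coinless q -> coinless p) ->
  frame p st st' -> frame q st st'.
Proof.
move=> sr sa sw sc [fr fa fw fc]; split => [x|a|a|/sc//].
- by move=> nx; apply: fr; apply: contra nx; apply: sr.
- by move=> nx; apply: fa; apply: contra nx; apply: sa.
- by move=> nx; apply: fw; apply: contra nx; apply: sw.
Qed.

Lemma frame_trans p st1 st2 st3 :
  frame p st1 st2 -> frame p st2 st3 -> frame p st1 st3.
Proof.
move=> [fr fa fw fc] [gr ga gw gc]; split=> [x|a|a|] h.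
- by rewrite gr // fr.
- by rewrite ga // fa.
- by rewrite gw // fw.
- by rewrite gc // fc.
Qed.

Lemma frame_if b p q st st' :
  frame (if b then p else q) st st' -> forall b', frame (If b' p q) st st'.
Proof.
move=> f b'; apply: frame_sub f => [x|x|x|]; case: b => //=; rewrite ?mem_cat;
  by [move=> ->; rewrite ?orbT | case/andP].
Qed.

Lemma exec_frame p st t st' : exec M p st t st' -> frame p st st'.
Proof.
elim=> {p st t st'} /=.
- by move=> st; apply: frame_refl.
- move=> p q st0 t1 st1 t2 st2 _ f1 _ f2.
  apply: (@frame_trans _ _ st1).
  + by apply: frame_sub f1 => //= [x|x|x|/andP[]//]; rewrite mem_cat => ->.
  + by apply: frame_sub f2 => //= [x|x|x|/andP[]//]; rewrite mem_cat => ->; rewrite orbT.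
- by move=> b p q st t st' _ f; apply: frame_if f _.
- move=> b p st t st' _ f; apply: frame_sub f => //= [x|x|x|->//].
  + by rewrite cats0 mem_cat orbb.
  + by rewrite cats0 mem_cat orbb.
  + by rewrite cats0 mem_cat orbb.
- by move=> x e st; split=> //= y; rewrite inE /upd => /negbTE ->.
- by move=> a i e st; split=> //= y; rewrite inE /upd => /negbTE ->.
- by move=> a i e st; split=> //= y; rewrite inE /upd => /negbTE ->.
- by move=> x st b r _; split=> //= y; rewrite inE /upd => /negbTE ->.
Qed.

(** Total correctness with an upper bound on the time rather than its exact value, so that branches
    of different costs can be joined and sums rounded up by [runs_le]. *)
Definition runs p st (T : nat) (Q : state R -> Prop) :=
  exists t st', [/\ exec M p st t st', t <= T & Q st'].

Lemma runs_le p st T T' Q : runs p st T Q -> T <= T' -> runs p st T' Q.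
Proof. by move=> [t [st' [e h q]]] hT; exists t, st'; split=> //; apply: leq_trans hT. Qed.

Lemma runs_imp p st T (Q Q' : state R -> Prop) :
  runs p st T Q -> (forall st', frame p st st' -> Q st' -> Q' st') -> runs p st T Q'.
Proof.
move=> [t [st' [e h q]]] hQ; exists t, st'; split=> //; apply: hQ => //.
exact: exec_frame e.
Qed.

Lemma runs_skip st (Q : state R -> Prop) : Q st -> runs Skip st 1 Q.
Proof. by move=> q; exists 1, st; split=> //; constructor. Qed.

Lemma runs_seq p q st T1 T2 Q :
  runs p st T1 (fun st1 => runs q st1 T2 Q) -> runs (Seq p q) st (T1 + T2) Q.
Proof.
move=> [t1 [st1 [e1 h1 [t2 [st2 [e2 h2 q2]]]]]].
by exists (t1 + t2), st2; split=> //; [econstructor; eassumption | apply: leq_add].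
Qed.

Lemma runs_then p q st T1 T2 (Q1 Q : state R -> Prop) :
  runs p st T1 Q1 ->
  (forall st1, frame p st st1 -> Q1 st1 -> runs q st1 T2 Q) ->
  runs (Seq p q) st (T1 + T2) Q.
Proof. by move=> h1 h2; apply: runs_seq; apply: runs_imp h1 h2. Qed.

Lemma runs_if b p q st T1 T2 Q :
  (test_val M st b -> runs p st T1 Q) -> (~~ test_val M st b -> runs q st T2 Q) ->
  runs (If b p q) st (maxn T1 T2).+1 Q.
Proof.
move=> h1 h2; case: (boolP (test_val M st b)) => hb.
- have [t [st' [e h q']]] := h1 hb; exists t.+1, st'; split=> //.
    by constructor; rewrite hb.
  by rewrite ltnS leq_max h.
- have [t [st' [e h q']]] := h2 hb; exists t.+1, st'; split=> //.
    by constructor; rewrite (negbTE hb).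
  by rewrite ltnS leq_max h orbT.
Qed.

Lemma runs_assign x e st (Q : state R -> Prop) :
  Q (setr st x (word_val M st e)) -> runs (Assign x e) st 1 Q.
Proof. by move=> q; eexists; eexists; split; [constructor | | exact: q]. Qed.

Lemma runs_store a i e st (Q : state R -> Prop) :
  Q (seta st a (word_val M st i) (word_val M st e)) -> runs (Store a i e) st 1 Q.
Proof. by move=> q; eexists; eexists; split; [constructor | | exact: q]. Qed.

Lemma runs_wstore a i e st (Q : state R -> Prop) :
  Q (setw st a (word_val M st i) (weight_val M st e)) -> runs (WStore a i e) st 1 Q.
Proof. by move=> q; eexists; eexists; split; [constructor | | exact: q]. Qed.

Lemma runs_flip x st b r (Q : state R -> Prop) : coins st = b :: r ->
  Q (State (upd (reg st) x b) (arr st) (warr st) r) -> runs (Flip x) st 1 Q.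
Proof. by move=> hc q; eexists; eexists; split; [constructor; exact: hc | | exact: q]. Qed.

(* [phi] is a potential that pays for the remaining iterations. *)
Lemma runs_while b p (I : state R -> Prop) (phi : state R -> nat) st :
  I st ->
  (forall st1, frame p st st1 -> I st1 -> test_val M st1 b -> exists T,
     runs p st1 T (fun st2 => I st2 /\ T + 1 + phi st2 <= phi st1)) ->
  runs (While b p) st (phi st + 2) (fun st' => I st' /\ ~~ test_val M st' b).
Proof.
move=> Ist hb.
suff H m st1 : phi st1 < m -> frame p st st1 -> I st1 ->
    runs (While b p) st1 (phi st1 + 2) (fun st' => I st' /\ ~~ test_val M st' b).
  exact: H (ltnSn _) (frame_refl _ _) Ist.
elim: m st1 => // m IH st1 hm f1 I1.
case: (boolP (test_val M st1 b)) => ht; last first.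
  (* The failing test and the [Skip] behind it cost one step each. *)
  exists 2, st1; split=> //; last by rewrite addn2.
  by do 2!constructor; rewrite (negbTE ht); constructor.
have [T [t [st2 [e2 h2 [I2 hphi]]]]] := hb _ f1 I1 ht.
have f2 := frame_trans f1 (exec_frame e2).
have [|t' [st3 [e3 h3 q3]]] := IH st2 _ f2 I2; first lia.
exists (t + t').+1, st3; split=> //; last lia.
by do 2!constructor; rewrite ht; econstructor; eassumption.
Qed.

(** The potential is the cost of the iterations still to come: the body, one step for the test and
    one for the increment; the final 3 pays for the initialisation and the exit. [N < M] keeps the
    counter from wrapping around. The invariant is asserted after the update of the counter, and the
    frame relative to the initial state is handed to the body. *)
Lemma runs_for x y p (T : nat -> nat) (I : nat -> state R -> Prop) st N :
  x \notin regs_of p -> y \notin regs_of p -> x != y -> reg st y = N -> N < M ->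
  I 0 (setr st x 0) ->
  (forall k st1, k < N -> frame (For x y p) st st1 -> reg st1 x = k ->
     I k st1 -> runs p st1 (T k) (fun st2 => I k.+1 (setr st2 x k.+1))) ->
  runs (For x y p) st (\sum_(k < N) (T k + 2) + 3) (fun st' => I N st').
Proof.
move=> nx ny xy hN NM I0 hb.
set J := fun st1 : state R => exists k, [/\ k <= N, reg st1 x = k, reg st1 y = N,
   frame (For x y p) st st1 & I k st1].
set phi := fun st1 : state R => \sum_(k < N | reg st1 x <= k) (T k + 2).
have h0 : phi (setr st x 0) = \sum_(k < N) (T k + 2).
  by rewrite /phi /= /upd eqxx; apply: eq_bigl.
have hst0 : J (setr st x 0).
  exists 0; split=> //=; rewrite /upd ?eqxx //.
    by rewrite eq_sym (negbTE xy).
  by split=> //= z; rewrite /upd inE negb_or => /andP[/negbTE ->].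
rewrite -h0.
have -> : phi (setr st x 0) + 3 = 1 + (phi (setr st x 0) + 2) by lia.
apply: runs_seq; apply: runs_assign.
rewrite /word_val mod0n.
have hw := @runs_while (Not (Le (Reg y) (Reg x)))
  (Seq p (Assign x (Add (Reg x) (Const 1)))) J phi (setr st x 0) hst0.
apply: runs_imp (hw _) _ => {hw}; last first.
  move=> st' _ [[k [kN hk hy f Ik]] /=]; rewrite negbK hy hk => Nk.
  by have -> : N = k by apply/eqP; rewrite eqn_leq Nk kN.
move=> st1 f1 [k [kN hk hy fk Ik]] /=; rewrite hy hk -ltnNge => {}kN.
exists (T k + 1); apply: runs_seq.
apply: runs_imp (hb _ _ kN fk hk Ik) _ => st2 fp2 I2.
have hx2 : reg st2 x = k by rewrite (frame_reg fp2).
have hy2 : reg st2 y = N by rewrite (frame_reg fp2).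
apply: runs_assign => /=; rewrite hx2 modnDmr addn1 modn_small; last by lia.
split.
  exists k.+1; split=> //=; rewrite /upd ?eqxx //.
    by rewrite eq_sym (negbTE xy).
  apply: (frame_trans fk); apply: (@frame_trans _ _ st2).
    by apply: frame_sub fp2; rewrite /= ?cats0 ?andbT // => z;
       rewrite inE mem_cat => ->; rewrite orbT.
  by split=> //= z; rewrite /upd inE negb_or => /andP[/negbTE ->].
rewrite /phi /= /upd eqxx hk.
rewrite [leqRHS](bigD1 (Ordinal kN)) //=.
rewrite (eq_bigl (fun j : 'I_N => (k <= j) && (j != Ordinal kN)));
  first by rewrite -!addnA leq_add2l.
by move=> j; rewrite -val_eqE /= ltn_neqAle andbC eq_sym.
Qed.

Lemma runs_for_const x y p T (I : nat -> state R -> Prop) st N :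
  x \notin regs_of p -> y \notin regs_of p -> x != y -> reg st y = N -> N < M ->
  I 0 (setr st x 0) ->
  (forall k st1, k < N -> frame (For x y p) st st1 -> reg st1 x = k ->
     I k st1 -> runs p st1 T (fun st2 => I k.+1 (setr st2 x k.+1))) ->
  runs (For x y p) st (N * (T + 2) + 3) (fun st' => I N st').
Proof.
move=> nx ny xy hN NM I0 hb.
have := @runs_for x y p (fun=> T) I st N nx ny xy hN NM I0 hb.
by rewrite sum_nat_const card_ord.
Qed.

End Logic.

(** * Walks and rounds of Bellman-Ford *)

Section Walks.
Variables (R : realType).
Implicit Type w : nat -> nat -> \bar R.
Local Open Scope ereal_scope.

(* A walk from [u] is any sequence [p] of nodes; missing arcs have length +oo. *)
Fixpoint elen w (u : nat) (p : seq nat) : \bar R :=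
  if p is v :: p' then w u v + elen w v p' else 0.

Lemma elen_cat w u p q : elen w u (p ++ q) = elen w u p + elen w (last u p) q.
Proof. by elim: p u => [|v p IH] u /=; rewrite ?add0e // IH addeA. Qed.

Lemma elen_rcons w u p v : elen w u (rcons p v) = elen w u p + w (last u p) v.
Proof. by rewrite -cats1 elen_cat /= adde0. Qed.

Lemma elen_ge0 w u p : (forall u v, 0 <= w u v) -> 0 <= elen w u p.
Proof. by move=> w0; elim: p u => //= v p IH u; apply: adde_ge0. Qed.

Lemma elen_rev w u p :
  elen (fun x y => w y x) u p = elen w (last u p) (rev (belast u p)).
Proof.
elim: p u => //= v p IH u; rewrite rev_cons elen_rcons IH addeC; congr (_ + w _ _).
by case: p {IH} => //= x p; rewrite rev_cons last_rcons.
Qed.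

End Walks.

Section BellmanFord.
Variables (R : realType) (n : nat) (w : nat -> nat -> \bar R) (rmv : pred nat)
  (c : nat).
Local Open Scope ereal_scope.

(** The strict comparison matters: in a round without improvement a node remains its own parent. *)
Definition relax_step (l : nat -> \bar R) (t : nat) (acc : \bar R * nat) (u : nat) :=
  if l u + w u t < acc.1 then (l u + w u t, u) else acc.

Definition relax (l : nat -> \bar R) (t m : nat) : \bar R * nat :=
  foldl (relax_step l t) (l t, t) (iota 0 m).

Fixpoint lay (k t : nat) : \bar R :=
  if k is k'.+1 then if rmv t then lay k' t else (relax (lay k') t n).1
  else if t == c then 0 else +oo.

(** One parent per round: a single parent per node would be overwritten by later rounds, and
    following such parents need not give back the walk of at most [k] arcs behind [lay k t]. *)
Definition par (k t : nat) : nat :=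
  if rmv t then t else (relax (lay k) t n).2.

(** A trail always has [k + 1] entries, since rounds without improvement repeat the node. It agrees
    with the walk that it encodes only as a set, which is enough to decide whether a deletion breaks
    the walk. *)
Fixpoint trail (k t : nat) : seq nat :=
  if k is k'.+1 then t :: trail k' (par k' t) else [:: t].

Lemma size_trail k t : size (trail k t) = k.+1.
Proof. by elim: k t => //= k IH t; rewrite IH. Qed.

Lemma mem_trail k t : t \in trail k t.
Proof. by case: k => [|k]; rewrite inE eqxx. Qed.

Lemma relaxS l t m : relax l t m.+1 = relax_step l t (relax l t m) m.
Proof. by rewrite /relax -addn1 iotaD foldl_cat. Qed.

Lemma relax_le l t m u : (u < m)%N -> (relax l t m).1 <= l u + w u t.
Proof.
elim: m => // m IH; rewrite ltnS leq_eqVlt relaxS /relax_step => /predU1P[->|/IH h].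
  by case: ifP => //= /negbT; rewrite -leNgt.
by case: ifP => //= h'; apply: le_trans (ltW h') h.
Qed.

Lemma relax_le0 l t m : (relax l t m).1 <= l t.
Proof.
elim: m => // m IH; rewrite relaxS /relax_step.
by case: ifP => //= h; apply: le_trans (ltW h) IH.
Qed.

Lemma relaxP l t m : relax l t m = (l t, t) \/
  exists u, [/\ (u < m)%N, relax l t m = (l u + w u t, u) & l u + w u t < l t].
Proof.
elim: m => [|m IH]; first by left.
rewrite relaxS /relax_step; case: ifP => h.
  by right; exists m; split=> //; apply: lt_le_trans h (relax_le0 _ _ _).
case: IH => [->|[u [um e lu]]]; first by left.
by right; exists u; split=> //; apply: leqW.
Qed.

Lemma eq_relax l l' t m : (forall u, (u < m)%N -> l u = l' u) -> (t < m)%N ->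
  relax l t m = relax l' t m.
Proof.
move=> e tm; rewrite /relax (e t tm).
have : {subset iota 0 m <= gtn m} by move=> x; rewrite mem_iota.
elim: (iota 0 m) (l' t, t) => //= u s IH acc hs.
have -> : relax_step l t acc u = relax_step l' t acc u.
  by rewrite /relax_step e //; apply: hs; rewrite inE eqxx.
by apply: IH => x hx; apply: hs; rewrite inE hx orbT.
Qed.

Lemma par_lt k t : (t < n)%N -> (par k t < n)%N.
Proof.
by move=> tn; rewrite /par; case: ifP => // _;
   case: (relaxP (lay k) t n) => [->//|[u [un -> _]]].
Qed.

Lemma trail_cons k t : trail k t = t :: behead (trail k t).
Proof. by case: k. Qed.

Hypotheses (w0 : forall u v, 0 <= w u v) (cn : (c < n)%N) (rc : ~~ rmv c).

Lemma lay_ge0 k t : 0 <= lay k t.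
Proof.
elim: k t => [|k IH] t /=; first by case: ifP; rewrite ?leey.
case: ifP => _; first exact: IH.
case: (relaxP (lay k) t n) => [->|[u [_ -> _]]]; first exact: IH.
exact: adde_ge0.
Qed.

Lemma lay_source k : lay k c = 0.
Proof.
elim: k => [|k IH] /=; first by rewrite eqxx.
rewrite (negbTE rc); case: (relaxP (lay k) c n) => [->//|[u [_ _]]].
by rewrite IH lt_neqAle andbC; case: ltgtP (adde_ge0 (lay_ge0 k u) (w0 u c)).
Qed.

(** Weights are non-negative, so nothing improves strictly on the value 0 of the source. Its trail
    is therefore constant, and its entry can be affected only by the deletion of [c] itself. *)
Lemma par_source k : par k c = c.
Proof.
rewrite /par (negbTE rc); case: (relaxP (lay k) c n) => [->//|[u [_ _]]].
by rewrite lay_source; case: ltgtP (adde_ge0 (lay_ge0 k u) (w0 u c)).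
Qed.

Lemma trail_source k x : x \in trail k c -> x = c.
Proof.
elim: k => [|k IH] /=; rewrite ?inE; first by move/eqP.
by rewrite par_source => /predU1P[->//|/IH].
Qed.

Lemma lay_sound k t : (t < n)%N -> lay k t < +oo ->
  exists p, [/\ last c p = t, elen w c p = lay k t, trail k t =i c :: p
    & all (fun x => (x < n)%N && ~~ rmv x) (c :: p)].
Proof.
elim: k t => [|k IH] t tn /=.
  case: eqP => [-> _|_]; last by rewrite ltxx.
  by exists [::]; rewrite /= cn rc.
rewrite /par; case: ifPn => [rt /IH [//|p [h1 h2 h3 h4]]|rt].
  exists p; split=> // x; rewrite inE h3.
  by case: eqP => // ->; rewrite -h3 mem_trail.
case: (relaxP (lay k) t n) => [->/= /IH [//|p [h1 h2 h3 h4]]|[u [un -> _]]] /=.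
  exists p; split=> // x; rewrite inE h3.
  by case: eqP => // ->; rewrite -h3 mem_trail.
move=> fin; have fu : lay k u < +oo.
  by apply: le_lt_trans fin; rewrite leeDl.
have [p [h1 h2 h3 h4]] := IH u un fu.
exists (rcons p t); split.
- by rewrite last_rcons.
- by rewrite elen_rcons h2 h1.
- by move=> x; rewrite !inE mem_rcons h3 !inE orbCA.
- by move: h4; rewrite /= all_rcons tn rt /= => ->.
Qed.

Lemma lay_complete k p : (size p <= k)%N ->
  all (fun x => (x < n)%N && ~~ rmv x) p -> lay k (last c p) <= elen w c p.
Proof.
elim: k p => [|k IH] p; first by rewrite leqn0 => /nilP -> _ /=; rewrite eqxx.
have lay_mono t : lay k.+1 t <= lay k t.
  by rewrite /=; case: ifP => // _; apply: relax_le0.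
case/lastP: p => [|p t]; first by move=> _ _; rewrite lay_source.
rewrite size_rcons ltnS all_rcons last_rcons elen_rcons => hs /andP[/andP[tn rt] hp].
have lastn : (last c p < n)%N.
  have := mem_last c p; rewrite inE => /predU1P[->//|/(allP hp)/andP[]//].
rewrite /= (negbTE rt); apply: le_trans (relax_le _ _ lastn) _.
by apply: leeD => //; apply: IH.
Qed.

End BellmanFord.

(** * The choice of the centres *)

Section Slots.
Variables (R : realType) (A : nat -> \bar R) (n lam : nat) (samp : nat -> nat).

(* Arc lengths of the graph ([dir = false]) and of its reverse. *)
Definition wdir (dir : bool) (u v : nat) : \bar R :=
  A (if dir then v * n + u else u * n + v).

(** The second component is the best value plus one: the initial 0 stands for the absence of a
    candidate, and [acc.2 <= f t] says that [t] is strictly better. *)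
Definition select_step (rm : pred nat) (f : nat -> nat) (acc : nat * nat) (t : nat) :=
  if ~~ rm t && (acc.2 <= f t) then (t, (f t).+1) else acc.

Definition select (rm : pred nat) (f : nat -> nat) (m : nat) : nat * nat :=
  foldl (select_step rm f) (0, 0) (iota 0 m).

(** Samples are uniform below a power of two, so they may be at least [n], and they may hit a former
    centre; in both cases the hub rule takes over. *)
Definition pick_centre (i : nat) (rm : pred nat) (f : nat -> nat) : nat :=
  let v := samp i./2 in
  if [&& ~~ odd i, v < n & ~~ rm v] then v else (select rm f n).1.

Definition hops (i : nat) : nat := (n * lam) %/ i.+1.

Definition visits (i : nat) (rm : pred nat) (c : nat) (dir : bool) (t x : nat) : nat :=
  if (lay n (wdir dir) rm c (hops i) t < +oo)%E
  then count_mem x (trail n (wdir dir) rm c (hops i) t) else 0.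

Definition load (i : nat) (rm : pred nat) (c : nat) (dir : bool) (x : nat) : nat :=
  i.+1 * \sum_(t < n) visits i rm c dir t x.

Fixpoint slots (i : nat) : seq nat * (nat -> nat) :=
  if i is j.+1 then
    let: (h, f) := slots j in
    let c := pick_centre j (mem h) f in
    (rcons h c, fun x => f x + load j (mem h) c false x + load j (mem h) c true x)
  else ([::], fun=> 0).

Definition chosen i : seq nat := (slots i).1.
Definition cnt i : nat -> nat := (slots i).2.
Definition centre i : nat := pick_centre i (mem (chosen i)) (cnt i).
Definition sload i dir x := load i (mem (chosen i)) (centre i) dir x.
Definition slay i dir k t : \bar R := lay n (wdir dir) (mem (chosen i)) (centre i) k t.
Definition spar i dir k t : nat := par n (wdir dir) (mem (chosen i)) (centre i) k t.
Definition sdist i dir t : \bar R := slay i dir (hops i) t.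

Lemma chosenS i : chosen i.+1 = rcons (chosen i) (centre i).
Proof. by rewrite /centre /chosen /cnt /=; case: (slots i). Qed.

Lemma cntS i x : cnt i.+1 x = cnt i x + sload i false x + sload i true x.
Proof. by rewrite /sload /centre /chosen /cnt /=; case: (slots i). Qed.

Lemma size_chosen i : size (chosen i) = i.
Proof. by elim: i => // i IH; rewrite chosenS size_rcons IH. Qed.

Lemma mem_chosenS i x : (x \in chosen i.+1) = (x == centre i) || (x \in chosen i).
Proof. by rewrite chosenS mem_rcons inE. Qed.

Lemma sub_chosen i j : i <= j -> {subset chosen i <= chosen j}.
Proof.
move=> /subnK <-; elim: (j - i) => [|k IH] // x hx.
by rewrite addSn mem_chosenS IH ?orbT.
Qed.

Lemma selectP rm f m :
  (forall t, t < m -> ~~ rm t -> f t < (select rm f m).2) /\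
  (0 < (select rm f m).2 ->
     [/\ (select rm f m).1 < m, ~~ rm (select rm f m).1 &
         (select rm f m).2 = (f (select rm f m).1).+1]).
Proof.
elim: m => [|m [IH1 IH2]]; first by split.
have -> : select rm f m.+1 = select_step rm f (select rm f m) m.
  by rewrite /select -addn1 iotaD foldl_cat.
rewrite /select_step; case: ifPn => [/andP[rt ft]|/nandP ht]; split=> /=.
- move=> t; rewrite ltnS leq_eqVlt => /predU1P[->//|tm rm_t].
  by rewrite ltnS (leq_trans (ltnW (IH1 _ tm rm_t)) ft).
- by [].
- move=> t; rewrite ltnS leq_eqVlt => /predU1P[->|tm rm_t]; last exact: IH1.
  by move=> rt; case: ht; rewrite ?rt // -ltnNge.
- by move=> /IH2[h1 h2 h3]; split=> //; apply: ltnW.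
Qed.

Lemma select_max rm f : (exists2 t, t < n & ~~ rm t) ->
  [/\ (select rm f n).1 < n, ~~ rm (select rm f n).1 &
      forall t, t < n -> ~~ rm t -> f t <= f (select rm f n).1].
Proof.
move=> [t tn rt]; have [h1 h2] := selectP rm f n.
have [//|h3 h4 h5] := h2; first exact: leq_ltn_trans (h1 _ tn rt).
by split=> // u un ru; rewrite -ltnS -h5 h1.
Qed.

Lemma exists_unchosen i : i < n -> exists2 t, t < n & t \notin chosen i.
Proof.
move=> hi; have [/allP h|/allPn[t]] := boolP (all (mem (chosen i)) (iota 0 n)).
  have := uniq_leq_size (iota_uniq 0 n) h.
  by rewrite size_iota size_chosen leqNgt hi.
by rewrite mem_iota add0n => /= tn ht; exists t.
Qed.

Lemma centreP i : i < n -> centre i < n /\ centre i \notin chosen i.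
Proof.
move=> /exists_unchosen h; rewrite /centre /pick_centre.
case: ifP => [/and3P[_ h1 h2]//|_].
by have [] := select_max (rm := mem (chosen i)) (cnt i) h.
Qed.

Lemma centre_hub i x : i < n -> odd i -> x < n -> x \notin chosen i ->
  cnt i x <= cnt i (centre i).
Proof.
move=> /exists_unchosen h oi; rewrite /centre /pick_centre oi /=.
by have [_ _] := select_max (rm := mem (chosen i)) (cnt i) h; apply.
Qed.

Lemma chosen_lt i : i <= n -> {subset chosen i <= iota 0 n}.
Proof.
elim: i => // i IH hi x; rewrite mem_chosenS => /predU1P[->|/(IH (ltnW hi))//].
by rewrite mem_iota add0n; case: (centreP hi).
Qed.

Lemma chosen_uniq i : i <= n -> uniq (chosen i).
Proof.
elim: i => [//|i IH] hi; rewrite chosenS rcons_uniq (IH (ltnW hi)) andbT.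
by case: (centreP hi).
Qed.

Lemma chosen_all x : x < n -> x \in chosen n.
Proof.
have [] := uniq_min_size (chosen_uniq (leqnn n)) (chosen_lt (leqnn n)).
  by rewrite size_iota size_chosen.
move=> _ h xn.
by rewrite h mem_iota.
Qed.

(** A sample below [n] is rejected only because it has been removed before. The conclusion thus does
    not depend on how the hubs were picked. *)
Lemma sample_chosen i : ~~ odd i -> samp i./2 < n -> samp i./2 \in chosen i.+1.
Proof.
move=> oi sn; rewrite mem_chosenS /centre /pick_centre oi sn /=.
by case: ifPn => [|]; rewrite ?eqxx // negbK => ->; rewrite orbT.
Qed.

Lemma cnt_sum i x : cnt i x = \sum_(j < i) (sload j false x + sload j true x).
Proof.
elim: i => [|i IH]; first by rewrite big_ord0.
by rewrite cntS IH big_ord_recr /= addnA.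
Qed.

Hypothesis A0 : forall i, (0 <= A i)%E.

Lemma wdir_ge0 dir u v : (0 <= wdir dir u v)%E.
Proof. exact: A0. Qed.

(** Stored walks avoid the removed nodes, so the counter of a node is frozen once the node has been
    a centre. *)
Lemma load_chosen i dir x : i < n -> x \in chosen i -> sload i dir x = 0.
Proof.
move=> hi hx; rewrite /sload /load big1 ?muln0 // => t _; rewrite /visits.
case: ifP => // fin.
have [cn cc] := centreP hi.
have [p [_ _ h3 h4]] := lay_sound (@wdir_ge0 dir) cn cc (ltn_ord t) fin.
apply/count_memPn/negP; rewrite h3 => /(allP h4)/andP[_ /negP]; apply.
exact: hx.
Qed.

Lemma sum_count_mem (s : seq nat) : \sum_(x < n) count_mem (x : nat) s <= size s.
Proof.
elim: s => /= [|y s IH]; first by rewrite big1.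
rewrite big_split /= -addn1 addnC leq_add //.
have [yn|ny] := ltnP y n; last first.
  by rewrite big1 // => x _; case: eqP => // e; have := ltn_ord x; rewrite -e ltnNge ny.
by rewrite (bigD1 (Ordinal yn)) //= eqxx big1 // => x;
   rewrite -val_eqE /= eq_sym => /negbTE ->.
Qed.

(** Each target contributes at most one trail, of [hops i + 1] entries counted with repetition. *)
Lemma load_total i dir :
  \sum_(x < n) sload i dir x <= i.+1 * (n * (hops i).+1).
Proof.
rewrite /sload /load -big_distrr leq_mul2l exchange_big /=.
apply: (@leq_trans (\sum_(t < n) (hops i).+1)); last by rewrite sum_nat_const card_ord.
apply: leq_sum => t _; rewrite /visits; case: (_ < +oo)%E; last by rewrite big1.
by apply: leq_trans (sum_count_mem _) _; rewrite size_trail.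
Qed.

End Slots.

(** * A bound on the counters *)

Section Potential.
Local Open Scope ring_scope.

(** Convexity: each of the [a] unit steps adds at most [b - 1] times the final power. *)
Lemma expr_diff_le (F : realFieldType) (b : F) (y a : nat) : 1 <= b ->
  b ^+ (y + a) <= b ^+ y + a%:R * (b - 1) * b ^+ (y + a).
Proof.
move=> b1; elim: a => [|a IH]; first by rewrite addn0 !mul0r addr0.
have e0 : 0 <= b ^+ (y + a) by apply: exprn_ge0; lra.
have a0 : (0 : F) <= a%:R by [].
have h : 0 <= (a%:R + 1) * (b - 1) * (b - 1) * b ^+ (y + a).
  by rewrite !mulr_ge0 ?subr_ge0 // addr_ge0.
by rewrite addnS exprS -natr1; lra.
Qed.

Lemma bernoulli_lower (F : realFieldType) (x : F) k : 0 <= x -> 1 + k%:R * x <= (1 + x) ^+ k.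
Proof.
move=> x0; elim: k => [|k IH]; first by rewrite mul0r addr0.
have h : 0 <= k%:R * x * x by rewrite !mulr_ge0.
have : (1 + x) * (1 + k%:R * x) <= (1 + x) * (1 + x) ^+ k.
  by rewrite ler_wpM2l // addr_ge0.
by rewrite exprS -natr1; lra.
Qed.

(** The upper counterpart of Bernoulli's inequality, in a form without division; it is applied with
    [k * x = 1 / 4]. *)
Lemma bernoulli_upper (F : realFieldType) (x : F) k : 0 <= x ->
  (1 + x) ^+ k * (1 - k%:R * x) <= 1.
Proof.
move=> x0; elim: k => [|k IH]; first by rewrite mul0r subr0 mulr1.
have h : 0 <= (k%:R + 1) * x * x * (1 + x) ^+ k.
  by rewrite !mulr_ge0 ?addr_ge0 // exprn_ge0 // addr_ge0.
by rewrite exprS -natr1; lra.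
Qed.

Variables (R : realType) (A : nat -> \bar R) (n lam : nat) (samp : nat -> nat).
Hypothesis A0 : forall i, (0 <= A i)%E.
Local Notation cnt := (cnt A n lam samp).
Local Notation chosen := (chosen A n lam samp).
Local Notation centre := (centre A n lam samp).
Local Notation sload := (sload A n lam samp).

Hypothesis n0 : (0 < n)%N.

(** Two directions with [n] targets each, and [(i + 1) * (hops i + 1) <= n * lam.+1] in every
    slot. *)
Definition slot_cap : nat := (2 * n * n * lam.+1)%N.
Local Notation U := slot_cap.

Lemma slot_total i : (i < n)%N ->
  (\sum_(x < n) (sload i false x + sload i true x) <= U)%N.
Proof.
move=> hi; rewrite big_split /=.
apply: leq_trans (leq_add (load_total _ _ _ _ _ _) (load_total _ _ _ _ _ _)) _.
have h : (i.+1 * (hops n lam i).+1 <= n * lam.+1)%N.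
  by have := leq_trunc_div (n * lam) i.+1; rewrite /hops; lia.
rewrite /slot_cap; move: h; rewrite -(leq_pmul2l n0); lia.
Qed.

Lemma slot_le i x : (i < n)%N -> (x < n)%N -> (sload i false x + sload i true x <= U)%N.
Proof.
move=> hi hx; apply: leq_trans (slot_total hi).
by rewrite (bigD1 (Ordinal hx)) //= leq_addr.
Qed.

(* With this base, one slot multiplies [base ^ cnt] by at most 2 and, if all the
   [base ^ cnt] are then at most [B], increases their sum by at most [B / 4]. *)
Definition base : R := 1 + (4 * U)%:R^-1.
Local Notation b := base.

Definition Phi (i : nat) : R := \sum_(x < n | (x : nat) \notin chosen i) b ^+ cnt i x.

Lemma base_ge1 : 1 <= b.
Proof. by rewrite lerDl invr_ge0. Qed.

Lemma base_exp_ge0 k : 0 <= b ^+ k.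
Proof. by apply: exprn_ge0; apply: le_trans base_ge1. Qed.

Lemma slot_cap_gt0 : (0 < U)%N.
Proof. by rewrite /slot_cap !muln_gt0 n0. Qed.

Lemma base_exp_cap : b ^+ U <= 2.
Proof.
have h := bernoulli_upper U (_ : 0 <= (4 * U)%:R^-1 :> R).
have U0 : (0 : R) < U%:R by rewrite ltr0n slot_cap_gt0.
have e : U%:R * (4 * U)%:R^-1 = 4^-1 :> R.
  by rewrite natrM invfM mulrCA divff ?mulr1 // gt_eqF.
have /h : 0 <= (4 * U)%:R^-1 :> R by rewrite invr_ge0.
by rewrite -/b e; have := base_exp_ge0 U; lra.
Qed.

Lemma base_exp_4cap : 2 <= b ^+ (4 * U).
Proof.
have : 0 <= (4 * U)%:R^-1 :> R by rewrite invr_ge0.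
move=> /(bernoulli_lower (4 * U)).
by rewrite -/b divff // pnatr_eq0 -lt0n muln_gt0 slot_cap_gt0.
Qed.

Lemma Phi_ge i x : (x < n)%N -> x \notin chosen i -> b ^+ cnt i x <= Phi i.
Proof.
move=> hx cx; rewrite /Phi (bigD1 (Ordinal hx)) //= lerDl.
by apply: sumr_ge0 => y _; apply: base_exp_ge0.
Qed.

(** The centre leaves the sum. Every other term grows by at most [B / (4 * U)] per unit of load, and
    the slot hands out at most [U] units. *)
Lemma Phi_step i (B : R) : (i < n)%N ->
  (forall x, (x < n)%N -> x \notin chosen i.+1 -> b ^+ cnt i.+1 x <= B) -> 0 <= B ->
  Phi i.+1 <= Phi i - b ^+ cnt i (centre i) + B / 4.
Proof.
move=> hi hB B0; have [cn cc] := centreP A lam samp hi.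
rewrite /Phi [X in _ <= X - _ + _](bigD1 (Ordinal cn)) //=.
rewrite [X in _ <= X + _]addrAC subrr add0r
  (eq_bigl (fun x : 'I_n => ((x : nat) \notin chosen i) && (x != Ordinal cn))); last first.
  by move=> x; rewrite mem_chosenS negb_or andbC.
have U0 : (0 : R) < U%:R by rewrite ltr0n slot_cap_gt0.
set a := fun x : nat => (sload i false x + sload i true x)%N.
have hle (x : 'I_n) : ((x : nat) \notin chosen i) && (x != Ordinal cn) ->
    b ^+ cnt i.+1 x <= b ^+ cnt i x + (a x)%:R * ((4 * U)%:R^-1 * B).
  move=> hx; have -> : cnt i.+1 x = (cnt i x + a x)%N by rewrite cntS /a addnA.
  apply: le_trans (expr_diff_le _ _ base_ge1) _.
  have -> : b - 1 = (4 * U)%:R^-1 by rewrite /base addrC addKr.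
  rewrite lerD2l -mulrA ler_wpM2l // ler_wpM2l ?invr_ge0 //.
  have -> : (cnt i x + a x)%N = cnt i.+1 x by rewrite cntS /a addnA.
  by apply: hB; rewrite // mem_chosenS negb_or andbC.
apply: le_trans (ler_sum _ hle) _; rewrite big_split /= lerD2l.
rewrite -mulr_suml mulrA [leRHS]mulrC ler_wpM2r //.
rewrite ler_pdivrMr ?ltr0n ?muln_gt0 ?n0 //.
rewrite natrM mulrA mulVf ?pnatr_eq0 // mul1r -natr_sum ler_nat.
apply: leq_trans (slot_total hi).
rewrite [leqRHS](bigID (fun x : 'I_n => ((x : nat) \notin chosen i) && (x != Ordinal cn))) /=.
exact: leq_addr.
Qed.

(** Slots are paired. The even slot adds at most [B / 4]; the odd slot after it removes the largest
    term [m]. One slot at most doubles a term, so the odd slot adds at most [2 * m / 4], and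
    [m / 4 - m + 2 * m / 4] is not positive. At odd [i] the bound [B] is left open because it is
    instantiated with the maximum found by the next slot. *)
Lemma Phi_le i : (i <= n)%N ->
  (~~ odd i -> Phi i <= n%:R) /\
  (odd i -> forall B : R, 0 <= B ->
     (forall x, (x < n)%N -> x \notin chosen i -> b ^+ cnt i x <= B) ->
     Phi i <= n%:R + B / 4).
Proof.
elim: i => [_|i IH hi].
  split=> // _; rewrite /Phi /=.
  apply: (@le_trans _ _ (\sum_(x < n) (1 : R))); last by rewrite sumr_const card_ord.
  by rewrite le_eqVlt; apply/orP; left; apply/eqP/eq_big => // x _; rewrite expr0.
have [IHe IHo] := IH (ltnW hi); rewrite /= negbK; split=> oi.
  have [cn cc] := centreP A lam samp hi.
  set m := b ^+ cnt i (centre i).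
  have m0 : 0 <= m by apply: base_exp_ge0.
  have hm : Phi i <= n%:R + m / 4.
    apply: IHo => // x hx cx; rewrite /m ler_weXn2l ?base_ge1 //.
    exact: centre_hub.
  have h2m : Phi i.+1 <= Phi i - m + (2 * m) / 4.
    apply: Phi_step => //; last by rewrite mulr_ge0.
    move=> x hx; rewrite mem_chosenS negb_or => /andP[_ cx].
    apply: (@le_trans _ _ (b ^+ (U + cnt i (centre i)))).
      rewrite ler_weXn2l ?base_ge1 // cntS -addnA addnC leq_add ?slot_le //.
      exact: centre_hub.
    by rewrite exprD ler_wpM2r // base_exp_cap.
  lra.
move=> B B0 hB; have := Phi_step hi hB B0; have := IHe oi.
by have := base_exp_ge0 (cnt i (centre i)); lra.
Qed.

(** When a node is about to be chosen, its power of the base is at most [2 * n], hence below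
    [2 ^ L.+1 <= base ^ (4 * U * L.+1)]; the slot of the node itself adds one more [U]. *)
Definition cnt_cap (L : nat) : nat := (4 * U * L.+1 + U)%N.

Lemma cnt_le L x : (n < 2 ^ L)%N -> (x < n)%N -> (cnt n x <= cnt_cap L)%N.
Proof.
move=> hL hx; have := chosen_all A lam samp hx.
have : (0 + n <= n)%N by [].
have : x \notin chosen 0 by [].
(* Induction on the number [k] of remaining slots, up to the slot that picks [x]; after it the
   counter of [x] no longer moves. *)
suff H k i : (i + k <= n)%N -> x \notin chosen i -> x \in chosen (i + k) ->
    (cnt (i + k) x <= cnt_cap L)%N by move=> h1 h2; apply: (H n 0%N).
elim: k i => [|k IH] i hik nx; first by rewrite addn0 (negbTE nx).
rewrite -addSnnS in hik *.
have [cx hx'|] := boolP (x \in chosen i.+1); last exact: IH.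
move: cx; rewrite mem_chosenS (negbTE nx) orbF => /eqP ex.
have hi : (i < n)%N by apply: leq_trans hik; rewrite leq_addr.
have hcnt : (cnt (i.+1 + k) x = cnt i.+1 x)%N.
  elim: k hik {IH hx'} => [|k IH] hik; first by rewrite addn0.
  have hlt : (i.+1 + k < n)%N by rewrite -addnS.
  have hin : x \in chosen (i.+1 + k).
    by apply: (@sub_chosen _ _ _ _ _ i.+1); rewrite ?leq_addr // mem_chosenS ex eqxx.
  by rewrite addnS cntS (IH (ltnW hlt)) !load_chosen ?addn0.
rewrite hcnt cntS -addnA leq_add ?slot_le //.
have bx : b ^+ cnt i x <= 2 * n%:R.
  have [he ho] := Phi_le (ltnW hi); have hP := Phi_ge hx nx.
  have b0 := base_exp_ge0 (cnt i x).
  have [oi|oi] := boolP (odd i); last by have := he oi; lra.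
  (* At odd [i] the node [x] is itself the hub, so its own term serves as [B]. *)
  suff : Phi i <= n%:R + b ^+ cnt i x / 4 by lra.
  apply: ho => // y hy cy; rewrite ler_weXn2l ?base_ge1 // ex.
  exact: centre_hub.
rewrite leqNgt; apply/negP => big.
have : b ^+ (4 * U * L.+1) <= 2 * n%:R.
  by apply: le_trans bx; rewrite ler_weXn2l ?base_ge1 // ltnW.
rewrite exprM leNgt => /negP; apply.
apply: (@lt_le_trans _ _ (2 ^+ L.+1)).
  by rewrite exprS ltr_pM2l // -natrX ltr_nat.
by apply: lerXn2r; rewrite ?nnegrE ?base_exp_ge0 // base_exp_4cap.
Qed.

End Potential.

(** * The preprocessing program *)

Ltac ev := rewrite /= /upd /=.

(* Registers 0, 1, 2 hold [n], [bitlen n] and [n * lam]; in the loops over slots,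
   3 and 4 hold the slot and its number of rounds, and 5 its centre.
   Word arrays: 0 the deleted nodes, 2 the samples, 3 the former centres, 4 the
   counters, 5 the numbers of rounds, 6 and 7 the parents of each round (of walks
   from and to the centre), 8 the powers of two, 9 and 10 the affected entries,
   11 the nodes under repair, 12 and 13 the next affected slots.
   Weight arrays: 0 the graph, 1 the answers, 2 the rounds, 3 and 4 the
   distances from and to the centres, 5 the tables of range minima. *)
Definition idx (a b : wordexp) : wordexp := Add (Mul a (Reg 0)) b.

Section Arithmetic.

Lemma lt_idx a b i j : i < a -> j < b -> i * b + j < a * b.
Proof. by move=> ia jb; apply: (@leq_trans (i.+1 * b));
  [rewrite mulSn; lia | rewrite leq_mul2r ia orbT]. Qed.

Definition bitlen (n : nat) : nat := (trunc_log 2 n).+1.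

Lemma bitlen_gt n : n < 2 ^ bitlen n.
Proof. exact: trunc_log_ltn. Qed.

Lemma bitlen_le n : 0 < n -> 2 ^ (bitlen n).-1 <= n.
Proof. by move=> n0; apply: trunc_logP. Qed.

Lemma bitlen_leq n : 0 < n -> bitlen n <= n.
Proof. by move=> n0; apply: leq_trans (bitlen_le n0); apply: ltn_expl. Qed.

Lemma exp2_leq n j : 0 < n -> (2 ^ j <= n) = (j < bitlen n).
Proof.
move=> n0; rewrite ltnS; apply/idP/idP => [/trunc_log_max->//|h].
by apply: leq_trans (bitlen_le n0); rewrite leq_exp2l.
Qed.

End Arithmetic.

Definition bval (l : seq bool) : nat := foldl (fun v (b : bool) => 2 * v + b) 0 l.

Lemma bval_rcons l b : bval (rcons l b) = 2 * bval l + b.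
Proof. by rewrite /bval -cats1 foldl_cat. Qed.

Lemma bval_lt l : bval l < 2 ^ size l.
Proof.
elim/last_ind: l => // l b IH; rewrite bval_rcons size_rcons expnS.
by case: b; lia.
Qed.

Section Setup.
Variables (R : realType) (M n : nat).
Hypotheses (n0 : 0 < n) (hM : 2 * n < M).
Local Notation L := (bitlen n).
Local Notation runs := (@runs R M).

(** The machine has no logarithm: powers of two are doubled past [n], in a loop of [n] passes that
    idles once the bit length is reached. Both programs begin with it, since registers do not
    survive between them. *)
Definition setup (K : nat) : prog :=
  Seq (Assign 2 (Const 1))
  (Seq (For 3 0
         (If (Le (Reg 2) (Reg 0))
             (Seq (Assign 2 (Mul (Const 2) (Reg 2))) (Assign 1 (Add (Reg 1) (Const 1))))
             Skip))
       (Assign 2 (Mul (Reg 0) (Mul (Const K) (Reg 1))))).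

Lemma setup_runs K st : n * (K * L) < M -> K < M -> reg st 0 = n -> reg st 1 = 0 ->
  runs (setup K) st (n * 5 + 5)
    (fun st' => reg st' 1 = L /\ reg st' 2 = n * (K * L)).
Proof.
move=> hK KM h0 h1; have M2 : 2 < M by lia.
apply: (@runs_le _ _ _ _ (1 + (n * 5 + 3 + 1))); last lia.
apply: runs_seq; apply: runs_assign; apply: runs_then.
  apply: (@runs_for_const _ _ _ _ _ 3
    (fun k st => reg st 1 = minn k L /\ reg st 2 = 2 ^ minn k L) _ n) => //; try by lia.
    by ev; rewrite h1 min0n modn_small // ltnW.
  move=> k st1 kn f _ [e1 e2].
  have r0 : reg st1 0 = n by rewrite (frame_reg f) //; ev.
  apply: (@runs_le _ _ _ _ (maxn 2 1).+1) => //.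
  apply: runs_if; rewrite /= e2 r0 exp2_leq // => h.
    have kL : k < L by move: h; rewrite gtn_min ltnn orbF.
    have h2 : 2 ^ k <= n by rewrite exp2_leq.
    apply: (@runs_seq _ _ _ _ _ 1 1); apply: runs_assign; apply: runs_assign; ev.
    rewrite e1 e2 (minn_idPl kL) (minn_idPl (ltnW kL)) expnS.
    by rewrite [2 %% M]modn_small // [1 %% M]modn_small ?addn1 ?modn_small //; lia.
  apply: runs_skip; ev; rewrite e1 e2.
  have kL : L <= k by move: h; rewrite gtn_min ltnn orbF -leqNgt.
  by rewrite (minn_idPr kL) (minn_idPr (leqW kL)).
move=> st1 f [e1 e2]; apply: runs_assign; ev.
have r0 : reg st1 0 = n by rewrite (frame_reg f) //; ev.
rewrite r0 e1 (minn_idPr (bitlen_leq n0)) [K %% M]modn_small //.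
have [l0|l0] := posnP n; first lia.
by rewrite [K * L %% M]modn_small ?modn_small //; nia.
Qed.

Definition sample (r : seq bool) (j : nat) : nat := bval (take L (drop (j * L) r)).

Definition sampling : prog :=
  For 3 0
    (Seq (Assign 4 (Const 0))
    (Seq (For 5 1 (Seq (Flip 6) (Assign 4 (Add (Mul (Const 2) (Reg 4)) (Reg 6)))))
         (Store 2 (Reg 3) (Reg 4)))).

Lemma exp2_bitlen : 2 ^ L <= 2 * n.
Proof. by rewrite /bitlen expnS leq_mul2l trunc_logP ?orbT. Qed.

Lemma sampling_runs st : size (coins st) = n * L ->
  reg st 0 = n -> reg st 1 = L ->
  runs sampling st (n * (L * 4 + 7) + 3)
    (fun st' => forall j, j < n -> arr st' 2 j = sample (coins st) j).
Proof.
move=> hs h0 h1.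
have LM : L < M by have := bitlen_leq n0; lia.
apply: (@runs_le _ _ _ _ (n * (L * 4 + 5 + 2) + 3)); last by rewrite -addnA.
apply: runs_imp (_ : runs sampling st _ (fun st' => coins st' = drop (n * L) (coins st) /\
  forall j, j < n -> arr st' 2 j = sample (coins st) j)) _; last by move=> st' _ [].
apply: (@runs_for_const _ _ _ _ _ (L * 4 + 5)
  (fun k st' => coins st' = drop (k * L) (coins st) /\
     forall j, j < k -> arr st' 2 j = sample (coins st) j) _ n) => //; try by lia.
  by rewrite mul0n drop0.
move=> k st1 kn f rk [ec ea].
have r0 : reg st1 0 = n by rewrite (frame_reg f).
have r1 : reg st1 1 = L by rewrite (frame_reg f).
set r := drop (k * L) (coins st) in ec.
have sr : L <= size r.
  by rewrite size_drop hs -mulnBl leq_pmull // subn_gt0.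
apply: (@runs_le _ _ _ _ (1 + (L * 4 + 3 + 1))); last lia.
apply: runs_seq; apply: runs_assign; apply: runs_then.
  apply: (@runs_for_const _ _ _ _ _ 2
    (fun b st' => coins st' = drop b r /\ reg st' 4 = bval (take b r)) _ L) => //.
    by ev; rewrite take0 drop0 mod0n.
  move=> b st2 bL f2 rb [ec2 e4].
  have br : b < size r by apply: leq_trans sr.
  apply: (@runs_seq _ _ _ _ _ 1 1); apply: (@runs_flip _ _ _ _ (nth false r b) (drop b.+1 r)).
    by rewrite ec2 (drop_nth false).
  apply: runs_assign; ev; split=> //.
  rewrite (take_nth false) // bval_rcons e4.
  have := bval_lt (rcons (take b r) (nth false r b)).
  rewrite bval_rcons size_rcons size_take br => hlt.
  have : 2 ^ b.+1 <= 2 ^ L by rewrite leq_exp2l.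
  have := exp2_bitlen => h2 h3.
  by rewrite [2 %% M]modn_small ?[2 * _ %% M]modn_small ?modn_small //; lia.
move=> st2 f2 [ec2 e4]; apply: runs_store; ev.
have r3 : reg st2 3 = k by rewrite (frame_reg f2) //; ev.
have a2 : arr st2 2 = arr st1 2 by rewrite (frame_arr f2).
split; first by rewrite ec2 /r drop_drop mulSn.
move=> j; rewrite ltnS leq_eqVlt r3 => /predU1P[->|jk]; first by rewrite eqxx e4.
by rewrite ltn_eqF // a2 ea.
Qed.

End Setup.

(** * Bellman-Ford on the machine *)

Definition wexp (dir : bool) (u v : wordexp) : weightexp :=
  WGet 0 (if dir then idx v u else idx u v).

(** Parents are addressed by slot, round and node. Every slot owns [n * lam] rows although it fills
    only [hops i] of them, which avoids prefix sums in addresses. *)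
Definition pidx (k t : wordexp) : wordexp := idx (Add (Mul (Reg 3) (Reg 2)) k) t.

Definition par_arr (dir : bool) : nat := if dir then 7 else 6.
Definition dist_arr (dir : bool) : nat := if dir then 4 else 3.

Definition bf_relax (dir : bool) : prog :=
  let e := WAdd (WGet 2 (idx (Reg 6) (Reg 8))) (wexp dir (Reg 8) (Reg 7)) in
  If (WLe (WGet 2 (Reg 10)) e) Skip (Seq (WStore 2 (Reg 10) e) (Assign 9 (Reg 8))).

(** Every round has a row of its own in weight array 2, so a round never reads its own results and
    [k] rounds account for at most [k] arcs. *)
Definition bf_node (dir : bool) : prog :=
  Seq (Assign 9 (Reg 7))
  (Seq (Assign 10 (idx (Add (Reg 6) (Const 1)) (Reg 7)))
  (Seq (WStore 2 (Reg 10) (WGet 2 (idx (Reg 6) (Reg 7))))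
  (Seq (If (Le (Get 3 (Reg 7)) (Const 0)) (For 8 0 (bf_relax dir)) Skip)
       (Store (par_arr dir) (pidx (Reg 6) (Reg 7)) (Reg 9))))).

Definition bf_init : prog :=
  Seq (For 7 0 (WStore 2 (Reg 7) WInfty)) (WStore 2 (Reg 5) WZero).

Definition bf_save (dir : bool) : prog :=
  For 7 0 (WStore (dist_arr dir) (idx (Reg 3) (Reg 7)) (WGet 2 (idx (Reg 4) (Reg 7)))).

Definition bf (dir : bool) : prog :=
  Seq bf_init (Seq (For 6 4 (For 7 0 (bf_node dir))) (bf_save dir)).

(** Bounds on all addresses and stored words, under which arithmetic modulo [M] is exact. For the
    counters a crude bound of one [slot_cap] per slot is enough here, without the potential. *)
Record fits (M n lam : nat) : Prop := Fits {
  fits_n : 0 < n;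
  fits_lay : (n * lam).+2 * n < M;
  fits_par : n * (n * lam) * n < M;
  fits_sq : n * n < M;
  fits_two : 4 * n < M;
  fits_cnt : n * (2 * n * n * lam.+1) + n < M;
  fits_tab : n * n * n.+1 * n < M }.

Section BFProgram.
Variables (R : realType) (M n lam : nat) (A : nat -> \bar R) (dir : bool).
Hypothesis hF : fits M n lam.
Local Notation n0 := (fits_n hF).
Local Notation hM1 := (fits_lay hF).
Local Notation hM2 := (fits_par hF).
Local Notation hM3 := (fits_sq hF).
Local Notation nl := (n * lam).
Local Notation runs := (@runs R M).
Local Notation w := (wdir A n dir).

Lemma n_lt_M : n < M. Proof. by apply: leq_ltn_trans hM3; rewrite leq_pmulr ?n0. Qed.

Lemma idxE (st : state R) a b i j m : reg st 0 = n ->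
  word_val M st a = i -> word_val M st b = j -> i < m -> j < n -> m * n <= M ->
  word_val M st (idx a b) = i * n + j.
Proof.
move=> h0 ha hb im jn hm; have := leq_trans (lt_idx im jn) hm => h.
by rewrite /= ha hb h0 [i * n %% M]modn_small ?modn_small //; lia.
Qed.

Lemma wexpE (st : state R) u v i j : reg st 0 = n -> warr st 0 = A ->
  word_val M st u = i -> word_val M st v = j -> i < n -> j < n ->
  weight_val M st (wexp dir u v) = w i j.
Proof.
move=> h0 hA hu hv hi hj; rewrite /wexp /wdir /weight_val hA; case: dir.
  by rewrite (idxE h0 hv hu hj hi (ltnW hM3)).
by rewrite (idxE h0 hu hv hi hj (ltnW hM3)).
Qed.

Lemma pidxE (st : state R) a b i k t : reg st 0 = n -> reg st 2 = nl -> reg st 3 = i ->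
  word_val M st a = k -> word_val M st b = t -> i < n -> k < nl -> t < n ->
  word_val M st (pidx a b) = (i * nl + k) * n + t.
Proof.
move=> h0 h2 h3 ha hb hi hk ht; have h := lt_idx hi hk; have hm := hM2.
have hle : n * nl <= n * nl * n by rewrite leq_pmulr ?n0.
apply: (idxE (m := n * nl) h0) => //; last exact: ltnW hM2.
by rewrite /= h2 h3 ha [i * nl %% M]modn_small ?modn_small //; lia.
Qed.

Definition bf_env (st : state R) (i H : nat) :=
  [/\ reg st 0 = n, reg st 2 = nl, reg st 3 = i & reg st 4 = H] /\ warr st 0 = A.

Lemma bf_env_frame p (st st' : state R) i H : frame p st st' ->
  all (fun x => x \notin regs_of p) [:: 0; 2; 3; 4] -> 0 \notin warrs_of p ->
  bf_env st i H -> bf_env st' i H.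
Proof.
move=> f /and5P[h0 h1 h2 h3 _] h4 [[e0 e1 e2 e3] e4].
by split; [rewrite !(frame_reg f) | rewrite (frame_warr f)].
Qed.

Lemma bf_relax_runs st i H k t : bf_env st i H -> k < nl -> t < n ->
  reg st 6 = k -> reg st 7 = t -> reg st 9 = t -> reg st 10 = k.+1 * n + t ->
  warr st 2 (k.+1 * n + t) = warr st 2 (k * n + t) ->
  runs (For 8 0 (bf_relax dir)) st (n * 5 + 3) (fun st' =>
    [/\ relax w (fun u => warr st 2 (k * n + u)) t n =
          (warr st' 2 (k.+1 * n + t), reg st' 9)
      & forall j, j != k.+1 * n + t -> warr st' 2 j = warr st 2 j]).
Proof.
move=> E kn tn r6 r7 r9 r10 e0.
set l := fun u => warr st 2 (k * n + u).
apply: (@runs_for_const _ _ _ _ _ 3 (fun m st' =>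
    [/\ relax w l t m = (warr st' 2 (k.+1 * n + t), reg st' 9)
      & forall j, j != k.+1 * n + t -> warr st' 2 j = warr st 2 j]) _ n) => //.
all: try first [exact: n_lt_M | by case: E => [[]] | by case: (dir)].
- by split=> //; rewrite /relax /= /upd /= e0 r9.
move=> m st1 mn f r8 [eq un].
have E1 : bf_env st1 i H by apply: bf_env_frame f _ _ E => //; case: (dir).
have s6 : reg st1 6 = k by rewrite (frame_reg f) //; case: (dir).
have s7 : reg st1 7 = t by rewrite (frame_reg f) //; case: (dir).
have s10 : reg st1 10 = k.+1 * n + t by rewrite (frame_reg f) //; case: (dir).
have we : weight_val M st1 (WAdd (WGet 2 (idx (Reg 6) (Reg 8))) (wexp dir (Reg 8) (Reg 7)))
    = (l m + w m t)%E.
  case: E1 => [[r0 _ _ _] hA].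
  rewrite -[LHS]/(weight_val M st1 (WGet 2 (idx (Reg 6) (Reg 8))) +
    weight_val M st1 (wexp dir (Reg 8) (Reg 7)))%E (wexpE r0 hA (i := m) (j := t)) //;
      congr (_ + _)%E.
  rewrite /l -un; last by rewrite neq_ltn mulSn; apply/orP; left; lia.
  rewrite /weight_val (idxE r0 (i := k) (j := m) (m := nl.+2)) ?(ltnW hM1) //; lia.
apply: (@runs_le _ _ _ _ (maxn 1 2).+1) => //.
have e1 : (relax w l t m).1 = warr st1 2 (reg st1 10) by rewrite eq s10.
have rS : relax w l t m.+1 = if (l m + w m t < (relax w l t m).1)%E
  then ((l m + w m t)%E, m) else relax w l t m by rewrite relaxS.
apply: runs_if; rewrite -[test_val _ _ _]/(weight_val M st1 (WGet 2 (Reg 10)) <=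
  weight_val M st1 (WAdd _ _))%E we => h.
  apply: runs_skip; split=> //=; rewrite rS e1.
  by rewrite ltNge h /= eq.
apply: (@runs_seq _ _ _ _ _ 1 1); apply: runs_wstore; apply: runs_assign; rewrite we.
ev; split; first by rewrite rS e1 ltNge h s10 eqxx r8.
by move=> j hj; rewrite s10 (negbTE hj) un.
Qed.

Variables (rmv : pred nat) (c : nat).
Local Notation lay := (lay n w rmv c).
Local Notation par := (par n w rmv c).
Hypothesis cn : c < n.

Lemma bf_node_runs st i H k t : bf_env st i H -> i < n -> k < nl -> t < n ->
  reg st 6 = k -> reg st 7 = t -> (forall v, v < n -> arr st 3 v = (rmv v : nat)) ->
  (forall u, u < n -> warr st 2 (k * n + u) = lay k u) ->
  runs (bf_node dir) st (n * 5 + 8) (fun st' =>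
    [/\ warr st' 2 (k.+1 * n + t) = lay k.+1 t,
        arr st' (par_arr dir) ((i * nl + k) * n + t) = par k t,
        forall j, j < k.+1 * n + t -> warr st' 2 j = warr st 2 j
      & forall j, j < (i * nl + k) * n + t -> arr st' (par_arr dir) j = arr st (par_arr dir) j]).
Proof.
move=> E hi kn tn r6 r7 hr hl; have M1 : 1 < M by have := n_lt_M; lia.
have [[r0 r2 r3 r4] hA] := E.
have hn := n_lt_M.
apply: (@runs_le _ _ _ _ (1 + (1 + (1 + ((maxn (n * 5 + 3) 1).+1 + 1))))); last by lia.
apply: runs_seq; apply: runs_assign; apply: runs_seq; apply: runs_assign.
rewrite (idxE (i := k.+1) (j := t) (m := nl.+2)) //; last 3 first.
- by ev; rewrite r6 [1 %% M]modn_small // addn1 modn_small //; have := hM1; have := n0; nia.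
- lia.
- exact: ltnW hM1.
apply: runs_seq; apply: runs_wstore.
have -> : word_val M (setr (setr st 9 (word_val M st (Reg 7))) 10 (k.+1 * n + t)) (Reg 10) =
  k.+1 * n + t.
  by ev.
rewrite /weight_val (idxE (i := k) (j := t) (m := nl.+2)) //; last 2 first.
- lia.
- exact: ltnW hM1.
rewrite [word_val M st (Reg 7)]/= r7.
set st1 := setw _ _ _ _.
have E1 : bf_env st1 i H by [].
have hadr u : u < n -> (k * n + u == k.+1 * n + t) = false.
  by move=> un; apply/negbTE; rewrite neq_ltn mulSn; apply/orP; left; lia.
have lk u : u < n -> warr st1 2 (k * n + u) = lay k u.
  by move=> un; rewrite /st1; ev; rewrite hadr // hl.
apply: (@runs_then _ _ _ _ _ _ _ (fun st' =>
   [/\ warr st' 2 (k.+1 * n + t) = lay k.+1 t, reg st' 9 = par k t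
      & forall j, j < k.+1 * n + t -> warr st' 2 j = warr st 2 j])).
  apply: runs_if => /=; rewrite mod0n leqn0 /st1; ev; rewrite r7 hr // eqb0 -/st1 => rt.
    apply: runs_imp (@bf_relax_runs st1 i H k t E1 kn tn r6 r7 _ _ _) _ => //.
      by rewrite /st1; ev; rewrite eqxx hadr.
    move=> st2 f [e un].
    have er : relax w (fun u => warr st1 2 (k * n + u)) t n = relax w (lay k) t n.
      exact: eq_relax.
    rewrite er in e; rewrite /= /par (negbTE rt) e; split=> // j hj.
    rewrite un ?ltn_eqF // /st1; ev; by rewrite ltn_eqF.
  apply: runs_skip; move: rt; rewrite negbK => rt.
  rewrite /= /par rt /st1; ev; rewrite eqxx hl //; split=> // j hj.
  by rewrite ltn_eqF.
move=> st2 f [e1 e2 un].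
have f9 x : x \in [:: 0; 2; 3; 6; 7] -> reg st2 x = reg st1 x.
  by rewrite !inE => hx; rewrite (frame_reg f) //; move: hx; do !case/predU1P=> [->|];
    try move/eqP->; case: (dir).
have [s0 s2 s3 [s6 s7]] : [/\ reg st2 0 = n, reg st2 2 = nl, reg st2 3 = i
    & reg st2 6 = k /\ reg st2 7 = t] by rewrite !f9.
apply: runs_store; rewrite (pidxE (i := i) (k := k) (t := t)) //.
ev; rewrite !eqxx; split=> // j hj; rewrite ltn_eqF //.
by rewrite (frame_arr f) //; case: (dir).
Qed.

Lemma bf_round_runs st i H k : bf_env st i H -> i < n -> k < nl ->
  reg st 6 = k -> (forall v, v < n -> arr st 3 v = (rmv v : nat)) ->
  (forall u, u < n -> warr st 2 (k * n + u) = lay k u) ->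
  runs (For 7 0 (bf_node dir)) st (n * (n * 5 + 10) + 3) (fun st' =>
    [/\ forall t, t < n -> warr st' 2 (k.+1 * n + t) = lay k.+1 t,
        forall t, t < n -> arr st' (par_arr dir) ((i * nl + k) * n + t) = par k t
      & forall j, j < (i * nl + k) * n -> arr st' (par_arr dir) j = arr st (par_arr dir) j]).
Proof.
move=> E hi kn r6 hr hl.
apply: (@runs_le _ _ _ _ (n * (n * 5 + 8 + 2) + 3)); last by rewrite -addnA.
apply: runs_imp; first apply: (@runs_for_const _ _ _ _ _ (n * 5 + 8) (fun t st' =>
    [/\ forall t', t' < t -> warr st' 2 (k.+1 * n + t') = lay k.+1 t',
        forall t', t' < t -> arr st' (par_arr dir) ((i * nl + k) * n + t') = par k t',
        forall j, j < k.+1 * n -> warr st' 2 j = warr st 2 j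
      & forall j, j < (i * nl + k) * n -> arr st' (par_arr dir) j = arr st (par_arr dir) j]) _ n)
        => //.
all: try first [exact: n_lt_M | by case: E => [[]] | by case: (dir)].
- move=> t st1 tn f r7 [h1 h2 h3 h4].
  have E1 : bf_env st1 i H by apply: bf_env_frame f _ _ E => //; case: (dir).
  have s6 : reg st1 6 = k by rewrite (frame_reg f) //; case: (dir).
  have s3 : arr st1 3 = arr st 3 by rewrite (frame_arr f) //; case: (dir).
  apply: runs_imp; first apply: (@bf_node_runs st1 i H k t) => //.
  + by rewrite s3.
  + by move=> u un; rewrite h3 ?hl // mulSn addnC ltn_add2r.
  move=> st2 _ [g1 g2 g3 g4] /=; split.
  + move=> t'; rewrite ltnS leq_eqVlt => /predU1P[->//|tt].
    by rewrite g3 ?ltn_add2l // h1.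
  + move=> t'; rewrite ltnS leq_eqVlt => /predU1P[->//|tt].
    by rewrite g4 ?ltn_add2l // h2.
  + by move=> j hj; rewrite g3 ?h3 // (leq_trans hj) // leq_addr.
  + by move=> j hj; rewrite g4 ?h4 // (leq_trans hj) // leq_addr.
- by move=> st' _ [].
Qed.

Lemma bf_runs st i H : bf_env st i H -> i < n -> H <= nl -> reg st 5 = c ->
  (forall v, v < n -> arr st 3 v = (rmv v : nat)) ->
  runs (bf dir) st (H * (n * (n * 5 + 10) + 5) + n * 6 + 10) (fun st' =>
    [/\ forall k t, k < H -> t < n -> arr st' (par_arr dir) ((i * nl + k) * n + t) = par k t,
        forall j, j < i * nl * n -> arr st' (par_arr dir) j = arr st (par_arr dir) j,
        forall t, t < n -> warr st' (dist_arr dir) (i * n + t) = lay H t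
      & forall j, j < i * n -> warr st' (dist_arr dir) j = warr st (dist_arr dir) j]).
Proof.
move=> E hi hH r5 hr; have [[r0 r2 r3 r4] hA] := E.
have hn := n_lt_M.
apply: (@runs_le _ _ _ _ ((n * 3 + 3 + 1) +
  ((H * (n * (n * 5 + 10) + 3 + 2) + 3) + (n * 3 + 3)))); last first.
  rewrite -!addnA; lia.
apply: (@runs_then _ _ _ _ _ _ _ (fun st' => (forall u, u < n -> warr st' 2 u = lay 0 u))).
  apply: runs_then.
    apply: (@runs_for_const _ _ _ _ _ 1 (fun t st' => forall u,
      u < t -> warr st' 2 u = +oo%E) _ n) => //.
    move=> t st1 tn f r7 I; apply: runs_wstore; ev => u.
    by rewrite ltnS leq_eqVlt r7 => /predU1P[->|ut]; rewrite ?eqxx // ltn_eqF // I.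
  move=> st1 f I; apply: runs_wstore; ev => u un.
  rewrite (frame_reg f) // r5; case: eqP => // _; exact: I.
move=> st1 f1 l0.
have E1 : bf_env st1 i H by apply: bf_env_frame f1 _ _ E.
have a1 a : arr st1 a = arr st a by rewrite (frame_arr f1).
apply: (@runs_then _ _ _ _ _ _ _ (fun st' => [/\
    forall t, t < n -> warr st' 2 (H * n + t) = lay H t,
    forall k t, k < H -> t < n -> arr st' (par_arr dir) ((i * nl + k) * n + t) = par k t
  & forall j, j < i * nl * n -> arr st' (par_arr dir) j = arr st (par_arr dir) j])).
  apply: (@runs_for_const _ _ _ _ _ _ (fun K st' => [/\
    forall t, t < n -> warr st' 2 (K * n + t) = lay K t,
    forall k t, k < K -> t < n -> arr st' (par_arr dir) ((i * nl + k) * n + t) = par k t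
  & forall j, j < i * nl * n -> arr st' (par_arr dir) j = arr st (par_arr dir) j]) _ H) => //.
  all: try first [by case: E1 => [[]] | by apply: leq_ltn_trans hM1; have := n0;
    nia | by case: (dir)].
  - by split=> // j _; rewrite /= a1.
  move=> k st2 kH f2 r6 [h1 h2 h3].
  have E2 : bf_env st2 i H by apply: bf_env_frame f2 _ _ E1 => //; case: (dir).
  have s3 : arr st2 3 = arr st 3 by rewrite (frame_arr f2) ?a1 //; case: (dir).
  apply: runs_imp; first apply: (@bf_round_runs st2 i H k) => //.
  + exact: leq_trans hH.
  + by rewrite s3.
  move=> st3 _ [g1 g2 g3]; split=> //.
    move=> k' t; rewrite ltnS leq_eqVlt => /predU1P[->|kk] tn; first exact: g2.
    rewrite -[LHS]/(arr st3 _ _) g3 ?h2 //; apply: lt_idx => //.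
    by rewrite ltn_add2l.
  move=> j hj; rewrite -[LHS]/(arr st3 _ _) g3 ?h3 //; apply: leq_trans hj _.
  by rewrite leq_mul2r leq_addr orbT.
move=> st2 f2 [h1 h2 h3].
have E2 : bf_env st2 i H by apply: bf_env_frame f2 _ _ E1 => //; case: (dir).
have w2 : warr st2 (dist_arr dir) = warr st (dist_arr dir).
  by rewrite (frame_warr f2) ?(frame_warr f1) //; case: (dir).
have I := @runs_for_const R M 7 0 (WStore (dist_arr dir) (idx (Reg 3) (Reg 7))
  (WGet 2 (idx (Reg 4) (Reg 7)))) 1
  (fun t st' => [/\ forall u, u < t -> warr st' (dist_arr dir) (i * n + u) = lay H u
                  & forall j, j < i * n -> warr st' (dist_arr dir) j = warr st (dist_arr dir) j])
                    st2 n.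
apply: runs_imp; first apply: I => //.
all: try first [by case: E2 => [[]] | by split=> //= j hj; rewrite w2].
- move=> t st3 tn f3 r7 [g1 g2].
  have E3 : bf_env st3 i H by apply: bf_env_frame f3 _ _ E2 => //; case: (dir).
  have w3 : warr st3 2 = warr st2 2 by rewrite (frame_warr f3) //; case: (dir).
  have [[s0 s2 s3 s4] _] := E3.
  apply: runs_wstore.
  rewrite (idxE (i := i) (j := t) (m := n)) //; last exact: ltnW hM3.
  rewrite /weight_val (idxE (i := H) (j := t) (m := nl.+2)) //; last exact: ltnW hM1;
    last by rewrite ltnS leqW.
  ev; split.
    move=> u; rewrite eqxx ltnS leq_eqVlt => /predU1P[->|ut]; first by rewrite eqxx w3 h1.
    by rewrite ltn_eqF ?ltn_add2l // g1.
  by move=> j hj; rewrite eqxx ltn_eqF ?g2 // (leq_trans hj) // leq_addr.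
- by move=> st3 f3 [g1 g2]; split=> //; move: h2 h3; rewrite (frame_arr f3) //; case: (dir).
Qed.

End BFProgram.

(* Follows the parents of register 11, running [visit] at every node met. *)
Definition walk (dir : bool) (visit : prog) : prog :=
  Seq visit
    (For 6 4
      (Seq (Assign 11 (Get (par_arr dir)
              (pidx (Defs.Sub (Defs.Sub (Reg 4) (Const 1)) (Reg 6)) (Reg 11))))
           visit)).

Definition bump : prog :=
  Store 4 (Reg 11) (Add (Get 4 (Reg 11)) (Add (Reg 3) (Const 1))).

Definition count_trails (dir : bool) : prog :=
  For 7 0
    (If (WLe WInfty (WGet (dist_arr dir) (idx (Reg 3) (Reg 7))))
        Skip (Seq (Assign 11 (Reg 7)) (walk dir bump))).

Definition choose_centre : prog :=
  Seq (Assign 10 (Const 0))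
  (Seq (Assign 5 (Const 0))
  (Seq (For 7 0
         (If (And (Le (Get 3 (Reg 7)) (Const 0)) (Le (Reg 10) (Get 4 (Reg 7))))
             (Seq (Assign 5 (Reg 7)) (Assign 10 (Add (Get 4 (Reg 7)) (Const 1)))) Skip))
  (Seq (Assign 9 (Get 2 (Div (Reg 3) (Const 2))))
       (If (And (Le (Mod (Reg 3) (Const 2)) (Const 0))
                (And (Not (Le (Reg 0) (Reg 9))) (Le (Get 3 (Reg 9)) (Const 0))))
           (Assign 5 (Reg 9)) Skip)))).

Section Walking.
Variables (R : realType) (M n lam : nat) (A : nat -> \bar R) (dir : bool).
Hypothesis hF : fits M n lam.
Local Notation n0 := (fits_n hF).
Local Notation hM1 := (fits_lay hF).
Local Notation nl := (n * lam).
Local Notation runs := (@runs R M).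
Local Notation w := (wdir A n dir).
Variables (rmv : pred nat) (c i : nat).
Hypothesis hi : i < n.
Local Notation lay := (lay n w rmv c).
Local Notation par := (par n w rmv c).
Local Notation trail := (trail n w rmv c).
Local Notation H := (hops n lam i).

Definition par_row (st : state R) := forall k t, k < H -> t < n ->
  arr st (par_arr dir) ((i * nl + k) * n + t) = par k t.

Definition walk_env (st : state R) :=
  [/\ reg st 0 = n, reg st 2 = nl, reg st 3 = i & reg st 4 = H].

Lemma hops_le : H <= nl.
Proof. by rewrite /hops leq_div. Qed.

(** A rule for visitors: [I s] speaks of the part [s] of the trail already visited, and must ignore
    registers 6 and 11, which the walk changes. The bound on multiplicities is for visitors that
    accumulate: partial sums stay below the final one, hence below [M]. *)
Lemma walk_runs (visit : prog) (T : nat) (I : seq nat -> state R -> Prop) st t :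
  {in [:: 0; 2; 3; 4; 6; 11], forall x, x \notin regs_of visit} ->
  par_arr dir \notin arrs_of visit ->
  (forall s st' x v, I s st' -> x = 6 \/ x = 11 -> I s (setr st' x v)) ->
  (forall s st' x, walk_env st' -> I s st' -> reg st' 11 = x -> x < n ->
     {subset rcons s x <= trail H t} ->
     (forall y, count_mem y (rcons s x) <= count_mem y (trail H t)) ->
     runs visit st' T (I (rcons s x))) ->
  walk_env st -> par_row st -> t < n -> reg st 11 = t -> I [::] st ->
  runs (walk dir visit) st (T + (H * (T + 3) + 3)) (I (trail H t)).
Proof.
move=> hx hp hI hv E P tn r11 I0; have M1 : 1 < M by have := hM1; have := n0; nia.
have HM : H < M by apply: leq_ltn_trans hops_le _; have := hM1; have := n0; nia.
have [r0 r2 r3 r4] := E.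
have tc : rcons [::] t ++ behead (trail H t) = trail H t by rewrite /= -trail_cons.
apply: runs_then.
  apply: (hv [::] st t) => //.
  - by move=> y hy; rewrite -tc mem_cat hy.
  - by move=> y; rewrite -tc count_cat leq_addr.
move=> st1 f1 I1.
apply: (@runs_le _ _ _ _ (H * (1 + T + 2) + 3)); last by rewrite leq_add2r leq_mul2l; lia.
(* What is left of the trail is again a trail, from the current node [x] with [H - j] rounds to
   go. *)
apply: runs_imp; first apply: (@runs_for_const _ _ _ _ _ (1 + T) (fun j st' =>
    exists s x, [/\ rcons s x ++ behead (trail (H - j) x) = trail H t, x < n,
      reg st' 11 = x & I (rcons s x) st']) _ H).
- by rewrite /= hx.
- by rewrite /= inE hx.
- by [].
- by rewrite (frame_reg f1) // hx.
- by [].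
- exists [::], t; rewrite subn0; split=> //; first by ev; rewrite (frame_reg f1) ?hx.
  by apply: hI => //; left.
- move=> j st2 jH f2 r6 [s [x [e xn s11 I2]]].
  have s0 : forall y, y \in [:: 0; 2; 3; 4] -> reg st2 y = reg st y.
    move=> y hy; have hy' : y \in [:: 0; 2; 3; 4; 6; 11].
      by move: hy; rewrite !inE => /or4P[] /eqP ->.
    rewrite (frame_reg f2) ?(frame_reg f1) ?hx //.
    rewrite /= !inE mem_cat !inE (negbTE (hx _ hy')).
    by move: hy; rewrite !inE => /or4P[] /eqP ->.
  have E2 : walk_env st2 by split; rewrite s0.
  have pa : arr st2 (par_arr dir) = arr st (par_arr dir).
    by rewrite (frame_arr f2) ?(frame_arr f1) //= cats0.
  have [q0 q2 q3 q4] := E2.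
  apply: runs_seq; apply: runs_assign.
  rewrite getE.
  have e1 : word_val M st2 (Defs.Sub (Defs.Sub (Reg 4) (Const 1)) (Reg 6)) = H - j.+1.
    by rewrite /= q4 r6 modn_small // -subnDA.
  have hlt : H - j.+1 < H by rewrite ltn_subrL (leq_ltn_trans _ jH).
  rewrite (pidxE hF (b := Reg 11) q0 q2 q3 e1 s11 hi _ xn); last exact: leq_trans hops_le.
  rewrite pa P //.
  set x' := par _ x.
  have x'n : x' < n by apply: par_lt.
  have e' : rcons (rcons s x) x' ++ behead (trail (H - j.+1) x') = trail H t.
    rewrite -e -[in LHS]cats1 -catA -[[:: _] ++ _]/(_ :: behead _) -trail_cons.
    by rewrite -[H - j](@subnSK j H) //.
  apply: runs_imp; first apply: (hv (rcons s x) _ x') => //.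
  + by apply: hI => //; right.
  + by move=> y hy; rewrite -e' mem_cat hy.
  + by move=> y; rewrite -e' count_cat leq_addr.
  move=> st3 f3 I3; exists (rcons s x), x'; split=> //.
    by ev; rewrite (frame_reg f3) ?hx.
  by apply: hI => //; left.
move=> st2 _ [s [x [e _ _ I2]]].
by rewrite -e subnn /= cats0.
Qed.

Lemma count_trails_runs st : walk_env st -> par_row st ->
  (forall t, t < n -> warr st (dist_arr dir) (i * n + t) = lay H t) ->
  (forall x, x < n -> arr st 4 x + load A n lam i rmv c dir x < M) ->
  runs (count_trails dir) st (n * (H * 4 + 8) + 3) (fun st' =>
    forall x, x < n -> arr st' 4 x = arr st 4 x + load A n lam i rmv c dir x).
Proof.
move=> E P hd hc; have M1 : 1 < M by have := hM1; have := n0; nia.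
have hn : n < M by apply: n_lt_M hF.
apply: (@runs_le _ _ _ _ (n * ((maxn 1 (1 + (1 + (H * (1 + 3) + 3)))).+1 + 2) + 3)); last by lia.
apply: runs_imp; first apply: (@runs_for_const _ _ _ _ _ _ (fun m st' =>
    forall x, x < n -> arr st' 4 x = arr st 4 x +
      i.+1 * \sum_(t < m) visits A n lam i rmv c dir t x) _ n).
- by [].
- by [].
- by [].
- by case: E.
- exact: hn.
- by move=> x xn; rewrite big_ord0 muln0 addn0.
- move=> t st1 tn f1 r7 I.
  have E1 : walk_env st1 by case: E => *; split; rewrite (frame_reg f1).
  have [r0 r2 r3 r4] := E1.
  have dd : word_val M st1 (idx (Reg 3) (Reg 7)) = i * n + t.
    by apply: (idxE (m := n)) => //; apply: ltnW (fits_sq hF).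
  have visE x : visits A n lam i rmv c dir t x =
      if (lay H t < +oo)%E then count_mem x (trail H t) else 0 by [].
  apply: runs_if; rewrite -[test_val _ _ _]/(+oo <=
    warr st1 (dist_arr dir) (word_val M st1 (idx (Reg 3) (Reg 7))))%E dd;
    rewrite (frame_warr f1) // hd // leye_eq => fin.
    apply: runs_skip => x xn; rewrite /= I // big_ord_recr /= visE.
    by rewrite (eqP fin) ltxx addn0.
  apply: runs_seq; apply: runs_assign.
  apply: runs_imp; first apply: (@walk_runs _ _ (fun s st' => forall x, x < n ->
      arr st' 4 x = arr st1 4 x + i.+1 * count_mem x s) _ t) => //.
  + by case: (dir).
  + move=> s st2 x [q0 q2 q3 q4] I2 r11 xn _ hcnt; apply: runs_store; ev.
    move=> y yn; rewrite r11 q3.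
    have -> : (count_mem y) (rcons s x) = count_mem y s + (x == y).
      by rewrite -cats1 count_cat /= addn0.
    case: (altP (y =P x)) => [->|nxy]; last first.
      by rewrite I2 // [x == y]eq_sym (negbTE nxy) addn0.
    (* The partial count is at most the count in the whole trail of [t], and the trails up to [t]
       are part of the final load, which fits by [hc]. *)
    have hlt : arr st1 4 x + i.+1 * (count_mem x s).+1 < M.
      apply: leq_ltn_trans (hc x xn); rewrite I // -addnA -mulnDr leq_add2l leq_mul2l /=.
      apply: (@leq_trans (\sum_(t < t.+1) visits A n lam i rmv c dir t x)).
        rewrite big_ord_recr /= leq_add2l visE ltey fin.
        apply: leq_trans (hcnt x); rewrite -cats1 count_cat /= eqxx addn0 addn1.
        exact: leqnn.
      rewrite (big_ord_widen n (fun t => visits A n lam i rmv c dir t x) tn).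
      by rewrite [leqRHS](bigID (fun t0 : 'I_n => t0 < t.+1)) /= leq_addr.
    rewrite I2 // eqxx.
    rewrite [1 %% M]modn_small // addn1 [i.+1 %% M]modn_small; last by nia.
    by rewrite modn_small; lia.
  + move=> k u kH un; rewrite /= (frame_arr f1) ?P //; by case: (dir).
  + by move=> x xn; rewrite muln0 addn0.
  move=> st2 f2 I2 x xn; rewrite -[LHS]/(arr st2 4 x) I2 // I // -addnA -mulnDr.
  by rewrite big_ord_recr /= visE ltey fin.
- by [].
Qed.

End Walking.

(** * One slot of the preprocessing, and the loop over the slots *)

Definition slot : prog :=
  Seq choose_centre
  (Seq (Assign 4 (Div (Reg 2) (Add (Reg 3) (Const 1))))
  (Seq (Store 5 (Reg 3) (Reg 4))
  (Seq (bf false) (Seq (count_trails false)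
  (Seq (bf true) (Seq (count_trails true)
       (Store 3 (Reg 5) (Const 1)))))))).

Section SlotProgram.
Variables (R : realType) (M n lam : nat) (A : nat -> \bar R) (samp : nat -> nat).
Hypothesis hF : fits M n lam.
Local Notation n0 := (fits_n hF).
Local Notation nl := (n * lam).
Local Notation runs := (@runs R M).
Hypothesis A0 : forall i, (0 <= A i)%E.
Local Notation chosen := (chosen A n lam samp).
Local Notation cnt := (cnt A n lam samp).
Local Notation centre := (centre A n lam samp).
Local Notation hops := (hops n lam).
Local Notation sload := (sload A n lam samp).

Lemma four_lt_M : 4 < M.
Proof. by apply: leq_ltn_trans (fits_two hF); have := n0; lia. Qed.

Lemma choose_centre_runs st i (rm : pred nat) f : reg st 0 = n -> reg st 3 = i -> i < n ->
  (forall v, v < n -> arr st 3 v = (rm v : nat)) ->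
  (forall v, v < n -> arr st 4 v = f v) -> (forall v, v < n -> (f v).+1 < M) ->
  (forall j, j < n -> arr st 2 j = samp j) ->
  runs choose_centre st (n * 5 + 9) (fun st' => reg st' 5 = pick_centre n samp i rm f).
Proof.
move=> r0 r3 hi hr hf hfM hs; have M4 := four_lt_M.
apply: (@runs_le _ _ _ _ (1 + (1 + ((n * (3 + 2) + 3) + (1 + 2))))); last lia.
apply: runs_seq; apply: runs_assign; apply: runs_seq; apply: runs_assign.
apply: runs_then.
  apply: (@runs_for_const _ _ _ _ _ 3 (fun m st' =>
      select rm f m = (reg st' 5, reg st' 10)) _ n) => //.
    exact: n_lt_M hF.
    by rewrite /select; ev; rewrite mod0n.
  move=> t st1 tn f1 r7 e.
  have a1 a : arr st1 a = arr st a by rewrite (frame_arr f1).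
  apply: (@runs_le _ _ _ _ (maxn 2 1).+1) => //.
  have sS : select rm f t.+1 = select_step rm f (reg st1 5, reg st1 10) t.
    by rewrite -e /select -addn1 iotaD foldl_cat.
  have tv : test_val M st1 (And (Le (Get 3 (Reg 7)) (Const 0)) (Le (Reg 10) (Get 4 (Reg 7))))
      = ~~ rm t && (reg st1 10 <= f t).
    by rewrite /= !a1 r7 mod0n leqn0 hr // hf // eqb0.
  apply: runs_if; rewrite tv => h.
    apply: (@runs_seq _ _ _ _ _ 1 1); apply: runs_assign; apply: runs_assign.
    rewrite sS /select_step h; ev; rewrite a1 r7 hf // [1 %% M]modn_small //; last lia.
    by rewrite addn1 modn_small // hfM.
  by apply: runs_skip; rewrite sS /select_step (negbTE h).
move=> st1 f1 e.
have s0 : reg st1 0 = n by rewrite (frame_reg f1).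
have s3 : reg st1 3 = i by rewrite (frame_reg f1).
have a1 a : arr st1 a = arr st a by rewrite (frame_arr f1).
apply: runs_seq; apply: runs_assign.
have -> : word_val M st1 (Get 2 (Div (Reg 3) (Const 2))) = samp i./2.
  rewrite /= a1 s3 [2 %% M]modn_small ?divn2 ?hs //; last lia.
  by apply: leq_ltn_trans hi; rewrite -divn2 leq_div.
set st2 := setr _ _ _.
have tv : test_val M st2 (And (Le (Mod (Reg 3) (Const 2)) (Const 0))
    (And (Not (Le (Reg 0) (Reg 9))) (Le (Get 3 (Reg 9)) (Const 0)))) =
    [&& ~~ odd i, samp i./2 < n & ~~ rm (samp i./2)].
  rewrite /= /st2; ev; rewrite s0 s3 a1 mod0n [2 %% M]modn_small; last lia.
  rewrite modn2 leqn0 eqb0 -ltnNge; congr (_ && _).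
  by case: ltnP => // hsn; rewrite hr // leqn0 eqb0.
apply: (@runs_le _ _ _ _ (maxn 1 1).+1) => //.
apply: runs_if; rewrite tv /pick_centre => h.
  by apply: runs_assign; rewrite /st2; ev; rewrite h.
by apply: runs_skip; rewrite (negbTE h) e /st2; ev.
Qed.

Record built (m : nat) (st : state R) : Prop := Built {
  built_rem : forall v, v < n -> arr st 3 v = (v \in chosen m);
  built_cnt : forall x, x < n -> arr st 4 x = cnt m x;
  built_hop : forall j, j < m -> arr st 5 j = hops j;
  built_par : forall dir j k t, j < m -> k < hops j -> t < n ->
    arr st (par_arr dir) ((j * nl + k) * n + t) = spar A n lam samp j dir k t;
  built_dist : forall dir j t, j < m -> t < n ->
    warr st (dist_arr dir) (j * n + t) = sdist A n lam samp j dir t }.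

Lemma cnt_lt_M i x : i <= n -> x < n -> cnt i x + n < M.
Proof.
move=> hi xn; apply: leq_ltn_trans (fits_cnt hF); rewrite leq_add2r.
apply: (@leq_trans (i * slot_cap n lam)); last by rewrite leq_mul2r hi orbT.
elim: i hi => // i IH hi; rewrite cntS mulSn -addnA addnC leq_add ?slot_le ?n0 //.
exact: IH (ltnW hi).
Qed.

Definition slot_cost (H : nat) : nat := 80 * (H.+1 * (n * n)).

Lemma slot_runs st i : i < n -> reg st 0 = n -> reg st 2 = nl -> reg st 3 = i ->
  warr st 0 = A -> (forall j, j < n -> arr st 2 j = samp j) -> built i st ->
  runs slot st (slot_cost (hops i)) (built i.+1).
Proof.
move=> hi r0 r2 r3 hA hs B; have M4 := four_lt_M.
have [cn cc] := centreP A lam samp hi.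
have hH : hops i <= nl by apply: hops_le.
set H := hops i in hH *.
set BT := H * (n * (n * 5 + 10) + 5) + n * 6 + 10.
set CT := n * (H * 4 + 8) + 3.
apply: (@runs_le _ _ _ _ ((n * 5 + 9) + (1 + (1 + (BT + (CT + (BT + (CT + 1)))))))); last first.
  by rewrite /slot_cost /BT /CT; have := n0; nia.
apply: runs_then.
  apply: (choose_centre_runs (i := i) (rm := mem (chosen i)) (f := cnt i)) => //.
  - exact: built_rem B.
  - exact: built_cnt B.
  - by move=> v vn; apply: leq_ltn_trans (cnt_lt_M (ltnW hi) vn); rewrite -addn1 leq_add2l n0.
move=> st1 f1 r5.
have a1 a : arr st1 a = arr st a by rewrite (frame_arr f1).
have w1 a : warr st1 a = warr st a by rewrite (frame_warr f1).
have E1 : [/\ reg st1 0 = n, reg st1 2 = nl & reg st1 3 = i] by split; rewrite (frame_reg f1).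
have {E1} [s0 s2 s3] := E1.
apply: runs_seq; apply: runs_assign.
have -> : word_val M st1 (Div (Reg 2) (Add (Reg 3) (Const 1))) = H.
  rewrite /= s2 s3 [1 %% M]modn_small ?addn1 ?modn_small //; last lia.
  by apply: leq_ltn_trans hi (n_lt_M hF).
apply: runs_seq; apply: runs_store.
set st2 := seta _ _ _ _.
have r52 : reg st2 5 = centre i by [].
have E2 : bf_env n lam A st2 i H by split; [split | rewrite -hA -w1].
have rem2 v : v < n -> arr st2 3 v = ((mem (chosen i)) v : nat).
  by move=> vn; rewrite /st2; ev; rewrite a1 (built_rem B).
have cnt2 x : x < n -> arr st2 4 x = cnt i x.
  by move=> xn; rewrite /st2; ev; rewrite a1 (built_cnt B).
have hop2 j : j < i.+1 -> arr st2 5 j = hops j.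
  rewrite ltnS leq_eqVlt /st2; ev; rewrite s3 => /predU1P[->|ji]; first by rewrite eqxx.
  by rewrite ltn_eqF // a1 (built_hop B).
have par2 dir j k t : j < i -> k < hops j -> t < n ->
    arr st2 (par_arr dir) ((j * nl + k) * n + t) = spar A n lam samp j dir k t.
  move=> ji kj tn; rewrite -(built_par B) // -a1 /st2.
  by ev; case: dir.
have dist2 dir j t : j < i -> t < n ->
    warr st2 (dist_arr dir) (j * n + t) = sdist A n lam samp j dir t.
  by move=> ji tn; rewrite -(built_dist B) // -w1.
apply: runs_then; first by apply: (bf_runs (c := centre i) (rmv := mem (chosen i)) false hF cn
  E2).
move=> st3 f3 [par3 upar3 dist3 udist3].
have E3 : bf_env n lam A st3 i H by apply: bf_env_frame f3 _ _ E2.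
have [[t0 t2 t3 t4] hA3] := E3.
apply: runs_then.
  apply: (count_trails_runs (c := centre i) (rmv := mem (chosen i)) (A := A) (dir := false) hF
    hi) => //.
  move=> x xn; rewrite (frame_arr f3) // cnt2 //.
  apply: leq_ltn_trans (cnt_lt_M hi xn); rewrite cntS; apply: leq_trans (leq_addr _ _).
  exact: leq_addr.
move=> st4 f4 cnt4.
have E4 : bf_env n lam A st4 i H by apply: bf_env_frame f4 _ _ E3.
have r54 : reg st4 5 = centre i by rewrite (frame_reg f4) // (frame_reg f3).
have rem4 v : v < n -> arr st4 3 v = ((mem (chosen i)) v : nat).
  by move=> vn; rewrite (frame_arr f4) // (frame_arr f3) // rem2.
apply: runs_then; first by apply: (bf_runs (c := centre i) (rmv := mem (chosen i)) true hF cn E4).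
move=> st5 f5 [par5 upar5 dist5 udist5].
have E5 : bf_env n lam A st5 i H by apply: bf_env_frame f5 _ _ E4.
have [[u0 u2 u3 u4] hA5] := E5.
have cnt5 x : x < n -> arr st5 4 x = cnt i x + sload i false x.
  by move=> xn; rewrite (frame_arr f5) // cnt4 // (frame_arr f3) // cnt2.
apply: runs_then.
  apply: (count_trails_runs (c := centre i) (rmv := mem (chosen i)) (A := A) (dir := true) hF hi)
    => //.
  move=> x xn; rewrite cnt5 //.
  by apply: leq_ltn_trans (cnt_lt_M hi xn); rewrite cntS leq_addr.
move=> st6 f6 cnt6.
apply: runs_store.
have r56 : reg st6 5 = centre i by rewrite (frame_reg f6) // (frame_reg f5).
rewrite -[word_val _ _ (Reg 5)]/(reg st6 5) r56 -[word_val _ _ _]/(1 %% M) modn_small; last lia.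
have par6 dir : arr st6 (par_arr dir) = arr (if dir then st5 else st3) (par_arr dir).
  case: dir; rewrite (frame_arr f6) //.
  by rewrite (frame_arr f5) // (frame_arr f4).
have dist6 dir : warr st6 (dist_arr dir) = warr (if dir then st5 else st3) (dist_arr dir).
  case: dir; rewrite (frame_warr f6) //.
  by rewrite (frame_warr f5) // (frame_warr f4).
(* Slot [i] writes its parents from address [i * nl * n] on, beyond the rows of all earlier
   slots. *)
have hlt j k t : j < i -> k < hops j -> t < n -> (j * nl + k) * n + t < i * nl * n.
  move=> ji kj tn; apply: lt_idx => //; apply: lt_idx => //.
  by apply: leq_trans kj _; apply: hops_le.
split.
- move=> v vn; ev; rewrite mem_chosenS; case: eqP => //= _.
  by rewrite (frame_arr f6) // (frame_arr f5) // rem4.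
- by move=> x xn; ev; rewrite cnt6 // cnt5 // cntS.
- by move=> j ji; ev; rewrite (frame_arr f6) // (frame_arr f5) // (frame_arr f4) //
    (frame_arr f3) // hop2.
- move=> dir j k t; rewrite ltnS leq_eqVlt => /predU1P[->|ji] kj tn.
    have -> : arr (seta st6 3 (centre i) 1) (par_arr dir) = arr st6 (par_arr dir) by case: dir.
    by rewrite par6; case: dir; [apply: par5 | apply: par3].
  have -> : arr (seta st6 3 (centre i) 1) (par_arr dir) = arr st6 (par_arr dir) by case: dir.
  rewrite par6 -par2 //; case: dir.
    by rewrite upar5 ?hlt // (frame_arr f4) // (frame_arr f3).
  by rewrite upar3 ?hlt.
- move=> dir j t; rewrite ltnS leq_eqVlt => /predU1P[->|ji] tn.
    by rewrite -[warr (seta _ _ _ _)]/(warr st6) dist6; case: dir; [apply: dist5 | apply: dist3].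
  have hd : j * n + t < i * n by apply: lt_idx.
  rewrite -[warr (seta _ _ _ _)]/(warr st6) dist6 -dist2 //; case: dir.
    by rewrite udist5 // (frame_warr f4) // (frame_warr f3).
  by rewrite udist3.
Qed.

Lemma slots_runs st : reg st 0 = n -> reg st 2 = nl -> warr st 0 = A ->
  (forall j, j < n -> arr st 2 j = samp j) ->
  (forall v, arr st 3 v = 0) -> (forall v, arr st 4 v = 0) ->
  runs (For 3 0 slot) st (\sum_(i < n) (slot_cost (hops i) + 2) + 3) (built n).
Proof.
move=> r0 r2 hA hs h3 h4.
apply: (@runs_for _ _ _ _ _ (fun i => slot_cost (hops i)) built _ n) => //.
- exact: n_lt_M hF.
- by split=> // v _; rewrite /= ?h3 ?h4.
move=> i st1 hi f r3 B.
apply: runs_imp; first apply: (@slot_runs st1 i) => //.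
- by rewrite (frame_reg f).
- by rewrite (frame_reg f).
- by rewrite (frame_warr f).
- by rewrite (frame_arr f).
by move=> st2 _ [].
Qed.

End SlotProgram.

(** The harmonic sum by dyadic blocks: from index [2 ^ l - 1] on there are [2 ^ l] terms of at most
    [a / 2 ^ l] each. *)
Lemma sum_div_le a n : \sum_(i < n) a %/ i.+1 <= a * bitlen n.
Proof.
have H l : \sum_(0 <= i < (2 ^ l).-1) a %/ i.+1 <= a * l.
  elim: l => [|l IH]; first by rewrite big_nil.
  have p0 : 0 < 2 ^ l by rewrite expn_gt0.
  rewrite (big_cat_nat (n := (2 ^ l).-1)) //=; last by rewrite expnS; lia.
  rewrite mulnS addnC leq_add //.
  apply: (@leq_trans (\sum_((2 ^ l).-1 <= i < (2 ^ l.+1).-1) a %/ 2 ^ l)).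
    rewrite big_nat_cond [leqRHS]big_nat_cond; apply: leq_sum => i.
    by rewrite andbT => /andP[h _]; apply: leq_div2l => //; lia.
  rewrite sum_nat_const_nat expnS.
  have -> : (2 * 2 ^ l).-1 - (2 ^ l).-1 = 2 ^ l by lia.
  by rewrite mulnC leq_trunc_div.
apply: leq_trans (H (bitlen n)); rewrite -(big_mkord xpredT (fun i => a %/ i.+1)).
have h := bitlen_gt n.
by rewrite [leqRHS](big_cat_nat (n := n)) //=; [apply: leq_addr | lia].
Qed.

(** * Range minima *)

(** The largest power of two up to each number, obtained from its half; queries look it up in
    constant time to choose their windows. *)
Definition powers : prog :=
  For 3 0
    (If (Le (Reg 3) (Const 0)) (Store 8 (Const 1) (Const 1))
        (Store 8 (Add (Reg 3) (Const 1))
           (Mul (Const 2) (Get 8 (Div (Add (Reg 3) (Const 1)) (Const 2)))))).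

Definition table_init : prog :=
  For 6 0 (WStore 5 (idx (Add (Reg 5) (Const 1)) (Reg 6))
                    (WAdd (WGet 4 (idx (Reg 6) (Reg 3))) (WGet 3 (idx (Reg 6) (Reg 4))))).

Definition table_step : prog :=
  let l := WGet 5 (idx (Add (Reg 5) (Reg 7)) (Reg 6)) in
  let r := WGet 5 (idx (Add (Reg 5) (Reg 7)) (Add (Reg 6) (Reg 7))) in
  let dst := idx (Add (Reg 5) (Mul (Const 2) (Reg 7))) (Reg 6) in
  If (Le (Add (Reg 6) (Mul (Const 2) (Reg 7))) (Reg 0))
     (If (WLe l r) (WStore 5 dst l) (WStore 5 dst r)) Skip.

Definition table_level : prog :=
  Seq (For 6 0 table_step) (Assign 7 (Mul (Const 2) (Reg 7))).

Definition table : prog :=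
  Seq (Assign 5 (Mul (idx (Reg 3) (Reg 4)) (Add (Reg 0) (Const 1))))
  (Seq table_init (Seq (Assign 7 (Const 1)) (For 8 1 table_level))).

Definition tables : prog := Seq powers (For 3 0 (For 4 0 table)).

Section RangeMinima.
Variables (R : realType) (key : nat -> \bar R).

Fixpoint rangemin (a i : nat) : \bar R :=
  if a is a'.+1 then
    let x := rangemin a' i in let y := rangemin a' (i + 2 ^ a') in
    if (x <= y)%E then x else y
  else key i.

Lemma rangemin_le a i j : i <= j -> j < i + 2 ^ a -> (rangemin a i <= key j)%E.
Proof.
elim: a i => [|a IH] i ij /=.
  rewrite addn1 ltnS => ji; have -> : i = j by apply/eqP; rewrite eqn_leq ij ji.
  exact: lexx.
rewrite expnS mul2n -addnn addnA => ji.
have [h|h] := ltnP j (i + 2 ^ a).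
  case: ifPn => [_|]; first exact: IH.
  by rewrite -ltNge => /ltW h'; apply: le_trans h' _; apply: IH.
case: ifP => [h'|_]; last exact: IH.
by apply: le_trans h' _; apply: IH.
Qed.

Lemma rangemin_ex a i : exists j, [/\ i <= j, j < i + 2 ^ a & rangemin a i = key j].
Proof.
elim: a i => [|a IH] i /=; first by exists i; rewrite addn1.
have [j [h1 h2 h3]] := IH i; have [k [h4 h5 h6]] := IH (i + 2 ^ a).
rewrite expnS mul2n -addnn addnA.
case: ifP => _; [exists j | exists k]; split=> //; first by apply: leq_trans (leq_addr _ _).
by apply: leq_trans h4; apply: leq_addr.
Qed.

End RangeMinima.

Section TableProgram.
Variables (R : realType) (M n lam : nat) (din dout : nat -> nat -> \bar R).
Hypothesis hF : fits M n lam.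
Local Notation n0 := (fits_n hF).
Local Notation runs := (@runs R M).
Local Notation L := (bitlen n).

Definition powers_ok (st : state R) :=
  forall m, 0 < m -> m <= n -> arr st 8 m = 2 ^ trunc_log 2 m.

Lemma powers_runs st : reg st 0 = n -> runs powers st (n * 4 + 3) powers_ok.
Proof.
move=> r0; have h4 := fits_two hF; have h0 := n0.
apply: (@runs_for_const _ _ _ _ _ 2 (fun k st' =>
  forall m, 0 < m -> m <= k -> arr st' 8 m = 2 ^ trunc_log 2 m) _ n) => //.
- exact: n_lt_M hF.
- by move=> m; case: m.
move=> k st1 kn f r3 I.
apply: (@runs_le _ _ _ _ (maxn 1 1).+1) => //.
apply: runs_if; rewrite /= r3 mod0n leqn0 => k0; apply: runs_store; ev.
  move=> m m0; rewrite (eqP k0) => m1; have -> : m = 1 by lia.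
  by rewrite modn_small ?trunc_log1 //; lia.
rewrite r3 [1 %% M]modn_small ?addn1; last lia.
rewrite [k.+1 %% M]modn_small; last lia.
rewrite [2 %% M]modn_small ?divn2; last lia.
move=> m m0; rewrite leq_eqVlt => /predU1P[->|mk]; last by rewrite ltn_eqF // I.
rewrite eqxx trunc_log2S; last by rewrite ltnS lt0n.
have hk : k.+1./2 <= k by rewrite -divn2; lia.
have hk0 : 0 < k.+1./2 by rewrite -divn2; lia.
rewrite I // -expnS modn_small //.
apply: leq_ltn_trans h4; apply: leq_trans (_ : 2 * k <= _); last lia.
by rewrite expnS leq_mul2l /=; apply: leq_trans hk; apply: trunc_logP.
Qed.

(** The window length [p = 2 ^ a] itself serves as the index of its level, so no logarithm is
    computed. Levels at other [p] are never touched and cost no time. *)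
Definition entry (b p i : nat) : nat := (b * n.+1 + p) * n + i.

Definition key (s t i : nat) : \bar R := (din i s + dout i t)%E.

Definition table_ok (st : state R) (s t a : nat) := forall a' i, a' <= a -> i + 2 ^ a' <= n ->
  warr st 5 (entry (s * n + t) (2 ^ a') i) = rangemin (key s t) a' i.

Lemma pair_lt s t : s < n -> t < n -> s * n + t < n * n.
Proof. exact: lt_idx. Qed.

Lemma entryE (st : state R) e f b p i : reg st 0 = n ->
  word_val M st e = b * n.+1 + p -> word_val M st f = i ->
  b < n * n -> p <= n -> i < n -> word_val M st (idx e f) = entry b p i.
Proof.
move=> r0 he hf hb hp hi; apply: (idxE (m := n * n * n.+1)) => //.
  by apply: lt_idx.
exact: ltnW (fits_tab hF).
Qed.

Lemma base_lt b p : b < n * n -> p <= n -> b * n.+1 + p < M.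
Proof.
move=> hb hp; apply: leq_ltn_trans (fits_tab hF).
apply: (@leq_trans (n * n * n.+1)); last by rewrite leq_pmulr ?n0.
by apply: ltnW; apply: lt_idx.
Qed.

Lemma table_step_runs st b a i (rm : nat -> nat -> \bar R) : reg st 0 = n -> reg st 5 =
  b * n.+1 ->
  reg st 7 = 2 ^ a -> a < L -> reg st 6 = i -> i < n -> b < n * n ->
  (forall j, j + 2 ^ a <= n -> warr st 5 (entry b (2 ^ a) j) = rm a j) ->
  (forall j, rm a.+1 j = if (rm a j <= rm a (j + 2 ^ a)%N)%E then rm a j else rm a (j + 2 ^ a)) ->
  runs table_step st 3 (fun st' =>
    (i + 2 ^ a.+1 <= n -> warr st' 5 (entry b (2 ^ a.+1) i) = rm a.+1 i) /\
    forall j, j < entry b (2 ^ a.+1) i -> warr st' 5 j = warr st 5 j).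
Proof.
move=> r0 r5 r7 aL r6 hi hb hl hrm; have h4 := fits_two hF.
have p2 : 2 ^ a.+1 <= 2 * n by rewrite expnS leq_mul2l exp2_leq ?n0.
have e2 : word_val M st (Mul (Const 2) (Reg 7)) = 2 ^ a.+1.
  by rewrite /= r7 [2 %% M]modn_small -?expnS ?modn_small //; have := n0; lia.
have tv : test_val M st (Le (Add (Reg 6) (Mul (Const 2) (Reg 7))) (Reg 0)) = (i + 2 ^ a.+1 <= n).
  by rewrite -[LHS]/((reg st 6 + word_val M st (Mul (Const 2) (Reg 7))) %% M <= reg st 0)
    e2 r0 r6 modn_small //; lia.
apply: (@runs_le _ _ _ _ (maxn (maxn 1 1).+1 1).+1) => //.
apply: runs_if; rewrite tv => h; last by apply: runs_skip; split=> // h'; rewrite h' in h.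
have pa : 2 ^ a.+1 = 2 ^ a + 2 ^ a by rewrite expnS mul2n addnn.
have ed : word_val M st (idx (Add (Reg 5) (Mul (Const 2) (Reg 7))) (Reg 6)) =
  entry b (2 ^ a.+1) i.
  have hp : 2 ^ a.+1 <= n by lia.
  apply: entryE => //.
  by rewrite -[LHS]/((reg st 5 + word_val M st (Mul (Const 2) (Reg 7))) %% M)
    e2 r5 modn_small // base_lt.
have e5 : word_val M st (Add (Reg 5) (Reg 7)) = b * n.+1 + 2 ^ a.
  by rewrite /= r5 r7 modn_small // base_lt //; lia.
have el : weight_val M st (WGet 5 (idx (Add (Reg 5) (Reg 7)) (Reg 6))) = rm a i.
  by rewrite wgetE (entryE (b := b) (p := 2 ^ a) (i := i)) ?hl //; lia.
have er : weight_val M st (WGet 5 (idx (Add (Reg 5) (Reg 7)) (Add (Reg 6) (Reg 7)))) =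
  rm a (i + 2 ^ a).
  have p0 : 0 < 2 ^ a by rewrite expn_gt0.
  have e67 : word_val M st (Add (Reg 6) (Reg 7)) = i + 2 ^ a.
    by rewrite /= r6 r7 modn_small //; lia.
  by rewrite wgetE (entryE (b := b) (p := 2 ^ a) (i := i + 2 ^ a)) ?hl //; lia.
have tv2 : test_val M st (WLe (WGet 5 (idx (Add (Reg 5) (Reg 7)) (Reg 6)))
    (WGet 5 (idx (Add (Reg 5) (Reg 7)) (Add (Reg 6) (Reg 7))))) =
      (rm a i <= rm a (i + 2 ^ a)%N)%E.
  by rewrite -el -er.
apply: runs_if; rewrite tv2 => hle; apply: runs_wstore; rewrite ed ?el ?er; ev.
  by rewrite eqxx hrm hle; split=> // j hj; rewrite ltn_eqF.
by rewrite eqxx hrm (negbTE hle); split=> // j hj; rewrite ltn_eqF.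
Qed.

Lemma table_runs st s t : reg st 0 = n -> reg st 1 = L -> reg st 3 = s -> reg st 4 = t ->
  s < n -> t < n ->
  (forall i v, i < n -> v < n -> warr st 4 (i * n + v) = din i v) ->
  (forall i v, i < n -> v < n -> warr st 3 (i * n + v) = dout i v) ->
  runs table st (n * 3 + L * (n * 5 + 6) + 8) (fun st' => table_ok st' s t L /\
    forall j, j < entry (s * n + t) 1 0 -> warr st' 5 j = warr st 5 j).
Proof.
move=> r0 r1 r3 r4 sn tn hin hout; have h4 := fits_two hF; have h0 := n0.
set b := s * n + t; have hb : b < n * n by apply: lt_idx.
have LM : L < M by have := bitlen_leq h0; lia.
apply: (@runs_le _ _ _ _ (1 + ((n * 3 + 3) + (1 + (L * (n * 5 + 3 + 1 + 2) + 3))))); last lia.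
apply: runs_seq; apply: runs_assign.
have -> : word_val M st (Mul (idx (Reg 3) (Reg 4)) (Add (Reg 0) (Const 1))) = b * n.+1.
  rewrite -[LHS]/((word_val M st (idx (Reg 3) (Reg 4)) * ((reg st 0 + 1 %% M) %% M)) %% M).
  rewrite (idxE (n := n) (i := s) (j := t) (m := n)) ?(ltnW (fits_sq hF)) //.
  rewrite r0 [1 %% M]modn_small ?addn1 ?[n.+1 %% M]modn_small ?modn_small //; try lia.
  by have := base_lt hb (leq0n n); rewrite addn0.
apply: runs_then.
  apply: (@runs_for_const _ _ _ _ _ 1 (fun m st' =>
    (forall i, i < m -> warr st' 5 (entry b 1 i) = key s t i) /\
    forall j, j < entry b 1 0 -> warr st' 5 j = warr st 5 j) _ n) => //.
    exact: n_lt_M hF.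
  move=> i st1 hi f r6 [I1 I2]; apply: runs_wstore.
  have s0 : reg st1 0 = n by rewrite (frame_reg f).
  have s3 : reg st1 3 = s by rewrite (frame_reg f).
  have s4 : reg st1 4 = t by rewrite (frame_reg f).
  have s5 : reg st1 5 = b * n.+1 by rewrite (frame_reg f).
  rewrite (entryE (b := b) (p := 1) (i := i)) //; last first.
    by rewrite /= s5 [1 %% M]modn_small ?modn_small ?base_lt //; lia.
  rewrite -[weight_val _ _ _]/(warr st1 4 (word_val M st1 (idx (Reg 6) (Reg 3))) +
    warr st1 3 (word_val M st1 (idx (Reg 6) (Reg 4))))%E.
  rewrite (idxE (n := n) (i := i) (j := s) (m := n)) ?(ltnW (fits_sq hF)) //.
  rewrite (idxE (n := n) (i := i) (j := t) (m := n)) ?(ltnW (fits_sq hF)) //.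
  rewrite !(frame_warr f) //= hin // hout //.
  ev; split=> [i'|j hj]; last first.
    by rewrite ltn_eqF ?I2 // (leq_trans hj) // /entry addn0 leq_addr.
  rewrite ltnS leq_eqVlt => /predU1P[->|ii]; first by rewrite eqxx.
  by rewrite ltn_eqF ?I1 // /entry ltn_add2l.
move=> st1 f1 [I1 I2].
apply: runs_seq; apply: runs_assign.
have -> : word_val M st1 (Const 1) = 1 by rewrite /= modn_small //; lia.
have f1r x : x != 6 -> reg st1 x = reg (setr st 5 (b * n.+1)) x.
  by move=> hx; rewrite (frame_reg f1) // !inE (negbTE hx).
apply: runs_imp; first apply: (@runs_for_const _ _ _ _ _ (n * 5 + 3 + 1) (fun a st' =>
    [/\ reg st' 7 = 2 ^ a, table_ok st' s t a &
    forall j, j < entry b 1 0 -> warr st' 5 j = warr st 5 j]) _ L).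
- by [].
- by [].
- by [].
- by ev; rewrite f1r.
- exact: LM.
- split=> // a' i; rewrite leqn0 => /eqP ->; rewrite expn0 addn1 => hi.
  by rewrite -[LHS]/(warr st1 5 _) I1.
- move=> a st2 aL f2 r8 [r7 T2 U2].
  have s0 : reg st2 0 = n by rewrite (frame_reg f2) //; ev; rewrite f1r.
  have s5 : reg st2 5 = b * n.+1 by rewrite (frame_reg f2) //; ev; rewrite f1r.
  apply: runs_then.
    apply: (@runs_for_const _ _ _ _ _ 3 (fun m st' =>
      (forall i, i < m -> i + 2 ^ a.+1 <= n ->
         warr st' 5 (entry b (2 ^ a.+1) i) = rangemin (key s t) a.+1 i) /\
      forall j, j < entry b (2 ^ a.+1) 0 -> warr st' 5 j = warr st2 5 j) _ n) => //.
      exact: n_lt_M hF.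
    move=> i st3 hi f3 r6 [J1 J2].
    apply: runs_imp; first apply: (@table_step_runs st3 b a i (rangemin (key s t))) => //.
    + by rewrite (frame_reg f3).
    + by rewrite (frame_reg f3).
    + by rewrite (frame_reg f3).
    + move=> j hj; rewrite J2; first exact: T2.
      rewrite /entry addn0; apply: (@leq_trans ((b * n.+1 + 2 ^ a).+1 * n)).
        by apply: lt_idx => //; have := ltn_expl a (isT : 1 < 2); lia.
      rewrite leq_mul2r -addnS leq_add2l expnS; apply/orP; right.
      by have := ltn_expl a (isT : 1 < 2); lia.
    move=> st4 _ [K1 K2]; split=> [i'|j hj].
      rewrite ltnS leq_eqVlt => /predU1P[-> //|ii] hi'.
      by rewrite -[LHS]/(warr st4 5 _) K2 ?J1 // /entry ltn_add2l.
    rewrite -[LHS]/(warr st4 5 _) K2 ?J2 // (leq_trans hj) // /entry addn0.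
    exact: leq_addr.
  move=> st3 f3 [J1 J2]; apply: runs_assign.
  have p2 : 2 ^ a.+1 <= 2 * n by rewrite expnS leq_mul2l exp2_leq.
  have s7 : reg st3 7 = 2 ^ a by rewrite (frame_reg f3).
  split.
  + by ev; rewrite s7 [2 %% M]modn_small -?expnS ?modn_small //; lia.
  + move=> a' i; rewrite leq_eqVlt => /predU1P[->|aa] hi.
      rewrite -[LHS]/(warr st3 5 _) J1 //.
      by have := ltn_expl a.+1 (isT : 1 < 2); lia.
    rewrite -[LHS]/(warr st3 5 _) J2; first exact: T2.
    rewrite /entry addn0; apply: (@leq_trans ((b * n.+1 + 2 ^ a').+1 * n)).
      by apply: lt_idx => //; have := ltn_expl a' (isT : 1 < 2); lia.
    by rewrite leq_mul2r -addnS leq_add2l ltn_exp2l ?aa ?orbT.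
  + move=> j hj; rewrite -[LHS]/(warr st3 5 _) J2 ?U2 //.
    apply: leq_trans hj _; rewrite /entry !addn0 leq_mul2r leq_add2l expn_gt0.
    by rewrite orbT.
- by move=> st2 _ [_ T U].
Qed.

Lemma tables_runs st : reg st 0 = n -> reg st 1 = L ->
  (forall i v, i < n -> v < n -> warr st 4 (i * n + v) = din i v) ->
  (forall i v, i < n -> v < n -> warr st 3 (i * n + v) = dout i v) ->
  runs tables st (n * n * n * L * 40 + 20) (fun st' => powers_ok st' /\
    forall s t, s < n -> t < n -> table_ok st' s t L).
Proof.
move=> r0 r1 hin hout; have h0 := n0.
have L0 : 0 < L by [].
set TT := n * 3 + L * (n * 5 + 6) + 8.
apply: (@runs_le _ _ _ _ ((n * 4 + 3) + (n * (n * (TT + 2) + 3 + 2) + 3))); last first.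
  have h : TT + 2 <= 24 * (L * n) by rewrite /TT; nia.
  have h2 : n * (TT + 2) + 3 + 2 <= 29 * (n * (L * n)) by nia.
  have : n * (n * (TT + 2) + 3 + 2) <= 29 * (n * (n * (L * n))) by nia.
  have : n <= n * (n * (L * n)) by nia.
  lia.
apply: runs_then; first exact: powers_runs.
move=> st1 f1 P1.
have s0 : reg st1 0 = n by rewrite (frame_reg f1).
have s1 : reg st1 1 = L by rewrite (frame_reg f1).
have hin1 i v : i < n -> v < n -> warr st1 4 (i * n + v) = din i v.
  by move=> hi hv; rewrite (frame_warr f1) // hin.
have hout1 i v : i < n -> v < n -> warr st1 3 (i * n + v) = dout i v.
  by move=> hi hv; rewrite (frame_warr f1) // hout.
(* The table of an earlier pair ends before the first cell of the current one. *)
have keep st' s t s' t' : s < n -> t < n -> s' * n + t' < s * n + t ->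
    t' < n -> (forall (st'' : state R), (forall j, j < entry (s * n + t) 1 0 ->
      warr st'' 5 j = warr st' 5 j) -> table_ok st' s' t' L -> table_ok st'' s' t' L).
  move=> sn tn lt tn' st'' U T a i aL hi; rewrite U ?T //.
  rewrite /entry addn0; apply: (@leq_trans (((s' * n + t') * n.+1 + 2 ^ a).+1 * n)).
    by apply: lt_idx => //; have := ltn_expl a (isT : 1 < 2); lia.
  have h2 : 2 ^ a <= n by lia.
  rewrite leq_mul2r; apply/orP; right; nia.
apply: runs_imp; first apply: (@runs_for_const _ _ _ _ _ (n * (TT + 2) + 3) (fun m st' =>
   forall s t, s < m -> t < n -> table_ok st' s t L) _ n).
- by [].
- by [].
- by [].
- by [].
- exact: n_lt_M hF.
- by [].
- move=> s st2 sn f2 r3 I.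
  apply: runs_imp; first apply: (@runs_for_const _ _ _ _ _ TT (fun m st' =>
    (forall s' t, s' < s -> t < n -> table_ok st' s' t L) /\
    forall t, t < m -> table_ok st' s t L) _ n).
  + by [].
  + by [].
  + by [].
  + by rewrite (frame_reg f2).
  + exact: n_lt_M hF.
  + by split.
  + move=> t st3 tn f3 r4 [J1 J2].
    apply: runs_imp; first apply: (@table_runs st3 s t) => //.
    * by rewrite (frame_reg f3) // (frame_reg f2).
    * by rewrite (frame_reg f3) // (frame_reg f2).
    * by rewrite (frame_reg f3).
    * by move=> i v hi hv; rewrite (frame_warr f3) // (frame_warr f2) // hin1.
    * by move=> i v hi hv; rewrite (frame_warr f3) // (frame_warr f2) // hout1.
    move=> st4 _ [K1 K2]; split=> [s' t' ss tn'|t'].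
      apply: (keep st3 s t s' t' sn tn _ tn' (setr st4 4 t.+1) K2); last exact: J1.
      by apply: (@leq_trans (s'.+1 * n)); [rewrite mulSn addnC ltn_add2r | nia].
    rewrite ltnS leq_eqVlt => /predU1P[->//|tt].
    apply: (keep st3 s t s t' sn tn _ (ltn_trans tt tn) (setr st4 4 t.+1) K2); last exact: J2.
    by rewrite ltn_add2l.
  move=> st3 _ [J1 J2] s' t'; rewrite ltnS leq_eqVlt => /predU1P[->|ss]; first exact: J2.
  exact: J1.
- move=> st2 f2 I; split=> // m m0 mn.
  by rewrite (frame_arr f2) // P1.
Qed.

End TableProgram.

(** * Repairing the stored distances *)

Definition aff_arr (dir : bool) : nat := if dir then 10 else 9.

Definition look : prog := If (Le (Get 0 (Reg 11)) (Const 0)) Skip (Assign 12 (Const 1)).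

Definition mark (dir : bool) : prog :=
  For 7 0
    (Seq (Assign 12 (Const 0))
    (Seq (Assign 11 (Reg 7))
    (Seq (If (WLe WInfty (WGet (dist_arr dir) (idx (Reg 3) (Reg 7)))) Skip (walk dir look))
         (Store (aff_arr dir) (idx (Reg 3) (Reg 7)) (Reg 12))))).

(** All affected entries become infinite, but only survivors are listed for repair. Deleted nodes
    thus stay at [+oo] and never become intermediate nodes. *)
Definition collect_node (dir : bool) : prog :=
  If (Le (Get (aff_arr dir) (idx (Reg 3) (Reg 7))) (Const 0)) Skip
     (Seq (WStore (dist_arr dir) (idx (Reg 3) (Reg 7)) WInfty)
          (If (Le (Get 0 (Reg 7)) (Const 0))
              (Seq (Store 11 (Reg 13) (Reg 7)) (Assign 13 (Add (Reg 13) (Const 1)))) Skip)).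

Definition collect (dir : bool) : prog :=
  Seq (Assign 13 (Const 0)) (For 7 0 (collect_node dir)).

Section Marking.
Variables (R : realType) (M n lam : nat) (A : nat -> \bar R) (dir : bool).
Hypothesis hF : fits M n lam.
Local Notation runs := (@runs R M).
Local Notation w := (wdir A n dir).
Variables (rmv : pred nat) (c i : nat) (D : pred nat).
Hypothesis hi : i < n.
Local Notation lay := (lay n w rmv c).
Local Notation trail := (trail n w rmv c).
Local Notation H := (hops n lam i).

(** An infinite entry needs no repair, as deletions create no walks. A deleted node with a finite
    entry is always affected, since it lies on its own trail. *)
Definition hurt (t : nat) : bool := (lay H t < +oo)%E && has D (trail H t).

Definition del_env (st : state R) :=
  [/\ walk_env n lam i st, warr st 0 = A & forall v, v < n -> arr st 0 v = D v].

Lemma del_env_frame p (st st' : state R) : frame p st st' ->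
  all (fun x => x \notin regs_of p) [:: 0; 2; 3; 4] -> 0 \notin arrs_of p ->
  0 \notin warrs_of p -> del_env st -> del_env st'.
Proof.
move=> f /and5P[h0 h1 h2 h3 _] h4 h5 [[e0 e1 e2 e3] e4 e5].
by split; [split; rewrite (frame_reg f) | rewrite (frame_warr f) | rewrite (frame_arr f)].
Qed.

Lemma mark_runs st : del_env st -> par_row n lam A dir rmv c i st ->
  (forall t, t < n -> warr st (dist_arr dir) (i * n + t) = lay H t) ->
  runs (mark dir) st (n * (H * 5 + 13) + 3) (fun st' =>
    (forall t, t < n -> arr st' (aff_arr dir) (i * n + t) = hurt t) /\
    (forall j, j < i * n -> arr st' (aff_arr dir) j = arr st (aff_arr dir) j)).
Proof.
move=> E P hd; have M4 := four_lt_M hF.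
have hn : n < M by apply: n_lt_M hF.
apply: (@runs_le _ _ _ _ (n * ((1 + (1 + ((maxn 1 (2 + (H * (2 + 3) + 3))).+1 + 1))) + 2) + 3));
  last by lia.
apply: (@runs_for_const _ _ _ _ _ _ (fun m st' =>
    (forall t, t < m -> arr st' (aff_arr dir) (i * n + t) = hurt t) /\
    (forall j, j < i * n -> arr st' (aff_arr dir) j = arr st (aff_arr dir) j)) _ n) => //.
- by case: E => [[]].
move=> t st1 tn f1 r7 [I1 I2].
have E1 : del_env st1 by apply: del_env_frame f1 _ _ _ E; case: (dir).
have [[r0 r2 r3 r4] hA hD] := E1.
have dd (st2 : state R) : reg st2 0 = n -> reg st2 3 = i -> reg st2 7 = t ->
   word_val M st2 (idx (Reg 3) (Reg 7)) = i * n + t.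
  by move=> s0 s3 s7; apply: (idxE (m := n)) => //; apply: ltnW (fits_sq hF).
apply: runs_seq; apply: runs_assign; apply: runs_seq; apply: runs_assign.
set st2 := setr _ _ _.
have r11 : reg st2 11 = t by rewrite /st2; ev.
have r12 : reg st2 12 = 0 by rewrite /st2; ev; rewrite mod0n.
apply: (@runs_then _ _ _ _ _ _ _ (fun st' => reg st' 12 = hurt t)).
  have tv : test_val M st2 (WLe WInfty (WGet (dist_arr dir) (idx (Reg 3) (Reg 7)))) =
      (lay H t == +oo%E).
    rewrite -[LHS]/(+oo <= warr st1 (dist_arr dir) (word_val M st2 (idx (Reg 3) (Reg 7))))%E.
    by rewrite dd // leye_eq (frame_warr f1) ?hd //; case: (dir).
  apply: runs_if; rewrite tv => fin.
    by apply: runs_skip; rewrite /hurt (eqP fin) ltxx r12.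
  apply: runs_imp; first apply: (@walk_runs R M n lam A dir hF rmv c i hi _ _ (fun s st' =>
      reg st' 12 = has D s /\ forall v, v < n -> arr st' 0 v = D v) st2 t) => //.
  - by apply/allP.
  - by move=> s st' x v [h h'] [] ->.
  - move=> s st3 x [q0 q2 q3 q4] [I3 J3] s11 xn _ _.
    rewrite -cats1 has_cat /= orbF.
    apply: (@runs_le _ _ _ _ (maxn 1 1).+1) => //.
    apply: runs_if; rewrite /= s11 mod0n leqn0 J3 // eqb0 => h.
      by apply: runs_skip; rewrite I3 (negbTE h) orbF.
    apply: runs_assign; move: h; rewrite negbK => ->; rewrite orbT.
    by split=> //; ev; rewrite modn_small //; lia.
  - move=> k u kH un; rewrite -[arr st2]/(arr st1) (frame_arr f1) ?P //.
    by case: (dir).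
  - by move=> st3 _ [-> _]; rewrite /hurt ltey fin.
move=> st3 f3 e12; apply: runs_store.
have keep x : x \in [:: 0; 3; 7] -> reg st3 x = reg st1 x.
  move=> hx; rewrite (frame_reg f3).
    by rewrite /st2; ev; move: hx; rewrite !inE => /or3P[] /eqP ->.
  by move: hx; rewrite !inE => /or3P[] /eqP ->; case: (dir).
have a3 : arr st3 (aff_arr dir) = arr st1 (aff_arr dir).
  by rewrite (frame_arr f3) //; case: (dir).
rewrite dd ?keep //; ev; rewrite eqxx e12 a3; split=> [t'|j hj].
  rewrite ltnS leq_eqVlt => /predU1P[->|tt]; first by rewrite eqxx.
  by rewrite ltn_eqF ?ltn_add2l // I1.
by rewrite ltn_eqF ?I2 // (leq_trans hj) // leq_addr.
Qed.

Definition row (st : state R) (t : nat) : \bar R := warr st (dist_arr dir) (i * n + t).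

Definition same_elsewhere (st st' : state R) := forall j,
  (j < i * n) || (i.+1 * n <= j) -> warr st' (dist_arr dir) j = warr st (dist_arr dir) j.

Lemma elsewhere_neq j t : t < n -> (j < i * n) || (i.+1 * n <= j) -> (j == i * n + t) = false.
Proof. by move=> tn; apply: contraTF => /eqP ->; rewrite mulSn; lia. Qed.

Lemma row_idx (st : state R) e t : del_env st -> word_val M st e = t -> t < n ->
  word_val M st (idx (Reg 3) e) = i * n + t.
Proof.
move=> [[r0 _ r3 _] _ _] he tn.
by apply: (idxE (m := n)) => //; apply: ltnW (fits_sq hF).
Qed.

(* The affected surviving nodes, as listed in word array 11. *)
Definition listed (st : state R) : seq nat := [seq arr st 11 b | b <- iota 0 (reg st 13)].

Lemma collect_runs st : del_env st ->
  (forall t, t < n -> arr st (aff_arr dir) (i * n + t) = hurt t) ->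
  runs (collect dir) st (n * 7 + 4) (fun st' =>
    [/\ forall t, t < n -> row st' t = if hurt t then +oo%E else row st t,
       same_elsewhere st st',
       forall t, (t \in listed st') = [&& t < n, hurt t & ~~ D t]
     & reg st' 13 <= \sum_(t < n) hurt t]).
Proof.
move=> E ha; have M4 := four_lt_M hF; have hn : n < M by apply: n_lt_M hF.
apply: (@runs_le _ _ _ _ (1 + (n * (5 + 2) + 3))); last lia.
apply: runs_seq; apply: runs_assign.
set st0 := setr _ _ _.
pose inv m (st' : state R) :=
  [/\ forall t, t < n -> row st' t = if (t < m) && hurt t then +oo%E else row st t,
     same_elsewhere st st',
     forall t, (t \in listed st') = [&& t < m, hurt t & ~~ D t]
   & reg st' 13 <= \sum_(t < m) hurt t].
apply: (@runs_imp _ _ _ _ _ (inv n)); last first.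
  by move=> st' _ [h1 h2 h3 h4]; split=> // t tn; rewrite h1 // tn.
apply: (@runs_for_const _ _ _ _ _ 5 inv _ n) => //.
- by case: E => [[]].
- split=> //; last by rewrite /st0; ev; rewrite mod0n.
  by move=> t; rewrite /listed /st0; ev; rewrite mod0n.
move=> t st1 tn f1 r7 [I1 I2 I3 I4].
have E0 : del_env st0 by [].
have E1 : del_env st1 by apply: del_env_frame f1 _ _ _ E0; case: (dir).
have [[r0 r2 r3 r4] hA hD] := E1.
have tv : test_val M st1 (Le (Get (aff_arr dir) (idx (Reg 3) (Reg 7))) (Const 0)) = ~~ hurt t.
  rewrite -[LHS]/(arr st1 (aff_arr dir) (word_val M st1 (idx (Reg 3) (Reg 7))) <= 0 %% M).
  rewrite (row_idx (e := Reg 7) E1 r7 tn) mod0n leqn0 (frame_arr f1); last by case: (dir).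
  by rewrite -[arr st0]/(arr st) ha // eqb0.
have ltS u : (u < t.+1) = (u == t) || (u < t) by rewrite ltnS leq_eqVlt.
apply: (@runs_le _ _ _ _ (maxn 1 (1 + (maxn 2 1).+1)).+1) => //.
apply: runs_if; rewrite tv; last rewrite negbK; move=> ht.
  apply: runs_skip; split=> //=.
  + move=> u un; rewrite ltS; case: eqP => [->|_]; last exact: I1.
    by have := I1 t tn; rewrite (negbTE ht) ltnn andbF.
  + move=> u; rewrite ltS; case: eqP => [->|_]; last exact: I3.
    by rewrite (negbTE ht) /= -[LHS]/(t \in listed st1) I3 ltnn.
  + by rewrite big_ord_recr /= (negbTE ht) addn0.
apply: runs_seq; apply: runs_wstore; rewrite (row_idx (e := Reg 7) E1 r7 tn).
set st2 := setw _ _ _ _.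
have row2 u : u < n -> row st2 u = if (u < t.+1) && hurt u then +oo%E else row st u.
  move=> un; rewrite /row /st2; ev; rewrite eqxx eqn_add2l ltS.
  by case: eqP => [->|_]; [rewrite ht | exact: I1].
have els2 : same_elsewhere st st2.
  by move=> j hj; rewrite /st2; ev; rewrite eqxx elsewhere_neq // I2.
have tv2 : test_val M st2 (Le (Get 0 (Reg 7)) (Const 0)) = ~~ D t.
  by rewrite /= -[arr st2 0]/(arr st1 0) -[reg st2 7]/(reg st1 7) r7 hD // mod0n leqn0 eqb0.
have sumS : \sum_(u < t.+1) hurt u = (\sum_(u < t) hurt u) + 1.
  by rewrite big_ord_recr /= ht.
apply: runs_if; rewrite tv2; last rewrite negbK; move=> hDt.
  have s13 : reg st2 13 < n.
    apply: leq_ltn_trans I4 _; apply: (@leq_ltn_trans (\sum_(u < t) 1)).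
      by apply: leq_sum => u _; case: (hurt u).
    by rewrite sum_nat_const card_ord muln1.
  apply: (@runs_seq _ _ _ _ _ 1 1); apply: runs_store; apply: runs_assign.
  rewrite /=; split=> //.
  + move=> u; rewrite /listed; ev; rewrite r7 [1 %% M]modn_small; last lia.
    rewrite -[reg st1 13]/(reg st2 13) addn1 modn_small; last lia.
    rewrite -[(reg st2 13).+1]addn1 iotaD map_cat mem_cat /= inE eqxx ltS.
    case: (eqVneq u t) => [->|nut].
      by rewrite ht hDt /= orbT.
    rewrite orbF -I3 /listed -[reg st2 13]/(reg st1 13); congr (_ \in _).
    by apply/eq_in_map => b; rewrite mem_iota add0n => /= hb; rewrite ltn_eqF.
  + ev; rewrite [1 %% M]modn_small; last lia.
    by rewrite -[reg st1 13]/(reg st2 13) modn_small ?sumS ?leq_add2r //; lia.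
apply: runs_skip; split=> //=.
+ move=> u; rewrite ltS; case: eqP => [->|_]; last exact: I3.
  by rewrite hDt /= andbF -[LHS]/(t \in listed st1) I3 ltnn.
+ by rewrite sumS (leq_trans I4) // leq_addr.
Qed.

End Marking.

(* Relaxes the arc from [src] to the node in register 9, whose cell is in register 10. *)
Definition relax_to (dir : bool) (src : wordexp) : prog :=
  let e := WAdd (WGet (dist_arr dir) (idx (Reg 3) src)) (wexp dir src (Reg 9)) in
  If (WLe (WGet (dist_arr dir) (Reg 10)) e) Skip (WStore (dist_arr dir) (Reg 10) e).

Definition enter (dir : bool) : prog :=
  For 8 13
    (Seq (Assign 9 (Get 11 (Reg 8)))
    (Seq (Assign 10 (idx (Reg 3) (Reg 9)))
         (For 7 0 (relax_to dir (Reg 7))))).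

Definition listed_dist (dir : bool) (b : wordexp) : weightexp :=
  WGet (dist_arr dir) (idx (Reg 3) (Get 11 b)).

Definition find_nearest (dir : bool) : prog :=
  For 8 13
    (If (And (Le (Reg 6) (Reg 8))
             (Not (WLe (listed_dist dir (Reg 14)) (listed_dist dir (Reg 8)))))
        (Assign 14 (Reg 8)) Skip).

Definition relax_all (dir : bool) : prog :=
  For 8 13
    (Seq (Assign 9 (Get 11 (Reg 8)))
    (Seq (Assign 10 (idx (Reg 3) (Reg 9)))
         (relax_to dir (Reg 15)))).

Definition settle_next (dir : bool) : prog :=
  Seq (Assign 14 (Reg 6))
  (Seq (find_nearest dir)
  (Seq (Assign 15 (Get 11 (Reg 14)))
  (Seq (Store 11 (Reg 14) (Get 11 (Reg 6)))
  (Seq (Store 11 (Reg 6) (Reg 15))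
       (relax_all dir))))).

Definition repair (dir : bool) : prog :=
  Seq (mark dir) (Seq (collect dir) (Seq (enter dir) (For 6 13 (settle_next dir)))).

(** * Dijkstra's algorithm on the affected survivors of one row *)

Section Repair.
Variables (R : realType) (M n lam : nat) (A : nat -> \bar R) (dir : bool).
Hypothesis hF : fits M n lam.
Hypothesis A0 : forall i, (0 <= A i)%E.
Local Notation n0 := (fits_n hF).
Local Notation runs := (@runs R M).
Local Notation w := (wdir A n dir).
Variables (rmv : pred nat) (c i : nat) (D : pred nat).
Hypotheses (hi : i < n) (cn : c < n) (rc : ~~ rmv c).
Local Notation lay := (lay n w rmv c).
Local Notation H := (hops n lam i).
Local Notation hurt := (hurt n lam A dir rmv c i D).
Local Notation del_env := (del_env n lam A i D).
Local Notation row := (row n dir i).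
Local Notation same_elsewhere := (same_elsewhere n dir i).

Lemma ereal_min_lel (x y : \bar R) : (Order.min x y <= x)%E.
Proof. by rewrite ge_min lexx. Qed.

Lemma ereal_min_ler (x y : \bar R) : (Order.min x y <= y)%E.
Proof. by rewrite ge_min lexx orbT. Qed.

(* [N] gives lengths of walks from [c] outside [D], exact at unaffected nodes. *)
Record valid_row (N : nat -> \bar R) : Prop := ValidRow {
  row_sound : forall t, t < n -> (N t < +oo)%E ->
    exists p, [/\ last c p = t, elen w c p = N t &
                  all (fun x => (x < n) && ~~ D x) (c :: p)];
  row_unhurt : forall t, t < n -> ~~ hurt t -> N t = lay H t;
  row_deleted : forall t, t < n -> D t -> N t = +oo%E }.

Lemma eq_valid_row N N' : (forall t, t < n -> N' t = N t) -> valid_row N -> valid_row N'.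
Proof.
by move=> e [h1 h2 h3]; split=> t tn; rewrite e //; [apply: h1 | apply: h2 | apply: h3].
Qed.

Lemma valid_row_init : valid_row (fun t => if hurt t then +oo%E else lay H t).
Proof.
split=> t tn.
- case: ifP => [_|]; first by rewrite ltxx.
  rewrite /hurt => + fin; rewrite fin /= => /negbT/hasPn hD.
  have [p [h1 h2 h3 h4]] := lay_sound (@wdir_ge0 _ A n A0 dir) cn rc tn fin.
  exists p; split; [exact: h1 | exact: h2 |].
  apply: (introT (@allP _ _ (c :: p))) => x hx.
  have /(allP h4)/andP[-> _] := hx.
  by apply: hD; rewrite h3.
- by move=> /negbTE ->.
- move=> Dt; case: ifPn => //; rewrite /hurt negb_and -leNgt leye_eq => /orP[/eqP//|].
  by move/hasPn/(_ t (mem_trail _ _ _ _ _ _)); rewrite Dt.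
Qed.

Lemma valid_row_relax N u v : u < n -> v < n -> hurt v -> ~~ D v -> valid_row N ->
  valid_row (fun t => if t == v then Order.min (N v) (N u + w u v)%E else N t).
Proof.
move=> un vn hv Dv [h1 h2 h3]; split=> t tn.
- case: eqP => [->|_]; last exact: h1.
  rewrite minEle; case: ifP => _; first exact: h1.
  move=> fin; have fu : (N u < +oo)%E.
    by apply: le_lt_trans fin; rewrite leeDl ?wdir_ge0.
  have [p [e1 e2 e3]] := h1 u un fu.
  exists (rcons p v); split.
  + by rewrite last_rcons.
  + by rewrite elen_rcons e2 e1.
  + by move: e3; rewrite /= all_rcons vn Dv.
- by case: eqP => [->|_]; [rewrite hv | apply: h2].
- by case: eqP => [->|_]; [rewrite (negbTE Dv) | apply: h3].
Qed.

Lemma relax_to_runs st src u v : del_env st -> word_val M st src = u ->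
  u < n -> v < n -> reg st 9 = v -> reg st 10 = i * n + v ->
  runs (relax_to dir src) st 2 (fun st' =>
    (forall t, t < n -> row st' t =
       if t == v then Order.min (row st v) (row st u + w u v)%E else row st t) /\
    same_elsewhere st st').
Proof.
move=> E hu un vn r9 r10.
have [[r0 r2 r3 r4] hA hD] := E.
have we : weight_val M st (WAdd (WGet (dist_arr dir) (idx (Reg 3) src)) (wexp dir src (Reg 9)))
   = (row st u + w u v)%E.
  rewrite -[LHS]/(warr st (dist_arr dir) (word_val M st (idx (Reg 3) src)) +
     weight_val M st (wexp dir src (Reg 9)))%E.
  by rewrite (row_idx hF hi E hu un) (wexpE dir hF r0 hA hu (v := Reg 9) r9 un vn).
have wt : weight_val M st (WGet (dist_arr dir) (Reg 10)) = row st v by rewrite wgetE /= r10.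
have tv : test_val M st (WLe (WGet (dist_arr dir) (Reg 10))
    (WAdd (WGet (dist_arr dir) (idx (Reg 3) src)) (wexp dir src (Reg 9)))) =
    (row st v <= row st u + w u v)%E by rewrite -we -wt.
apply: (@runs_le _ _ _ _ (maxn 1 1).+1) => //.
apply: runs_if; rewrite tv => h.
  by apply: runs_skip; split=> // t tn; case: eqP => // ->; rewrite minEle h.
apply: runs_wstore; rewrite we -[word_val _ _ (Reg 10)]/(reg st 10) r10; split.
  move=> t tn; rewrite /row; ev; rewrite eqxx eqn_add2l.
  by case: eqP => // _; rewrite minEle -/(row st v) (negbTE h).
by move=> j hj; ev; rewrite eqxx (elsewhere_neq hi vn hj).
Qed.

Definition good_list (l : seq nat) := forall t, (t \in l) = [&& t < n, hurt t & ~~ D t].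

(** Unaffected nodes already have their final values, so it is enough to relax the arcs leaving them
    once, before Dijkstra's algorithm starts. *)
Definition entered (l : seq nat) (N : nat -> \bar R) := forall v y, v \in l -> y < n ->
  ~~ hurt y -> (N v <= lay H y + w y v)%E.

Lemma listedP (st : state R) v :
  reflect (exists2 b, b < reg st 13 & arr st 11 b = v) (v \in listed st).
Proof.
apply: (iffP mapP) => [[b hb ->]|[b hb <-]].
  by exists b => //; move: hb; rewrite mem_iota.
by exists b; rewrite ?mem_iota.
Qed.

Lemma enter_runs st : del_env st -> good_list (listed st) -> reg st 13 <= n ->
  valid_row (row st) ->
  runs (enter dir) st (reg st 13 * (n * 4 + 7) + 3) (fun st' =>
    [/\ valid_row (row st'), entered (listed st) (row st') & same_elsewhere st st']).
Proof.
move=> E G mn V; have hn : n < M by apply: n_lt_M hF.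
set m := reg st 13 in mn *.
apply: (@runs_le _ _ _ _ (m * ((1 + (1 + (n * (2 + 2) + 3))) + 2) + 3));
  last by rewrite leq_add2r leq_mul2l; lia.
have hl b : b < m -> [&& arr st 11 b < n, hurt (arr st 11 b) & ~~ D (arr st 11 b)].
  by move=> bm; rewrite -G; apply/listedP; exists b.
apply: (@runs_for_const _ _ _ _ _ _ (fun k st' =>
  [/\ valid_row (row st'), entered [seq arr st 11 b | b <- iota 0 k] (row st')
    & same_elsewhere st st']) _ m) => //.
  by apply: leq_ltn_trans mn hn.
move=> k st1 km f1 r8 [V1 I1 S1].
have E1 : del_env st1 by apply: del_env_frame f1 _ _ _ E; case: (dir).
have a1 : arr st1 11 = arr st 11 by rewrite (frame_arr f1) //; case: (dir).
have /and3P[vn hv Dv] := hl k km; set v := arr st 11 k in vn hv Dv.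
apply: runs_seq; apply: runs_assign; apply: runs_seq; apply: runs_assign.
have -> : word_val M st1 (Get 11 (Reg 8)) = v by rewrite /= r8 a1.
set st2 := setr st1 9 v.
have E2 : del_env st2 by [].
rewrite (row_idx hF hi (e := Reg 9) E2 (erefl v) vn).
set st3 := setr _ _ _.
have E3 : del_env st3 by [].
apply: runs_imp; first apply: (@runs_for_const _ _ _ _ _ 2 (fun y st' =>
  [/\ valid_row (row st'), entered [seq arr st 11 b | b <- iota 0 k] (row st'),
      forall u, u < y -> ~~ hurt u -> (row st' v <= lay H u + w u v)%E
    & same_elsewhere st st']) _ n) => //.
- by case: E3 => [[]].
- move=> y st4 yn f4 r7 [V4 I4 J4 S4].
  have E4 : del_env st4 by apply: del_env_frame f4 _ _ _ E3; case: (dir).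
  have r9 : reg st4 9 = v by rewrite (frame_reg f4) //; case: (dir).
  have r10 : reg st4 10 = i * n + v by rewrite (frame_reg f4) //; case: (dir).
  apply: runs_imp; first exact: (@relax_to_runs st4 (Reg 7) y v).
  move=> st5 f5 [e5 S5].
  have le5 t : t < n -> (row st5 t <= row st4 t)%E.
    by move=> tn; rewrite e5 //; case: eqP => // ->; apply: ereal_min_lel.
  split=> /=.
  + apply: (eq_valid_row (N := fun t => if t == v then Order.min (row st4 v) (row st4 y +
      w y v)%E else row st4 t)) => //.
    exact: valid_row_relax.
  + move=> x u hx un hu; apply: le_trans (I4 x u hx un hu); apply: le5.
    move: hx => /mapP[b]; rewrite mem_iota => /= bk ->.
    by have /and3P[] := hl b (ltn_trans bk km).
  + move=> u; rewrite ltnS leq_eqVlt => /predU1P[->|uy] hu.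
      rewrite -(row_unhurt V4 yn hu) -[leLHS]/(row st5 v) e5 // eqxx.
      exact: ereal_min_ler.
    by apply: le_trans (le5 _ vn) _; apply: J4.
  + by move=> j hj; rewrite -[LHS]/(warr st5 _ j) S5 // S4.
- move=> st4 f4 [V4 I4 J4 S4]; split=> // x y.
  rewrite -[k.+1]addn1 iotaD map_cat mem_cat /= inE => /orP[hx|/eqP ->] yn hy; first exact: I4.
  exact: J4.
Qed.

(* The invariant of Dijkstra's algorithm: the first [a] listed nodes are settled. *)
Record settled (l : seq nat) (a : nat) (st : state R) : Prop := Settled {
  settled_valid : valid_row (row st);
  settled_entered : entered l (row st);
  settled_members : listed st =i l;
  settled_closed : forall b v, b < a -> v \in l ->
    (row st v <= row st (arr st 11 b) + w (arr st 11 b) v)%E;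
  settled_sorted : forall b b', b < a -> a <= b' -> b' < reg st 13 ->
    (row st (arr st 11 b) <= row st (arr st 11 b'))%E }.

Lemma find_nearest_runs st a : del_env st -> reg st 13 <= n -> a < reg st 13 ->
  reg st 6 = a -> reg st 14 = a -> (forall b, b < reg st 13 -> arr st 11 b < n) ->
  runs (find_nearest dir) st (reg st 13 * 4 + 3) (fun st' =>
    [/\ a <= reg st' 14, reg st' 14 < reg st 13 & forall b, a <= b -> b < reg st 13 ->
      (row st (arr st 11 (reg st' 14)) <= row st (arr st 11 b))%E]).
Proof.
move=> E mn; set m := reg st 13 in mn * => am r6 r14 hl; have hn : n < M by apply: n_lt_M hF.
apply: runs_imp; first apply: (@runs_for_const _ _ _ _ _ 2 (fun k st' =>
  [/\ a <= reg st' 14, reg st' 14 < m & forall b, a <= b -> b < m -> b < k ->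
      (row st (arr st 11 (reg st' 14)) <= row st (arr st 11 b))%E]) _ m) => //.
- by apply: leq_ltn_trans mn hn.
- by ev; rewrite r14.
- move=> k st1 km f1 r8 [I1 I2 I3].
  have E1 : del_env st1 by apply: del_env_frame f1 _ _ _ E; case: (dir).
  have s6 : reg st1 6 = a by rewrite (frame_reg f1).
  have row1 : row st1 = row st by rewrite /row (frame_warr f1).
  have a1 : arr st1 = arr st.
    by apply: boolp.funext => x; rewrite (frame_arr f1).
  have dE e b : word_val M st1 e = b -> b < m ->
      weight_val M st1 (listed_dist dir e) = row st (arr st 11 b).
    move=> he hb; rewrite wgetE (row_idx hF hi (t := arr st 11 b) E1) ?hl //.
      by rewrite -[LHS]/(row st1 _) row1.
    by rewrite getE he a1.
  have tv : test_val M st1 (And (Le (Reg 6) (Reg 8))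
      (Not (WLe (listed_dist dir (Reg 14)) (listed_dist dir (Reg 8))))) =
      (a <= k) && ~~ (row st (arr st 11 (reg st1 14)) <= row st (arr st 11 k))%E.
    rewrite -(dE (Reg 14) (reg st1 14)) // -(dE (Reg 8) k) //.
    by rewrite -[LHS]/((reg st1 6 <= reg st1 8) && ~~ _) s6 r8.
  apply: (@runs_le _ _ _ _ (maxn 1 1).+1) => //.
  apply: runs_if; rewrite tv => h.
    have {h} /andP[ak] := h; rewrite -ltNge => /ltW hlt.
    apply: runs_assign; ev; rewrite r8; split=> // b ab bm.
    rewrite ltnS leq_eqVlt => /predU1P[->//|bk].
    by apply: le_trans hlt _; apply: I3.
  apply: runs_skip; split=> // b ab bm /=.
  rewrite ltnS leq_eqVlt => /predU1P[e|bk]; last exact: I3.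
  by move: h; rewrite -e ab /= negbK.
- by move=> st' _ [h1 h2 h3]; split=> // b ab bm; apply: h3.
Qed.

Lemma relax_all_runs st u : del_env st -> reg st 13 <= n -> good_list (listed st) ->
  reg st 15 = u -> u < n ->
  runs (relax_all dir) st (reg st 13 * 6 + 3) (fun st' =>
    (forall t, t < n -> row st' t = if t \in listed st
       then Order.min (row st t) (row st u + w u t)%E else row st t) /\
    same_elsewhere st st').
Proof.
move=> E mn G r15 un; have hn : n < M by apply: n_lt_M hF.
set m := reg st 13 in mn *.
apply: (@runs_le _ _ _ _ (m * ((1 + (1 + 2)) + 2) + 3)) => //.
have hl b : b < m -> arr st 11 b < n.
  by move=> bm; have : arr st 11 b \in listed st by [apply/listedP; exists b];
    rewrite G => /and3P[].
apply: (@runs_for_const _ _ _ _ _ _ (fun k st' =>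
  (forall t, t < n -> row st' t = if t \in [seq arr st 11 b | b <- iota 0 k]
       then Order.min (row st t) (row st u + w u t)%E else row st t) /\
    same_elsewhere st st') _ m) => //.
  by apply: leq_ltn_trans mn hn.
move=> k st1 km f1 r8 [I1 S1].
have E1 : del_env st1 by apply: del_env_frame f1 _ _ _ E; case: (dir).
have a1 : arr st1 11 = arr st 11 by rewrite (frame_arr f1) //; case: (dir).
have s15 : reg st1 15 = u by rewrite (frame_reg f1) //; case: (dir).
apply: runs_seq; apply: runs_assign; apply: runs_seq; apply: runs_assign.
have -> : word_val M st1 (Get 11 (Reg 8)) = arr st 11 k by rewrite /= r8 a1.
have vn := hl k km; set v := arr st 11 k in vn *.
set st2 := setr st1 9 v.
have E2 : del_env st2 by [].
rewrite (row_idx hF hi (e := Reg 9) E2 (erefl v) vn).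
set st3 := setr _ _ _.
have E3 : del_env st3 by [].
apply: runs_imp; first exact: (@relax_to_runs st3 (Reg 15) u v).
move=> st4 f4 [e4 S4]; split=> [t tn|j hj]; last first.
  by rewrite -[LHS]/(warr st4 _ j) S4 // S1.
rewrite -[LHS]/(row st4 t) e4 // -[row st3]/(row st1).
(* The list may contain [u], but with non-negative weights relaxing from [u] to itself changes
   nothing, so the value at the source is constant during the loop. *)
have ru : row st1 u = row st u.
  rewrite I1 //; case: ifP => // _; rewrite minEle leeDl ?wdir_ge0 //.
rewrite -[k.+1]addn1 iotaD map_cat mem_cat /= inE add0n ru -/v.
case: (eqVneq t v) => [->|_]; last by rewrite orbF I1.
(* [good_list] fixes the members of the list, not their multiplicities; relaxing [v] a second time
   is harmless because the minimum is idempotent. *)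
by rewrite orbT I1 //; case: ifP => // _; rewrite -minA minxx.
Qed.

Lemma settle_next_runs l st a : del_env st -> reg st 13 <= n -> good_list l ->
  a < reg st 13 -> reg st 6 = a -> settled l a st ->
  runs (settle_next dir) st (reg st 13 * 10 + 10) (fun st' =>
    settled l a.+1 st' /\ same_elsewhere st st').
Proof.
move=> E mn G am r6 [V I Mb C S].
set m := reg st 13 in mn am *.
have hlm b : b < m -> arr st 11 b \in l.
  by move=> bm; rewrite -Mb; apply/listedP; exists b.
have hl b : b < m -> arr st 11 b < n by move=> /hlm; rewrite G => /and3P[].
apply: (@runs_le _ _ _ _ (1 + ((m * 4 + 3) + (1 + (1 + (1 + (m * 6 + 3))))))); last lia.
apply: runs_seq; apply: runs_assign.
have -> : word_val M st (Reg 6) = a by [].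
set st0 := setr _ _ _.
apply: runs_then; first exact: (@find_nearest_runs st0 a).
move=> st1 f1 [q1 q2 q3].
set q := reg st1 14 in q1 q2 q3 *.
have a1 x : arr st1 x = arr st x by rewrite (frame_arr f1).
have w1 x : warr st1 x = warr st x by rewrite (frame_warr f1).
have s6 : reg st1 6 = a by rewrite (frame_reg f1).
have s13 : reg st1 13 = m by rewrite (frame_reg f1).
have E1 : del_env st1 by apply: del_env_frame f1 _ _ _ E.
apply: runs_seq; apply: runs_assign; apply: runs_seq; apply: runs_store; apply: runs_seq;
  apply: runs_store.
rewrite -[word_val _ _ (Get 11 (Reg 14))]/(arr st1 11 q)
  -[word_val _ _ (Get 11 (Reg 6))]/(arr st1 11 (reg st1 6)).
rewrite -[word_val _ _ (Reg 14)]/q -[word_val _ _ (Reg 6)]/(reg st1 6)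
  -[word_val _ _ (Reg 15)]/(arr st1 11 q).
rewrite s6 !a1.
set u := arr st 11 q.
set st2 := seta _ _ _ _.
have E2 : del_env st2.
  case: E1 => [[? ? ? ?] ? ?]; split=> // v vn; rewrite /st2; ev; exact: H2.
have row2 : row st2 = row st by rewrite /row -[warr st2]/(warr st1) w1.
(* The two stores exchange positions [a] and [q]; [sg] is this transposition. *)
pose sg b := if b == a then q else if b == q then a else b.
have sgm b : b < m -> sg b < m by rewrite /sg; case: eqP => // _; case: eqP.
have sgK b : sg (sg b) = b.
  rewrite /sg; case: (eqVneq b a) => [->|nba].
    by case: (eqVneq q a) => [->//|_]; rewrite eqxx.
  case: (eqVneq b q) => [->|nbq]; first by rewrite eqxx.
  by rewrite (negbTE nba) (negbTE nbq).
have arr2 b : arr st2 11 b = arr st 11 (sg b).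
  rewrite /st2 /sg; ev; case: eqP => // _; rewrite a1; case: eqP => // _.
have s13' : reg st2 13 = m by [].
have Mb2 : listed st2 =i l.
  move=> v; rewrite -Mb; apply/listedP/listedP; rewrite s13' => -[b bm <-].
    by exists (sg b); [exact: sgm | rewrite -arr2].
  by exists (sg b); [exact: sgm | rewrite arr2 sgK].
have G2 : good_list (listed st2) by move=> t; rewrite Mb2 G.
have ul : u \in l by apply: hlm.
have un : u < n by apply: hl.
have u2 : arr st2 11 a = u by rewrite arr2 /sg eqxx.
rewrite -s13'; apply: runs_imp; first by apply: (@relax_all_runs st2 u); rewrite ?s13'.
move=> st3 f3 [e3 S3].
have a3 : arr st3 11 = arr st2 11 by rewrite (frame_arr f3) //; case: (dir).
have t13 : reg st3 13 = m by rewrite (frame_reg f3) //; case: (dir).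
have e3' t : t < n -> row st3 t = if t \in l then Order.min (row st t) (row st u + w u t)%E else
  row st t.
  by move=> tn; rewrite e3 // Mb2 row2.
have rl v : v \in l -> v < n by rewrite G => /and3P[].
have le3 t : t < n -> (row st3 t <= row st t)%E.
  by move=> tn; rewrite e3' //; case: ifP => // _; apply: ereal_min_lel.
have sg_lt b : b < a -> sg b = b.
  move=> ba; rewrite /sg ltn_eqF // ltn_eqF //; exact: leq_trans ba q1.
have lu b : b < a -> (row st (arr st 11 b) <= row st u)%E by move=> ba; apply: S.
have wu v : (row st u <= row st u + w u v)%E by rewrite leeDl ?wdir_ge0.
have am' b : b < a -> b < m by move=> ba; apply: ltn_trans am.
(* Settled nodes are relaxed together with the others; as they are no farther than [u] and weights
   are non-negative, their values do not move. *)
have low b : b < a -> row st3 (arr st 11 b) = row st (arr st 11 b).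
  move=> ba; rewrite e3' ?hl ?am' // hlm ?am' //; apply/le_anti.
  by rewrite ge_min lexx le_min lexx (le_trans (lu b ba) (wu _)).
have ru : row st3 u = row st u.
  by rewrite e3' // ul; apply/le_anti; rewrite ge_min lexx le_min lexx wu.
have sgge b : a < b -> a <= sg b.
  by move=> ab; rewrite /sg gtn_eqF //; case: eqP => // _; apply: ltnW.
split.
- split.
  + apply: (eq_valid_row (N := fun t => row st3 t)) => //.
    split=> t tn.
    * rewrite e3' //; case: ifP => tl; last exact: (row_sound V tn).
      have := row_sound (valid_row_relax un tn _ _ V) tn; rewrite /= eqxx; apply.
        by move: tl; rewrite G => /and3P[].
      by move: tl; rewrite G => /and3P[].
    * by move=> ht; rewrite e3' // G (negbTE ht) andbF (row_unhurt V tn ht).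
    * by move=> Dt; rewrite e3' // G Dt !andbF (row_deleted V tn Dt).
  + move=> v y vl yn hy; apply: le_trans (I v y vl yn hy); exact: le3 (rl _ vl).
  + by move=> v; rewrite -Mb2 /listed a3 t13 s13'.
  + move=> b v; rewrite ltnS leq_eqVlt a3 => /predU1P[->|ba] vl.
      by rewrite u2 ru e3' ?rl // vl ereal_min_ler.
    rewrite arr2 sg_lt // low //; apply: le_trans (le3 _ (rl _ vl)) _.
    exact: C.
  + move=> b b'; rewrite t13 ltnS leq_eqVlt a3 => ba ab' b'm.
    have l' : arr st 11 (sg b') \in l by apply: hlm; apply: sgm.
    rewrite [in leRHS]arr2 (e3' (arr st 11 (sg b'))) ?rl // l' le_min.
    move: ba => /predU1P[->|ba].
      rewrite u2 ru wu andbT; apply: q3; [exact: sgge | exact: sgm].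
    rewrite arr2 sg_lt // low // (le_trans (lu b ba) (wu _)) andbT.
    by apply: S => //; [exact: sgge | exact: sgm].
- move=> j hj; rewrite S3 // -[warr st2]/(warr st1) w1 //.
Qed.

(** Marking follows a trail of length [H] for each target. After that, each affected survivor costs
    [O(n)]: one scan over all nodes in [enter] and one over the list when a node is settled. *)
Lemma repair_runs st : del_env st -> par_row n lam A dir rmv c i st ->
  (forall t, t < n -> row st t = lay H t) ->
  runs (repair dir) st (80 * (n * (H.+1 + \sum_(t < n) hurt t))) (fun st' =>
    [/\ valid_row (row st'),
        forall v y, v < n -> y < n -> hurt v -> ~~ D v -> ~~ D y ->
          (row st' v <= row st' y + w y v)%E,
        same_elsewhere st st',
        forall t, t < n -> arr st' (aff_arr dir) (i * n + t) = hurt t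
      & forall j, j < i * n -> arr st' (aff_arr dir) j = arr st (aff_arr dir) j]).
Proof.
move=> E P hd; have h0 := n0.
set a := \sum_(t < n) hurt t.
have an : a <= n.
  apply: (@leq_trans (\sum_(t < n) 1)); last by rewrite sum_nat_const card_ord muln1.
  by apply: leq_sum => t _; case: (hurt t).
apply: (@runs_le _ _ _ _ ((n * (H * 5 + 13) + 3) +
  ((n * 7 + 4) + ((a * (n * 4 + 7) + 3) + (a * (n * 10 + 10 + 2) + 3))))); last by nia.
apply: runs_then; first exact: (mark_runs hF hi E P hd).
move=> st1 f1 [m1 m2].
have E1 : del_env st1 by apply: del_env_frame f1 _ _ _ E; case: (dir).
have w1 : warr st1 = warr st.
  by apply: boolp.funext => x; rewrite (frame_warr f1) //; case: (dir).
apply: runs_then; first exact: (collect_runs hF hi E1 m1).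
move=> st2 f2 [c1 c2 c3 c4].
have E2 : del_env st2 by apply: del_env_frame f2 _ _ _ E1; case: (dir).
have V2 : valid_row (row st2).
  apply: eq_valid_row valid_row_init => t tn.
  by rewrite c1 // /row w1 -/(row st t) hd.
have s13n : reg st2 13 <= n by apply: leq_trans c4 an.
apply: runs_then.
  apply: runs_le; first exact: (enter_runs E2 c3 s13n V2).
  by rewrite leq_add2r leq_mul2r c4 orbT.
move=> st3 f3 [V3 I3 S3].
have E3 : del_env st3 by apply: del_env_frame f3 _ _ _ E2; case: (dir).
have s13 : reg st3 13 = reg st2 13 by rewrite (frame_reg f3) //; case: (dir).
have hn : n < M by apply: n_lt_M hF.
have l3 : listed st3 = listed st2.
  by rewrite /listed s13 (frame_arr f3) //; case: (dir).
apply: (@runs_le _ _ _ _ (reg st2 13 * (n * 10 + 10 + 2) + 3)); last first.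
  by rewrite leq_add2r leq_mul2r c4 orbT.
apply: runs_imp; first apply: (@runs_for_const _ _ _ _ _ (n * 10 + 10) (fun k st' =>
   [/\ settled (listed st2) k st', same_elsewhere st3 st' & reg st' 13 = reg st2 13]) _
     (reg st2 13)).
- by case: (dir).
- by case: (dir).
- by [].
- exact: s13.
- exact: leq_ltn_trans s13n hn.
- split; [ | by [] | by rewrite -s13].
  by split=> //; rewrite -[listed _]/(listed st3) l3.
- move=> k st4 km f4 r6 [T4 S4 e13].
  have E4 : del_env st4 by apply: del_env_frame f4 _ _ _ E3; case: (dir).
  apply: (@runs_le _ _ _ _ (reg st4 13 * 10 + 10)).
    apply: runs_imp; first by apply: (@settle_next_runs (listed st2) st4 k); rewrite ?e13.
    move=> st5 f5 [T5 S5]; split.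
    + by case: T5.
    + by move=> j hj; rewrite -[LHS]/(warr st5 _ j) S5 // S4.
    + by rewrite -[LHS]/(reg st5 13) (frame_reg f5) //; case: (dir).
  by rewrite e13 leq_add2r leq_mul2r s13n orbT.
move=> st4 f4 [[V4 I4 M4 C4 _] S4 e13].
have aff4 : arr st4 (aff_arr dir) = arr st1 (aff_arr dir).
  by rewrite (frame_arr f4) ?(frame_arr f3) ?(frame_arr f2) //; case: (dir).
split=> //.
- move=> v y vn yn hv Dv Dy.
  have vl : v \in listed st2 by rewrite c3 vn hv Dv.
  (* Arcs from unaffected nodes were relaxed by [enter], arcs from affected ones when their source
     was settled. *)
  have [hy|hy] := boolP (hurt y); last by rewrite (row_unhurt V4 yn hy); apply: I4.
  have : y \in listed st2 by rewrite c3 yn hy Dy.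
  rewrite -M4 => /listedP[b]; rewrite e13 => bm <-.
  exact: C4.
- by move=> j hj; rewrite S4 // S3 // c2 // w1.
- by move=> t tn; rewrite aff4 m1.
- by move=> j hj; rewrite aff4 m2.
Qed.

End Repair.

(** * Answering all pairs *)

Definition next_arr (dir : bool) : nat := if dir then 13 else 12.

Definition nexts_row (dir : bool) : prog :=
  For 7 0
    (If (Le (Get (aff_arr dir) (idx (Reg 3) (Reg 7))) (Const 0))
        (Store (next_arr dir) (idx (Reg 3) (Reg 7))
           (Get (next_arr dir) (idx (Add (Reg 3) (Const 1)) (Reg 7))))
        (Store (next_arr dir) (idx (Reg 3) (Reg 7)) (Reg 3))).

(** Filled from the last slot backwards. Row [n] is a sentinel: the value [n] means that no affected
    slot follows. *)
Definition nexts (dir : bool) : prog :=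
  Seq (For 7 0 (Store (next_arr dir) (idx (Reg 0) (Reg 7)) (Reg 0)))
      (For 6 0
        (Seq (Assign 3 (Defs.Sub (Defs.Sub (Reg 0) (Const 1)) (Reg 6)))
             (nexts_row dir))).

Definition improve (e : weightexp) : prog :=
  If (WLe (WGet 1 (idx (Reg 3) (Reg 4))) e) Skip (WStore 1 (idx (Reg 3) (Reg 4)) e).

(** The run of unaffected slots before the next affected slot is covered by two windows of the same
    length, a power of two, one at each end; their overlap is harmless for minima. The affected
    slot, if there is one, is then evaluated on its own. *)
Definition answer_step : prog :=
  Seq (Assign 7 (Get 13 (idx (Reg 6) (Reg 3))))
  (Seq (Assign 8 (Get 12 (idx (Reg 6) (Reg 4))))
  (Seq (If (Le (Reg 7) (Reg 8)) Skip (Assign 7 (Reg 8)))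
  (Seq (If (Le (Reg 7) (Reg 6)) Skip
           (Seq (Assign 9 (Get 8 (Defs.Sub (Reg 7) (Reg 6))))
           (Seq (improve (WGet 5 (idx (Add (Reg 5) (Reg 9)) (Reg 6))))
                (improve (WGet 5 (idx (Add (Reg 5) (Reg 9)) (Defs.Sub (Reg 7) (Reg 9))))))))
  (Seq (If (Le (Reg 0) (Reg 7)) Skip
           (improve (WAdd (WGet 4 (idx (Reg 7) (Reg 3))) (WGet 3 (idx (Reg 7) (Reg 4))))))
       (Assign 6 (Add (Reg 7) (Const 1))))))).

Definition answer : prog :=
  Seq (WStore 1 (idx (Reg 3) (Reg 4)) WInfty)
  (Seq (Assign 5 (Mul (idx (Reg 3) (Reg 4)) (Add (Reg 0) (Const 1))))
  (Seq (Assign 6 (Const 0))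
       (While (Not (Le (Reg 0) (Reg 6))) answer_step))).

Section Nexts.
Variables (R : realType) (M n lam : nat) (aff : bool -> nat -> nat -> bool).
Hypothesis hF : fits M n lam.
Local Notation n0 := (fits_n hF).
Local Notation runs := (@runs R M).

(* [e] is the first affected slot from [i] on, or [n]. *)
Record is_next (dir : bool) (t i e : nat) : Prop := IsNext {
  next_ge : i <= e;
  next_le : e <= n;
  next_aff : e < n -> aff dir e t;
  next_skip : forall j, i <= j -> j < e -> ~~ aff dir j t }.

Lemma sq_le : n.+1 * n <= M.
Proof.
have h := fits_tab hF; have h0 := n0.
by apply: ltnW; apply: leq_ltn_trans h; rewrite leq_mul2r leq_pmull ?orbT // muln_gt0 h0.
Qed.

Lemma nexts_runs dir st : reg st 0 = n ->
  (forall i t, i < n -> t < n -> arr st (aff_arr dir) (i * n + t) = aff dir i t) ->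
  runs (nexts dir) st (n * (n * 4 + 9) + 6) (fun st' => forall i t, i < n -> t < n ->
    is_next dir t i (arr st' (next_arr dir) (i * n + t))).
Proof.
move=> r0 ha; have M4 := four_lt_M hF; have hn : n < M by apply: n_lt_M hF.
have h0 := n0.
apply: (@runs_le _ _ _ _ ((n * (1 + 2) + 3) + (n * ((1 + (n * (2 + 2) + 3)) + 2) + 3))); last lia.
apply: runs_then.
  apply: (@runs_for_const _ _ _ _ _ 1 (fun m st' => forall t, t < m ->
    is_next dir t n (arr st' (next_arr dir) (n * n + t))) _ n) => //.
  move=> t st1 tn f1 r7 I; apply: runs_store.
  have s0 : reg st1 0 = n by rewrite (frame_reg f1).
  rewrite (idxE (n := n) (i := n) (j := t) (m := n.+1)) // ?sq_le //
    -[word_val _ _ _]/(reg st1 0) s0.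
  ev; rewrite eqxx => u; rewrite ltnS leq_eqVlt eqn_add2l.
  case: eqP => [->|_] /= ut; last exact: I.
  by split; rewrite ?ltnn // => j h1; rewrite ltnNge h1.
move=> st1 f1 I1.
have s0 : reg st1 0 = n by rewrite (frame_reg f1).
have a1 : arr st1 (aff_arr dir) = arr st (aff_arr dir).
  by rewrite (frame_arr f1) //; case: (dir).
apply: runs_imp; first apply: (@runs_for_const _ _ _ _ _ _ (fun k st' =>
   forall i t, n - k <= i -> i <= n -> t < n ->
     is_next dir t i (arr st' (next_arr dir) (i * n + t))) _ n) => //.
- move=> i t hi hi' tn; have -> : i = n by lia.
  exact: I1.
- move=> k st2 kn f2 r6 I2.
  have q0 : reg st2 0 = n by rewrite (frame_reg f2).
  apply: runs_seq; apply: runs_assign.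
  have -> : word_val M st2 (Defs.Sub (Defs.Sub (Reg 0) (Const 1)) (Reg 6)) = n - k.+1.
    by rewrite /= q0 r6 modn_small -?subnDA ?add1n //; lia.
  set i := n - k.+1.
  have hi : i < n by rewrite /i; lia.
  set st3 := setr _ _ _.
  have aff3 t : t < n -> arr st3 (aff_arr dir) (i * n + t) = aff dir i t.
    move=> tn; rewrite -[arr st3]/(arr st2) (frame_arr f2); last by case: (dir).
    by rewrite a1 ha.
  have next3 j t : i < j -> j <= n -> t < n ->
      is_next dir t j (arr st3 (next_arr dir) (j * n + t)).
    by move=> ij jn tn; apply: I2 => //; rewrite /i in ij; lia.
  apply: runs_imp; first apply: (@runs_for_const _ _ _ _ _ 2 (fun m st' =>
     (forall t, t < m -> is_next dir t i (arr st' (next_arr dir) (i * n + t))) /\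
     (forall j, i.+1 * n <= j -> arr st' (next_arr dir) j = arr st3 (next_arr dir) j)) _ n) => //.
    move=> t st4 tn f4 r7 [J1 J2].
    have t0 : reg st4 0 = n by rewrite (frame_reg f4).
    have t3 : reg st4 3 = i by rewrite (frame_reg f4).
    have hidx : word_val M st4 (idx (Reg 3) (Reg 7)) = i * n + t.
      by rewrite (idxE (n := n) (i := i) (j := t) (m := n.+1)) ?sq_le //; apply: leqW.
    have hidx' : word_val M st4 (idx (Add (Reg 3) (Const 1)) (Reg 7)) = i.+1 * n + t.
      rewrite (idxE (n := n) (i := i.+1) (j := t) (m := n.+1)) ?sq_le //.
      by rewrite /= t3 [1 %% M]modn_small ?addn1 ?modn_small //; lia.
    have tv : test_val M st4 (Le (Get (aff_arr dir) (idx (Reg 3) (Reg 7))) (Const 0)) =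
      ~~ aff dir i t.
      rewrite -[LHS]/(arr st4 (aff_arr dir) (word_val M st4 (idx (Reg 3) (Reg 7))) <= 0 %% M).
      rewrite hidx mod0n (frame_arr f4); last by case: (dir).
      by rewrite aff3 // leqn0 eqb0.
    have nx : is_next dir t i.+1 (arr st4 (next_arr dir) (i.+1 * n + t)).
      by rewrite J2 ?leq_addr //; apply: next3.
    apply: (@runs_le _ _ _ _ (maxn 1 1).+1) => //.
    have keep (e : nat) : is_next dir t i e ->
        (forall u, u < t.+1 -> is_next dir u i
          (arr (seta st4 (next_arr dir) (i * n + t) e) (next_arr dir) (i * n + u))) /\
        (forall j, i.+1 * n <= j -> arr (seta st4 (next_arr dir) (i * n + t) e) (next_arr dir) j =
            arr st3 (next_arr dir) j).
      move=> he; split=> [u|j hj]; ev; rewrite eqxx.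
        rewrite ltnS leq_eqVlt eqn_add2l; case: eqP => [->//|_] /= ut; exact: J1.
      by rewrite gtn_eqF ?J2 //; apply: leq_trans hj; rewrite mulSn addnC ltn_add2r.
    apply: runs_if; rewrite tv => h; apply: runs_store; rewrite hidx.
      rewrite getE hidx'; apply: keep; case: nx => n1 n2 n3 n4; split=> //.
        exact: ltnW.
      by move=> j; rewrite leq_eqVlt => /predU1P[<-//|ij] je; apply: n4.
    rewrite -[word_val _ _ (Reg 3)]/(reg st4 3) t3; apply: keep; split=> //.
    + exact: ltnW.
    + by move: h; rewrite negbK.
    + by move=> j h1; rewrite ltnNge h1.
  move=> st4 _ [J1 J2] j t hj jn tn; rewrite -[arr (setr _ _ _)]/(arr st4).
  have [->|nji] := eqVneq j i; first exact: J1.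
  have ij : i < j by rewrite /i in nji *; lia.
  rewrite J2; first exact: next3.
  by apply: leq_trans (leq_addr _ _); rewrite leq_mul2r ij orbT.
- by move=> st2 _ I2 i t hi tn; apply: I2 => //; [rewrite subnn | apply: ltnW].
Qed.

Variables (din dout : nat -> nat -> \bar R) (N : bool -> nat -> nat -> \bar R).
Local Notation L := (bitlen n).
Hypothesis Nin : forall i t, i < n -> t < n -> ~~ aff true i t -> N true i t = din i t.
Hypothesis Nout : forall i t, i < n -> t < n -> ~~ aff false i t -> N false i t = dout i t.

Definition newkey (s t i : nat) : \bar R := (N true i s + N false i t)%E.

Record query_env (s t : nat) (st : state R) : Prop := QueryEnv {
  query_n : reg st 0 = n;
  query_s : reg st 3 = s;
  query_t : reg st 4 = t;
  query_dist : forall dir i v, i < n -> v < n -> warr st (dist_arr dir) (i * n + v) = N dir i v;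
  query_next : forall dir i v, i < n -> v < n ->
    is_next dir v i (arr st (next_arr dir) (i * n + v));
  query_pow : powers_ok n st;
  query_tab : table_ok n din dout st s t L }.

Lemma query_env_frame p s t (st st' : state R) : frame p st st' ->
  all (fun x => x \notin regs_of p) [:: 0; 3; 4] ->
  all (fun x => x \notin arrs_of p) [:: 8; 12; 13] ->
  all (fun x => x \notin warrs_of p) [:: 3; 4; 5] ->
  query_env s t st -> query_env s t st'.
Proof.
move=> f /and4P[x0 x3 x4 _] /and4P[a8 a12 a13 _] /and4P[w3 w4 w5 _].
case=> q0 q3 q4 qd qn qp qt; split; rewrite ?(frame_reg f) //.
- by move=> dir i v hi hv; rewrite (frame_warr f) ?qd //; case: (dir).
- move=> dir i v hi hv; have -> : arr st' (next_arr dir) = arr st (next_arr dir).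
    by rewrite (frame_arr f) //; case: (dir).
  exact: qn.
- by move=> m m0 mn; rewrite (frame_arr f) // qp.
- by move=> a i aL hi; rewrite (frame_warr f) // qt.
Qed.

Lemma improve_runs e st s t x : query_env s t st -> s < n -> t < n ->
  weight_val M st e = x ->
  runs (improve e) st 2 (fun st' =>
    warr st' 1 (s * n + t) = Order.min (warr st 1 (s * n + t)) x /\
    forall j, j != s * n + t -> warr st' 1 j = warr st 1 j).
Proof.
move=> E sn tn he; case: E => q0 q3 q4 _ _ _ _.
have hi : word_val M st (idx (Reg 3) (Reg 4)) = s * n + t.
  by apply: (idxE (m := n)) => //; apply: ltnW (fits_sq hF).
have tv : test_val M st (WLe (WGet 1 (idx (Reg 3) (Reg 4))) e) = (warr st 1 (s * n + t) <= x)%E.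
  by rewrite -he -hi.
apply: (@runs_le _ _ _ _ (maxn 1 1).+1) => //.
apply: runs_if; rewrite tv => h.
  by apply: runs_skip; rewrite minEle h.
apply: runs_wstore; rewrite hi he; ev; rewrite eqxx minEle (negbTE h); split=> // j hj.
by rewrite (negbTE hj).
Qed.

Definition good_value (s t : nat) (x : \bar R) :=
  x = +oo%E \/ exists2 i, i < n & x = newkey s t i.

Lemma good_min s t x y : good_value s t x -> good_value s t y -> good_value s t (Order.min x y).
Proof. by rewrite minEle; case: ifP. Qed.

Definition bad (s t j : nat) : bool := aff true j s || aff false j t.

Lemma key_newkey s t j : s < n -> t < n -> j < n -> ~~ bad s t j ->
  key din dout s t j = newkey s t j.
Proof.
by move=> sn tn jn; rewrite negb_or => /andP[h1 h2]; rewrite /key /newkey Nin ?Nout.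
Qed.

(** Register 6 reaches [n + 1] when the last run extends to the sentinel [n], because a step always
    moves one slot past the end of its run. *)
Definition query_inv (s t : nat) (st0 st : state R) :=
  [/\ reg st 6 <= n.+1,
      good_value s t (warr st 1 (s * n + t)),
      forall j, j < reg st 6 -> j < n -> (warr st 1 (s * n + t) <= newkey s t j)%E
    & forall j, j != s * n + t -> warr st 1 j = warr st0 1 j].

(** A step that ends at an affected slot is paid for by that slot; a last step that runs up to [n]
    is paid for by the first summand. The factor 15 is the cost 14 of a step plus the loop test. *)
Definition potential (s t : nat) (st : state R) : nat :=
  15 * ((reg st 6 < n) + \sum_(reg st 6 <= j < n) bad s t j).

Lemma answer_step_runs s t st0 st : s < n -> t < n -> query_env s t st ->
  reg st 5 = (s * n + t) * n.+1 -> reg st 6 < n -> query_inv s t st0 st ->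
  runs answer_step st 14 (fun st' => query_inv s t st0 st' /\
    14 + 1 + potential s t st' <= potential s t st).
Proof.
move=> sn tn E r5 pn [_ I2 I3 I4]; have M4 := four_lt_M hF; have h4 := fits_two hF.
have [q0 q3 q4 qd qn qp qt] := E.
set p := reg st 6 in pn I3 *.
have hb := pair_lt sn tn; set b := s * n + t in r5 I2 I3 I4 hb *.
have hnx := qn true p s pn sn; have hnx' := qn false p t pn tn.
set e1 := arr st 13 (p * n + s) in hnx; set e2 := arr st 12 (p * n + t) in hnx'.
have [a1 a2 a3 a4] := hnx; have [b1 b2 b3 b4] := hnx'.
pose e := minn e1 e2.
have pe : p <= e by rewrite leq_min a1 b1.
have en : e <= n by rewrite geq_min a2.
have skip j : p <= j -> j < e -> ~~ bad s t j.
  by rewrite leq_min => pj /andP[h1 h2]; rewrite negb_or a4 // b4.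
have badE : e < n -> bad s t e.
  rewrite /bad /e /minn; case: ifP => _ h; first by rewrite a3.
  by rewrite b3 ?orbT.
apply: (@runs_le _ _ _ _ (1 + (1 + ((maxn 1 1).+1 +
  ((maxn 1 (1 + (2 + 2))).+1 + ((maxn 1 2).+1 + 1)))))) => //.
apply: runs_seq; apply: runs_assign.
have -> : word_val M st (Get 13 (idx (Reg 6) (Reg 3))) = e1.
  by rewrite getE (idxE (n := n) (i := p) (j := s) (m := n)) // ltnW ?(fits_sq hF).
apply: runs_seq; apply: runs_assign.
have -> : word_val M (setr st 7 e1) (Get 12 (idx (Reg 6) (Reg 4))) = e2.
  by rewrite getE (idxE (n := n) (i := p) (j := t) (m := n)) // ltnW ?(fits_sq hF).
apply: (@runs_then _ _ _ _ _ _ _ (fun st' => reg st' 7 = e)).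
  apply: runs_if => /=; ev => h.
    by apply: runs_skip; ev; rewrite /e; apply/esym/minn_idPl.
  apply: runs_assign; ev; rewrite /e; apply/esym/minn_idPr.
  by rewrite -ltnNge in h; apply: ltnW.
move=> st1 f1 r7.
have E1 : query_env s t st1 by apply: query_env_frame f1 _ _ _ _ => //; split.
have x5 : reg st1 5 = b * n.+1 by rewrite (frame_reg f1).
have x6 : reg st1 6 = p by rewrite (frame_reg f1).
have w1 : warr st1 1 = warr st 1 by rewrite (frame_warr f1).
apply: (@runs_then _ _ _ _ _ _ _ (fun st' =>
  [/\ good_value s t (warr st' 1 b),
      forall j, j < e -> j < n -> (warr st' 1 b <= newkey s t j)%E
    & forall j, j != b -> warr st' 1 j = warr st0 1 j])).
  apply: runs_if; rewrite -[test_val _ _ _]/(reg st1 7 <= reg st1 6) r7 x6 => h.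
    apply: runs_skip; rewrite w1; split=> // j je jn; apply: I3 => //.
    exact: leq_trans je h.
  rewrite -ltnNge in h; set k := trunc_log 2 (e - p).
  have ep : 0 < e - p by rewrite subn_gt0.
  have k1 : 2 ^ k <= e - p by apply: trunc_logP.
  have k2 : e - p < 2 ^ k + 2 ^ k by rewrite addnn -mul2n -expnS; apply: trunc_log_ltn.
  have kL : k <= L by rewrite /k /bitlen leqW // leq_trunc_log //; lia.
  have [y0 y3 y4 yd yn yp yt] := E1.
  apply: runs_seq; apply: runs_assign.
  have -> : word_val M st1 (Get 8 (Defs.Sub (Reg 7) (Reg 6))) = 2 ^ k.
    by rewrite /= r7 x6 yp //; lia.
  set st2 := setr _ _ _.
  have E2 : query_env s t st2 by split.
  have p0 := ltn_expl k (isT : 1 < 2).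
  have z59 : word_val M st2 (Add (Reg 5) (Reg 9)) = b * n.+1 + 2 ^ k.
    rewrite -[LHS]/((reg st1 5 + 2 ^ k) %% M) x5 modn_small //.
    by apply: (base_lt hF) => //; lia.
  have tab (st' : state R) f q : query_env s t st' -> word_val M st' (Add (Reg 5) (Reg 9)) =
    b * n.+1 + 2 ^ k ->
      word_val M st' f = q -> q + 2 ^ k <= n ->
      weight_val M st' (WGet 5 (idx (Add (Reg 5) (Reg 9)) f)) = rangemin (key din dout s t) k q.
    move=> [z0 _ _ _ _ _ zt] z1 z2 hq.
    by rewrite wgetE (entryE hF z0 z1 z2) ?zt //; lia.
  have gv q : p <= q -> q + 2 ^ k <= e -> good_value s t (rangemin (key din dout s t) k q).
    move=> pq qe; have [j [j1 j2 ->]] := rangemin_ex (key din dout s t) k q.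
    by right; exists j; first lia; apply: key_newkey => //; [lia | apply: skip; lia].
  apply: runs_then.
    apply: (improve_runs E2 sn tn (x := rangemin (key din dout s t) k p)).
    by apply: tab => //; lia.
  move=> st3 f3 [v3 u3].
  have E3 : query_env s t st3 by apply: query_env_frame f3 _ _ _ E2.
  apply: runs_imp.
    apply: (improve_runs E3 sn tn (x := rangemin (key din dout s t) k (e - 2 ^ k))).
    apply: tab => //; last lia.
      by rewrite -z59 /= !(frame_reg f3).
    by rewrite /= !(frame_reg f3) // -[reg st2 7]/(reg st1 7) r7.
  move=> st4 f4 [v4 u4]; rewrite v4 v3 -[warr st2]/(warr st1) w1; split.
  - by apply: good_min; [apply: good_min => //|]; apply: gv; lia.
  - move=> j je jn; have [jp|pj] := ltnP j p.
      by apply: le_trans (ereal_min_lel _ _) _; apply: le_trans (ereal_min_lel _ _) _; apply: I3.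
    rewrite -key_newkey //; last exact: skip.
    have [jk|kj] := ltnP j (p + 2 ^ k).
      apply: le_trans (ereal_min_lel _ _) _; apply: le_trans (ereal_min_ler _ _) _.
      exact: rangemin_le.
    by apply: le_trans (ereal_min_ler _ _) _; apply: rangemin_le; lia.
  - by move=> j hj; rewrite u4 // u3 // -[warr st2]/(warr st1) w1 I4.
move=> st2 f2 [J2 J3 J4].
have E2 : query_env s t st2 by apply: query_env_frame f2 _ _ _ E1.
have z7 : reg st2 7 = e by rewrite (frame_reg f2).
have z0 : reg st2 0 = n by case: E2.
apply: (@runs_then _ _ _ _ _ _ _ (fun st' =>
  [/\ good_value s t (warr st' 1 b),
      forall j, j < e.+1 -> j < n -> (warr st' 1 b <= newkey s t j)%E
    & forall j, j != b -> warr st' 1 j = warr st0 1 j])).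
  apply: runs_if; rewrite -[test_val _ _ _]/(reg st2 0 <= reg st2 7) z0 z7 => h.
    by apply: runs_skip; split=> // j _ jn; apply: J3 => //; apply: leq_trans jn h.
  rewrite -ltnNge in h.
  apply: runs_imp.
    apply: (improve_runs E2 sn tn (x := newkey s t e)).
    have [_ z3 z4 zd _ _ _] := E2.
    rewrite -[LHS]/(warr st2 4 (word_val M st2 (idx (Reg 7) (Reg 3))) +
      warr st2 3 (word_val M st2 (idx (Reg 7) (Reg 4))))%E.
    rewrite (idxE (n := n) (i := e) (j := s) (m := n)) ?(ltnW (fits_sq hF)) //.
    rewrite (idxE (n := n) (i := e) (j := t) (m := n)) ?(ltnW (fits_sq hF)) //.
    by rewrite /newkey -(zd true e s h sn) -(zd false e t h tn).
  move=> st3 _ [v3 u3]; rewrite v3; split.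
  - by apply: good_min => //; right; exists e.
  - move=> j; rewrite ltnS leq_eqVlt => /predU1P[->|je] jn; first exact: ereal_min_ler.
    by apply: le_trans (ereal_min_lel _ _) _; apply: J3.
  - by move=> j hj; rewrite u3 // J4.
move=> st3 f3 [K2 K3 K4]; apply: runs_assign.
have -> : word_val M st3 (Add (Reg 7) (Const 1)) = e.+1.
  rewrite /= (frame_reg f3) // z7 [1 %% M]modn_small ?addn1 ?modn_small //; lia.
split.
  by split=> //; ev.
rewrite /potential; ev; rewrite -/p pn.
have [e_n|e_n] := ltnP e n.
  have -> : \sum_(p <= j < n) bad s t j =
      \sum_(p <= j < e.+1) bad s t j + \sum_(e.+1 <= j < n) bad s t j.
    by apply: big_cat_nat => //; apply: leqW.
  have -> : \sum_(p <= j < e.+1) bad s t j = \sum_(p <= j < e) bad s t j + 1.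
    by rewrite big_nat_recr //= badE.
  by case: (e.+1 < n); lia.
have ee : e = n by apply/eqP; rewrite eqn_leq en e_n.
by rewrite ltnNge ee leqnSn /= big_geq ?leqnSn //; lia.
Qed.

Lemma answer_runs s t st : s < n -> t < n -> query_env s t st ->
  runs answer st (15 * \sum_(j < n) bad s t j + 20) (fun st' =>
    [/\ good_value s t (warr st' 1 (s * n + t)),
        forall j, j < n -> (warr st' 1 (s * n + t) <= newkey s t j)%E
      & forall j, j != s * n + t -> warr st' 1 j = warr st 1 j]).
Proof.
move=> sn tn E; have [q0 q3 q4 _ _ _ _] := E.
have M4 := four_lt_M hF; have h4 := fits_two hF; have h0 := n0.
have hb := pair_lt sn tn.
apply: (@runs_le _ _ _ _ (1 + (1 + (1 + (15 * (1 + \sum_(j < n) bad s t j) + 2))))); last lia.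
apply: runs_seq; apply: runs_wstore.
have hidx (st' : state R) : reg st' 0 = n -> reg st' 3 = s -> reg st' 4 = t ->
    word_val M st' (idx (Reg 3) (Reg 4)) = s * n + t.
  by move=> *; apply: (idxE (m := n)) => //; apply: ltnW (fits_sq hF).
rewrite hidx //; set st1 := setw _ _ _ _.
apply: runs_seq; apply: runs_assign.
have -> : word_val M st1 (Mul (idx (Reg 3) (Reg 4)) (Add (Reg 0) (Const 1))) = (s * n + t) * n.+1.
  rewrite -[LHS]/((word_val M st1 (idx (Reg 3) (Reg 4)) * ((reg st1 0 + 1 %% M) %% M)) %% M).
  rewrite hidx // -[reg st1 0]/(reg st 0) q0.
  rewrite [1 %% M]modn_small ?addn1 ?[n.+1 %% M]modn_small ?modn_small //; try lia.
  by have := base_lt hF hb (leq0n n); rewrite addn0.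
apply: runs_seq; apply: runs_assign; rewrite -[word_val _ _ _]/(0 %% M) mod0n.
set st2 := setr _ _ _.
have E2 : query_env s t st2.
  case: E => e1 e2 e3 e4 e5 e6 e7; split=> //.
  by move=> dir i v hi hv; rewrite -e4 //; case: (dir).
have phi0 : potential s t st2 = 15 * (1 + \sum_(j < n) bad s t j).
  by rewrite /potential -[reg st2 6]/0 h0 big_mkord.
rewrite -phi0.
apply: runs_imp; first apply: (@runs_while _ _ _ _ (query_inv s t st)).
- split=> //; first by left; rewrite /st2; ev; rewrite eqxx.
  by move=> j hj; rewrite /st2; ev; rewrite (negbTE hj).
- move=> st3 f3 I3; rewrite -[test_val _ _ _]/(~~ (reg st3 0 <= reg st3 6)) => ht.
  have E3 : query_env s t st3 by apply: query_env_frame f3 _ _ _ E2.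
  have r0 : reg st3 0 = n by case: E3.
  exists 14; apply: answer_step_runs => //.
    by rewrite (frame_reg f3).
  by rewrite -r0 ltnNge.
- move=> st3 f3 [[I1 I2 I3 I4]]; rewrite -[test_val _ _ _]/(~~ (reg st3 0 <= reg st3 6)) negbK.
  rewrite (frame_reg f3) // -[reg st2 0]/(reg st 0) q0 => hn.
  by split=> // j jn; apply: I3 => //; apply: leq_trans jn hn.
Qed.

Definition answers : prog := For 3 0 (For 4 0 answer).

Lemma answers_runs st : reg st 0 = n ->
  (forall dir i v, i < n -> v < n -> warr st (dist_arr dir) (i * n + v) = N dir i v) ->
  (forall dir i v, i < n -> v < n -> is_next dir v i (arr st (next_arr dir) (i * n + v))) ->
  powers_ok n st -> (forall s t, s < n -> t < n -> table_ok n din dout st s t L) ->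
  runs answers st
    (\sum_(s < n) (\sum_(t < n) (15 * (\sum_(j < n) bad s t j) + 20 + 2) + 3 + 2) + 3)
    (fun st' => forall s t, s < n -> t < n ->
      good_value s t (warr st' 1 (s * n + t)) /\
      forall j, j < n -> (warr st' 1 (s * n + t) <= newkey s t j)%E).
Proof.
move=> r0 qd qn qp qt; have hn : n < M by apply: n_lt_M hF.
pose ok (st' : state R) s t := good_value s t (warr st' 1 (s * n + t)) /\
      forall j, j < n -> (warr st' 1 (s * n + t) <= newkey s t j)%E.
apply: (@runs_for _ _ _ _ _ (fun s => \sum_(t < n) (15 * (\sum_(j < n) bad s t j) + 20 + 2) + 3)
  (fun m st' => forall s t, s < m -> t < n -> ok st' s t) _ n) => //.
move=> s st1 sn f1 r3 I1.
apply: runs_imp; first apply: (@runs_for _ _ _ _ _ (fun t => 15 * (\sum_(j < n) bad s t j) + 20)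
  (fun m st' => (forall s' t, s' < s -> t < n -> ok st' s' t) /\
     forall t, t < m -> ok st' s t) _ n) => //.
- by rewrite (frame_reg f1).
- move=> t st2 tn f2 r4 [J1 J2].
  have E2 : query_env s t st2.
    split=> //.
    + by rewrite (frame_reg f2) // (frame_reg f1).
    + by rewrite (frame_reg f2).
    + by move=> dir i v hi hv; rewrite (frame_warr f2) ?(frame_warr f1) ?qd //; case: (dir).
    + move=> dir i v hi hv; rewrite (frame_arr f2) ?(frame_arr f1) //.
      exact: qn.
    + by move=> m m0 mn; rewrite (frame_arr f2) // (frame_arr f1) // qp.
    + by move=> a i aL hi; rewrite (frame_warr f2) // (frame_warr f1) // qt.
  apply: runs_imp; first exact: answer_runs E2.
  move=> st3 f3 [K1 K2 K3].
  have keep s' t' : s' * n + t' != s * n + t -> ok st2 s' t' -> ok (setr st3 4 t.+1) s' t'.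
    by move=> hne; rewrite /ok -[warr (setr _ _ _)]/(warr st3) K3.
  split=> [s' t' ss tn'|t'].
    apply: keep (J1 _ _ ss tn'); rewrite neq_ltn; apply/orP; left.
    by apply: leq_trans (leq_addr _ _); apply: lt_idx.
  rewrite ltnS leq_eqVlt => /predU1P[->//|tt].
  by apply: keep (J2 _ tt); rewrite neq_ltn ltn_add2l tt.
- move=> st2 _ [J1 J2] s' t; rewrite ltnS leq_eqVlt => /predU1P[->|ss] tn.
    exact: J2.
  exact: J1.
Qed.

End Nexts.

(** * Time and correctness of both programs *)

Definition preprocess_prog (K : nat) : prog :=
  Seq (setup K) (Seq sampling (Seq (For 3 0 slot) tables)).

Definition repair_slot : prog :=
  Seq (Assign 4 (Get 5 (Reg 3))) (Seq (repair false) (repair true)).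

Definition delete_prog (K : nat) : prog :=
  Seq (setup K) (Seq (For 3 0 repair_slot) (Seq (nexts false) (Seq (nexts true) answers))).

Lemma sum_affine n a b c m (f g : 'I_n -> nat) :
  \sum_(i < n) (a * (m * f i) + b * (m * g i) + c) =
  a * (m * \sum_(i < n) f i) + b * (m * \sum_(i < n) g i) + c * n.
Proof.
rewrite !big_split /= sum_nat_const card_ord [n * c]mulnC.
by rewrite -!big_distrr.
Qed.

Lemma sum_affine1 n a c (f : 'I_n -> nat) :
  \sum_(i < n) (a * f i + c) = a * (\sum_(i < n) f i) + c * n.
Proof. by rewrite big_split /= sum_nat_const card_ord [n * c]mulnC -big_distrr. Qed.

Lemma sum_below n q c : \sum_(i < n) (if i < q then c else 0) <= c * minn n q.
Proof.
elim: n => [|n IH]; first by rewrite big_ord0.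
rewrite big_ord_recr /=; apply: leq_trans (leq_add IH (leqnn _)) _.
by case: ltnP => nq; rewrite ?addn0 -?mulnSr leq_mul2l; apply/orP; right; lia.
Qed.

Section Assembly.
Variables (R : realType) (M n K : nat) (A : nat -> \bar R) (r : seq bool).
Local Notation L := (bitlen n).
Local Notation lam := (K * L).
Hypothesis hF : fits M n lam.
Hypothesis KM : K < M.
Hypothesis A0 : forall i, (0 <= A i)%E.
Local Notation n0 := (fits_n hF).
Local Notation nl := (n * lam).
Local Notation runs := (@runs R M).
Local Notation samp := (sample n r).
Local Notation chosen := (chosen A n lam samp).
Local Notation centre := (centre A n lam samp).
Local Notation sdist := (sdist A n lam samp).
Local Notation hops := (hops n lam).

Definition key_in (i v : nat) : \bar R := sdist i true v.
Definition key_out (i v : nat) : \bar R := sdist i false v.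

Record ready (st : state R) : Prop := Ready {
  ready_built : built n lam A samp n st;
  ready_powers : powers_ok n st;
  ready_tables : forall s t, s < n -> t < n -> table_ok n key_in key_out st s t L;
  ready_graph : warr st 0 = A }.

Lemma sum_slot_cost : \sum_(i < n) (slot_cost n (hops i) + 2) <=
  80 * (n * n * n) * (lam * L + 1) + 2 * n.
Proof.
rewrite big_split /= sum_nat_const card_ord [n * 2]mulnC leq_add2r.
rewrite /slot_cost -big_distrr -big_distrl /= -!mulnA leq_mul2l /=.
have h : \sum_(i < n) (hops i).+1 <= nl * L + n.
  apply: leq_trans (_ : \sum_(i < n) (hops i + 1) <= _).
    by apply: leq_sum => i _; rewrite addn1.
  by rewrite big_split /= sum_nat_const card_ord muln1 leq_add2r; apply: sum_div_le.
apply: leq_trans (leq_mul h (leqnn _)) _.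
by rewrite mulnDl mulnDr; lia.
Qed.

Lemma preprocess_runs st : size (coins st) = n * L -> coins st = r ->
  reg st 0 = n -> reg st 1 = 0 -> (forall v, arr st 3 v = 0) -> (forall v, arr st 4 v = 0) ->
  warr st 0 = A ->
  runs (preprocess_prog K) st ((80 * K + 300) * (n * n * n) * (L * L)) ready.
Proof.
move=> hs hr r0 r1 h3 h4 hA; have h0 := n0; have M4 := fits_two hF.
have M2 : 2 * n < M by lia.
have hKM : n * (K * L) < M by have := fits_lay hF; nia.
apply: (@runs_le _ _ _ _ ((n * 5 + 5) + ((n * (L * 4 + 7) + 3) +
   ((\sum_(i < n) (slot_cost n (hops i) + 2) + 3) + (n * n * n * L * 40 + 20))))); last first.
  have := sum_slot_cost; set S := \sum_(i < n) _ => hS.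
  have L0 : 0 < L by [].
  move: hS; move: (L) L0 => l L0 hS.
  have e1 : n <= n * n * n * (l * l) by rewrite -!mulnA leq_pmulr // !muln_gt0 h0 L0.
  have e2 : n * l <= n * n * n * (l * l).
    have -> : n * n * n * (l * l) = n * l * (n * n * l) by lia.
    by rewrite leq_pmulr // !muln_gt0 h0 L0.
  have e3 : 1 <= n * n * n * (l * l) by rewrite !muln_gt0 h0 L0.
  have e4 : n * n * n * l <= n * n * n * (l * l) by rewrite leq_mul2l leq_pmulr // orbT.
  have e5 : n * n * n <= n * n * n * (l * l) by rewrite leq_pmulr // muln_gt0 L0.
  have e6 : 80 * (n * n * n) * (K * l * l + 1) = (80 * K) * (n * n * n * (l * l)) +
    80 * (n * n * n) by lia.
  have e7 : (80 * K + 300) * (n * n * n) * (l * l) = (80 * K) * (n * n * n * (l * l)) +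
    300 * (n * n * n * (l * l)) by lia.
  rewrite e7; rewrite e6 in hS; lia.
apply: runs_then; first exact: (setup_runs h0 M2).
move=> st1 f1 [s1 s2].
have s0 : reg st1 0 = n by rewrite (frame_reg f1).
have c1 : coins st1 = coins st by rewrite (frame_coins f1).
apply: runs_then; first by apply: (sampling_runs h0 M2); rewrite ?c1.
move=> st2 f2 hsamp.
have q x : x \in [:: 0; 1; 2] -> reg st2 x = reg st1 x.
  by rewrite !inE => /or3P[] /eqP ->; rewrite (frame_reg f2).
have w2 a : warr st2 a = warr st a by rewrite (frame_warr f2) // (frame_warr f1).
have a2 a : a != 2 -> arr st2 a = arr st a.
  by move=> na; rewrite (frame_arr f2) ?(frame_arr f1) //= inE.
apply: runs_then.
  apply: (slots_runs (A := A) (samp := samp) hF).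
  - by rewrite q.
  - by rewrite q.
  - by rewrite w2.
  - by move=> j jn; rewrite hsamp // c1 hr.
  - by move=> v; rewrite a2.
  - by move=> v; rewrite a2.
move=> st3 f3 B.
have t0 : reg st3 0 = n by rewrite (frame_reg f3) // q.
have t1 : reg st3 1 = L by rewrite (frame_reg f3) // q.
apply: runs_imp; first apply: (tables_runs (din := key_in) (dout := key_out) hF t0 t1).
- by move=> i v hi hv; apply: (built_dist B true).
- by move=> i v hi hv; apply: (built_dist B false).
move=> st4 f4 [P T]; split=> //; last by rewrite (frame_warr f4) // (frame_warr f3) // w2.
case: B => b1 b2 b3 b4 b5; split.
- by move=> v vn; rewrite (frame_arr f4) // b1.
- by move=> v vn; rewrite (frame_arr f4) // b2.
- by move=> v vn; rewrite (frame_arr f4) // b3.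
- by move=> dir j k t hj hk ht; rewrite (frame_arr f4) ?b4 //; case: (dir).
- by move=> dir j t hj ht; rewrite (frame_warr f4) ?b5 //; case: (dir).
Qed.

Variable D : pred nat.

Definition affected (dir : bool) (i t : nat) : bool :=
  hurt n lam A dir (mem (chosen i)) (centre i) i D t.

(* After the repair, [N] bounds the distances in the graph without [D] by walks
   that avoid the earlier centres and have at most [hops i] arcs. *)
Record repaired_row (dir : bool) (i : nat) (N : nat -> \bar R) : Prop := RepairedRow {
  repaired_valid : valid_row n lam A dir (mem (chosen i)) (centre i) i D N;
  repaired_closed : forall v y, v < n -> y < n -> affected dir i v -> ~~ D v -> ~~ D y ->
     (N v <= N y + wdir A n dir y v)%E }.

(** Induction along the walk. At an affected node, closure under relaxation extends the bound by one
    arc. At an unaffected node the stored value bounds the whole prefix at once, and only there the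
    number of arcs and the earlier centres matter. Repaired values carry no hop count: they may come
    from walks with more arcs, which are still walks outside [D]. *)
Lemma repaired_complete dir i N p : i < n -> repaired_row dir i N ->
  size p <= hops i ->
  all (fun x => [&& x < n, ~~ D x & x \notin chosen i]) (centre i :: p) ->
  (N (last (centre i) p) <= elen (wdir A n dir) (centre i) p)%E.
Proof.
move=> hi [V C]; have [cn cc] := centreP A lam samp hi.
have w0 : forall u v, (0 <= wdir A n dir u v)%E by apply: wdir_ge0.
elim/last_ind: p => [_ /= /andP[/and3P[_ Dc _] _]|p t IH].
  rewrite (row_unhurt V cn) ?lay_source //.
  rewrite /hurt negb_and; apply/orP; right; apply/hasPn => x hx.
  by rewrite (trail_source w0 cc hx).
rewrite size_rcons last_rcons elen_rcons => hs.
move=> /=; rewrite all_rcons => /and3P[hc /and3P[tn Dt ct] hp].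
have IHp : (N (last (centre i) p) <= elen (wdir A n dir) (centre i) p)%E.
  by apply: IH; [apply: ltnW | rewrite /= hc hp].
have [aff|aff] := boolP (affected dir i t).
  have [yn Dy] : last (centre i) p < n /\ ~~ D (last (centre i) p).
    have := mem_last (centre i) p; rewrite inE => /predU1P[->|/(allP hp)/and3P[]//].
    by case/and3P: hc.
  by apply: le_trans (C t _ tn yn aff Dt Dy) _; apply: leeD.
rewrite (row_unhurt V tn aff) -elen_rcons -[X in lay _ _ _ _ _ X](last_rcons (centre i) p t).
apply: lay_complete => //; first by rewrite size_rcons.
rewrite all_rcons tn ct /=; apply/allP => x /(allP hp)/and3P[-> _ hx].
exact: hx.
Qed.

Record repaired (m : nat) (st : state R) : Prop := Repaired {
  repaired_new : forall dir j, j < m -> repaired_row dir j (row n dir j st);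
  repaired_old : forall dir j t, m <= j -> j < n -> t < n -> row n dir j st t = sdist j dir t;
  repaired_aff : forall dir j t, j < m -> t < n ->
    arr st (aff_arr dir) (j * n + t) = affected dir j t }.

Lemma row_else dir i j (st st' : state R) t : same_elsewhere n dir i st st' ->
  j != i -> t < n -> row n dir j st' t = row n dir j st t.
Proof.
move=> S ji tn; apply: S; move: ji; rewrite neq_ltn => /orP[ji|ij]; apply/orP; [left|right].
  exact: lt_idx.
by apply: leq_trans (leq_addr _ _); rewrite leq_mul2r ij orbT.
Qed.

Definition damage (dir : bool) (i : nat) : nat := \sum_(t < n) affected dir i t.

Lemma repair_dir_runs dir i st : i < n -> bf_env n lam A st i (hops i) ->
  (forall v, v < n -> arr st 0 v = D v) ->
  (forall k t, k < hops i -> t < n ->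
    arr st (par_arr dir) ((i * nl + k) * n + t) = spar A n lam samp i dir k t) ->
  (forall t, t < n -> row n dir i st t = sdist i dir t) ->
  runs (repair dir) st (80 * (n * ((hops i).+1 + damage dir i))) (fun st' =>
    [/\ repaired_row dir i (row n dir i st'),
        same_elsewhere n dir i st st',
        forall t, t < n -> arr st' (aff_arr dir) (i * n + t) = affected dir i t
      & forall j, j < i * n -> arr st' (aff_arr dir) j = arr st (aff_arr dir) j]).
Proof.
move=> hi [[r0 r2 r3 r4] hA] hD hP hR; have [cn cc] := centreP A lam samp hi.
have E : del_env n lam A i D st by split.
apply: runs_imp; first exact: (repair_runs hF A0 hi cn cc E hP hR).
by move=> st' _ [h1 h2 h3 h4 h5]; split.
Qed.

Lemma repairs_runs st : reg st 0 = n -> reg st 2 = nl ->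
  (forall v, v < n -> arr st 0 v = D v) -> built n lam A samp n st -> warr st 0 = A ->
  runs (For 3 0 repair_slot) st
    (\sum_(i < n) (1 + (80 * (n * ((hops i).+1 + damage false i)) +
                        80 * (n * ((hops i).+1 + damage true i))) + 2) + 3)
    (repaired n).
Proof.
move=> r0 r2 hD B hA; have hn : n < M by apply: n_lt_M hF.
apply: (@runs_for _ _ _ _ _ (fun i => 1 + (80 * (n * ((hops i).+1 + damage false i)) +
    80 * (n * ((hops i).+1 + damage true i)))) repaired _ n) => //.
  split=> // dir j t _ jn tn; exact: (built_dist B).
move=> i st1 hi f1 r3 P1.
have s0 : reg st1 0 = n by rewrite (frame_reg f1).
have s2 : reg st1 2 = nl by rewrite (frame_reg f1).
have par1 dir : arr st1 (par_arr dir) = arr st (par_arr dir).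
  by rewrite (frame_arr f1) //; case: dir.
apply: runs_seq; apply: runs_assign.
have -> : word_val M st1 (Get 5 (Reg 3)) = hops i.
  by rewrite /= r3 (frame_arr f1) // (built_hop B).
set st2 := setr _ _ _.
have E2 : bf_env n lam A st2 i (hops i).
  by split; [split | rewrite -[warr st2]/(warr st1) (frame_warr f1)].
have hD2 v : v < n -> arr st2 0 v = D v.
  by move=> vn; rewrite -[arr st2]/(arr st1) (frame_arr f1) // hD.
apply: runs_then.
  apply: (@repair_dir_runs false i st2) => //.
    by move=> k t hk tn; rewrite -[arr st2]/(arr st1) par1 (built_par B).
  by move=> t tn; apply: (repaired_old P1).
move=> st3 f3 [R3 S3 A3 U3].
have E3 : bf_env n lam A st3 i (hops i) by apply: bf_env_frame f3 _ _ E2.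
have hD3 v : v < n -> arr st3 0 v = D v by move=> vn; rewrite (frame_arr f3) // hD2.
have w3 : warr st3 4 = warr st2 4 by rewrite (frame_warr f3).
apply: runs_imp; first apply: (@repair_dir_runs true i st3) => //.
- move=> k t hk tn; rewrite (frame_arr f3) // -[arr st2]/(arr st1) par1.
  exact: (built_par B).
- move=> t tn; rewrite /row -[dist_arr true]/4 w3.
  exact: (repaired_old P1 true).
move=> st4 f4 [R4 S4 A4 U4].
have w4 : warr st4 3 = warr st3 3 by rewrite (frame_warr f4).
have a4 : arr st4 9 = arr st3 9 by rewrite (frame_arr f4).
have a3 : arr st3 10 = arr st2 10 by rewrite (frame_arr f3).
have rowE dir j t : j != i -> t < n -> row n dir j st4 t = row n dir j st1 t.
  move=> ji tn; case: dir.
    by rewrite (row_else S4 ji tn) /row -[dist_arr true]/4 w3.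
  by rewrite /row -[dist_arr false]/3 w4 -/(row n false j st3 t) (row_else S3 ji tn).
split.
- move=> dir j; rewrite ltnS leq_eqVlt => /predU1P[->|ji].
    case: dir; first exact: R4.
    have e : row n false i (setr st4 3 i.+1) = row n false i st3.
      by apply: boolp.funext => t; rewrite /row -[dist_arr false]/3 -w4.
    by rewrite e.
  have [V C] := repaired_new P1 dir ji; have nji : j != i by rewrite neq_ltn ji.
  have e t : t < n -> row n dir j (setr st4 3 i.+1) t = row n dir j st1 t.
    by move=> tn; apply: rowE.
  split; first exact: eq_valid_row e V.
  by move=> v y vn yn h1 h2 h3; rewrite !e //; apply: C.
- move=> dir j t ij jn tn; have nji : j != i by rewrite neq_ltn ij orbT.
  by rewrite -[LHS]/(row n dir j st4 t) rowE // (repaired_old P1) // ltnW.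
- move=> dir j t; rewrite ltnS leq_eqVlt => /predU1P[->|ji] tn.
    by case: dir; [apply: A4 | rewrite -[LHS]/(arr st4 9 _) a4; apply: A3].
  have hlt : j * n + t < i * n by apply: lt_idx.
  rewrite -(repaired_aff P1) //; case: dir; rewrite -[LHS]/(arr st4 _ _).
    by rewrite U4 // -[aff_arr true]/10 a3.
  by rewrite -[aff_arr false]/9 a4 U3.
Qed.

Definition total_damage : nat := \sum_(i < n) (damage false i + damage true i).

Lemma delete_runs st : reg st 0 = n -> reg st 1 = 0 ->
  (forall v, v < n -> arr st 0 v = D v) -> ready st ->
  runs (delete_prog K) st (400 * (n * n * (lam * L + 1) + n * total_damage)) (fun st' =>
    exists N : bool -> nat -> nat -> \bar R,
      (forall dir i, i < n -> repaired_row dir i (N dir i)) /\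
      forall s t, s < n -> t < n ->
        good_value n N s t (warr st' 1 (s * n + t)) /\
        forall j, j < n -> (warr st' 1 (s * n + t) <= newkey N s t j)%E).
Proof.
move=> r0 r1 hD [B P T hA]; have h0 := n0; have M4 := fits_two hF.
have M2 : 2 * n < M by lia.
have hKM : n * (K * L) < M by have := fits_lay hF; nia.
set T1 := \sum_(i < n) (1 + (80 * (n * ((hops i).+1 + damage false i)) +
                        80 * (n * ((hops i).+1 + damage true i))) + 2).
set T2 := \sum_(s < n) (\sum_(t < n) (15 * (\sum_(j < n) bad affected s t j) + 20 + 2) + 3 + 2).
have hT1 : T1 <= 160 * (n * n * (lam * L + 1)) + 80 * (n * total_damage) + 3 * n.
  rewrite /T1 (eq_bigr (fun i : 'I_n => 160 * (n * (hops i).+1) +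
      80 * (n * (damage false i + damage true i)) + 3)); last by move=> i _; lia.
  rewrite sum_affine -/total_damage.
  have h : \sum_(i < n) (hops i).+1 <= nl * L + n.
    apply: leq_trans (_ : \sum_(i < n) (hops i + 1) <= _).
      by apply: leq_sum => i _; rewrite addn1.
    by rewrite big_split /= sum_nat_const card_ord muln1 leq_add2r; apply: sum_div_le.
  rewrite leq_add2r leq_add2r leq_mul2l /=.
  by apply: leq_trans (leq_mul (leqnn n) h) _; lia.
have hT2 : T2 <= 15 * (n * total_damage) + 22 * (n * n) + 5 * n.
  have -> : T2 = 15 * (\sum_(s < n) \sum_(t < n) \sum_(j < n) bad affected s t j) +
      (22 * n + 5) * n.
    rewrite /T2 -sum_affine1; apply: eq_bigr => s _.
    rewrite (eq_bigr (fun t : 'I_n => 15 * (\sum_(j < n) bad affected s t j) + 22)).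
      by rewrite sum_affine1; lia.
    by move=> t _; rewrite -addnA.
  (* An affected entry interrupts the runs of only the [n] pairs that have its node at the
     corresponding end. *)
  have h : \sum_(s < n) \sum_(t < n) \sum_(j < n) bad affected s t j <= n * total_damage.
    apply: (@leq_trans (\sum_(s < n) \sum_(t < n) \sum_(j < n) (affected true j s +
      affected false j t))).
      apply: leq_sum => s _; apply: leq_sum => t _; apply: leq_sum => j _.
      by rewrite /bad; case: (affected true j s); case: (affected false j t).
    rewrite (eq_bigr (fun s : 'I_n => n * (\sum_(j < n) affected true j s) +
      \sum_(j < n) damage false j)).
      rewrite big_split /= -big_distrr /= exchange_big /= sum_nat_const card_ord.
      by rewrite /total_damage big_split /= mulnDr addnC.
    move=> s _; rewrite (eq_bigr (fun t : 'I_n => \sum_(j < n) affected true j s +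
      \sum_(j < n) affected false j t)).
      by rewrite big_split /= sum_nat_const card_ord exchange_big.
    by move=> t _; rewrite big_split.
  by apply: leq_trans (leq_add (leq_mul (leqnn 15) h) (leqnn _)) _; lia.
apply: (@runs_le _ _ _ _ ((n * 5 + 5) + ((T1 + 3) + ((n * (n * 4 + 9) + 6) +
   ((n * (n * 4 + 9) + 6) + (T2 + 3)))))); last first.
  have e1 : n <= n * n by rewrite leq_pmulr.
  have e2 : n * n <= n * n * (lam * L + 1) by rewrite leq_pmulr // addn1.
  have e3 : 1 <= n * n by rewrite muln_gt0 h0.
  lia.
apply: runs_then; first exact: (setup_runs h0 M2).
move=> st1 f1 [s1 s2].
have s0 : reg st1 0 = n by rewrite (frame_reg f1).
have a1 a : arr st1 a = arr st a by rewrite (frame_arr f1).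
have w1 a : warr st1 a = warr st a by rewrite (frame_warr f1).
apply: runs_then.
  apply: repairs_runs => //; rewrite ?a1 ?w1 //.
  case: B => b1 b2 b3 b4 b5; split=> *; rewrite ?a1 ?w1;
    by [apply: b1 | apply: b2 | apply: b3 | apply: b4 | apply: b5].
move=> st2 f2 P2.
have q0 : reg st2 0 = n by rewrite (frame_reg f2).
apply: runs_then.
  apply: (nexts_runs (aff := affected) hF q0) => i t hi tn.
  exact: (repaired_aff P2).
move=> st3 f3 N3.
have q3 : reg st3 0 = n by rewrite (frame_reg f3).
apply: runs_then.
  apply: (nexts_runs (aff := affected) hF q3) => i t hi tn.
  rewrite (frame_arr f3) //; exact: (repaired_aff P2).
move=> st4 f4 N4.
pose N dir i t := row n dir i st2 t.
have unhurt dir i t : i < n -> t < n -> ~~ affected dir i t -> N dir i t = sdist i dir t.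
  by move=> hi tn h; have [V _] := repaired_new P2 dir hi; apply: (row_unhurt V tn h).
apply: runs_imp.
  apply: (answers_runs (aff := affected) (din := key_in) (dout := key_out) (N := N) hF).
  - by move=> i t hi tn; apply: unhurt.
  - by move=> i t hi tn; apply: unhurt.
  - by rewrite (frame_reg f4).
  - by move=> dir i v hi vn; rewrite (frame_warr f4) ?(frame_warr f3) //; case: dir.
  - move=> dir i v hi vn; case: dir; first exact: N4.
    rewrite (frame_arr f4) //; exact: N3.
  - by move=> m m0 mn; rewrite (frame_arr f4) // (frame_arr f3) // (frame_arr f2) // a1 P.
  - move=> s t sn tn a i aL hi; rewrite (frame_warr f4) // (frame_warr f3) // (frame_warr f2) //
      w1.
    exact: T.
move=> st5 _ h; exists N; split=> // dir i hi; exact: (repaired_new P2 dir hi).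
Qed.

Local Notation w := (wdir A n false).

(** A row of direction [true] provides a walk from the centre in the reversed graph; turned around,
    it leads from [s] to the centre, where the walk of the other row continues. *)
Lemma answer_sound N s t x : s < n -> t < n ->
  (forall dir i, i < n -> repaired_row dir i (N dir i)) -> good_value n N s t x ->
  (x < +oo)%E -> exists p, [/\ last s p = t, elen w s p = x &
     all (fun x => (x < n) && ~~ D x) p].
Proof.
move=> sn tn hN [->|[i hi ->]]; first by rewrite ltxx.
rewrite /newkey => fin.
have N0 dir v : v < n -> (0 <= N dir i v)%E.
  move=> vn; have [V _] := hN dir i hi.
  have [->|fv] := eqVneq (N dir i v) +oo%E; first exact: leey.
  rewrite -ltey in fv; have [p [_ <- _]] := row_sound V vn fv.
  by apply: elen_ge0; apply: wdir_ge0.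
have f1 : (N true i s < +oo)%E by apply: le_lt_trans fin; rewrite leeDl ?N0.
have f2 : (N false i t < +oo)%E by apply: le_lt_trans fin; rewrite leeDr ?N0.
have [V1 _] := hN true i hi; have [V2 _] := hN false i hi.
have [p1 [l1 e1 a1]] := row_sound V1 sn f1.
have [p2 [l2 e2 a2]] := row_sound V2 tn f2.
have hl : last s (rev (belast (centre i) p1)) = centre i.
  by case: (p1) l1 => [<-//|y q] _ /=; rewrite rev_cons last_rcons.
exists (rev (belast (centre i) p1) ++ p2); split.
- by rewrite last_cat hl.
- rewrite elen_cat hl e2 -e1; congr (_ + _)%E.
  by have := elen_rev w (centre i) p1; rewrite l1 => <-.
- rewrite all_cat all_rev; apply/andP; split; last by case/andP: a2.
  by move: a1; rewrite lastI all_rcons => /andP[].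
Qed.

(** The path is split at the centre; both halves inherit the bound on the number of arcs and the
    avoidance of [D] and of the earlier centres. *)
Lemma answer_complete N s p x i : i < n ->
  (forall dir j, j < n -> repaired_row dir j (N dir j)) ->
  (forall j, j < n -> (x <= newkey N s (last s p) j)%E) ->
  all (fun y => [&& y < n, ~~ D y & y \notin chosen i]) (s :: p) ->
  centre i \in s :: p -> size p <= hops i -> (x <= elen w s p)%E.
Proof.
move=> hi hN hx ha hc hs; apply: le_trans (hx i hi) _; rewrite /newkey.
case/splitPl: hc ha hs => p1 p2 hlast.
rewrite last_cat elen_cat hlast -cat_cons all_cat size_cat => /andP[a1 a2] hs.
have ac : [&& centre i < n, ~~ D (centre i) & centre i \notin chosen i].
  by apply: (allP a1); rewrite -hlast mem_last.
apply: leeD.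
  have h := repaired_complete hi (hN true i hi) (p := rev (belast s p1)).
  have e : last (centre i) (rev (belast s p1)) = s.
    by case: (p1) hlast => [<-//|y q] _ /=; rewrite rev_cons last_rcons.
  rewrite e -hlast in h; apply: le_trans (h _ _) _.
  - rewrite size_rev size_belast; exact: leq_trans (leq_addr _ _) hs.
  - rewrite hlast /= ac all_rev /=.
    by move: a1; rewrite lastI all_rcons => /andP[].
  - rewrite le_eqVlt; apply/orP; left; apply/eqP.
    by have := elen_rev (wdir A n true) s p1; rewrite hlast => ->.
apply: (repaired_complete hi (hN false i hi)).
  exact: leq_trans (leq_addl _ _) hs.
by rewrite /= ac.
Qed.

(* The first centre on a short path is found early, because of the samples. *)
Lemma first_hit (p : seq nat) (s : nat) : uniq (s :: p) -> all (gtn n) (s :: p) ->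
  size (s :: p) <= lam \/
  (exists2 j, j < nl %/ (2 * size (s :: p)) & samp j \in s :: p) ->
  exists i, [/\ i < n, centre i \in s :: p, size p <= hops i &
    all (fun y => y \notin chosen i) (s :: p)].
Proof.
move=> up ap hit; set m := size (s :: p) in hit; have h0 := n0.
have m0 : 0 < m by [].
(* A slot that still has enough rounds and by whose end the path has been hit. For a short path it
   is the last one, where [hops] is [lam] and every node is a centre; for a long path it is the slot
   [2 * j] of a sample on the path. *)
have [i0 [h1 h2 h3]] : exists i0, [/\ i0 < n, m <= hops i0 & has (mem (chosen i0.+1)) (s :: p)].
  have [hm|hm] := leqP m lam.
    exists n.-1; rewrite prednK //; split=> //.
      by rewrite /hops prednK // mulKn.
    by apply/hasP; exists s; rewrite ?mem_head //; apply: chosen_all; case/andP: ap.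
  case: hit => [|[j hj sj]]; first by rewrite leqNgt hm.
  (* This gives both requirements: [2 * j < n] because [m] exceeds [lam], and
     [m <= hops (2 * j)]. *)
  have hJ : (2 * j + 2) * m <= nl.
    have := leq_trunc_div nl (2 * m); set J := nl %/ _ in hj * => h.
    apply: leq_trans h; nia.
  exists (2 * j); split.
  - have : (2 * j + 2) * m < n * m by apply: leq_ltn_trans hJ _; rewrite ltn_mul2l h0.
    by rewrite ltn_mul2r => /andP[_]; lia.
  - by rewrite /hops leq_divRL //; apply: leq_trans hJ; rewrite mulnC leq_mul2r; lia.
  - apply/hasP; exists (samp j) => //.
    have {2}-> : j = (2 * j)./2 by rewrite mul2n doubleK.
    apply: sample_chosen; first by rewrite mul2n odd_double.
    by rewrite mul2n doubleK; have := allP ap _ sj.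
have ex : exists i, has (mem (chosen i.+1)) (s :: p) by exists i0.
(* The earliest slot whose centre lies on the path. Earlier centres miss the path, and [hops] is
   decreasing, so the bound at [i0] carries over. *)
case: (ex_minnP ex) => i /hasP[y yp yi] imin.
have ii0 : i <= i0 by apply: imin.
have ac : all (fun y => y \notin chosen i) (s :: p).
  apply/allP => z zp; apply/negP => zi.
  case: i imin yi ii0 zi => // i imin _ _ zi.
  have : i.+1 <= i by apply: imin; apply/hasP; exists z.
  by rewrite ltnn.
exists i; split=> //.
- exact: leq_ltn_trans h1.
- move: yi; rewrite [mem _ _]mem_chosenS => /predU1P[<-//|yi].
  by have := allP ac y yp; rewrite yi.
- apply: (@leq_trans m) => //.
  by apply: leq_trans h2 _; rewrite /hops leq_div2l.
Qed.

(** An affected entry has a node of [D] on its trail, and this trail alone gave that node at least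
    [i + 1]. *)
Lemma damage_le i : i < n ->
  i.+1 * (damage false i + damage true i) <=
  \sum_(x < n | D x) (sload A n lam samp i false x + sload A n lam samp i true x).
Proof.
move=> hi; rewrite mulnDr big_split /=.
have H dir : i.+1 * damage dir i <= \sum_(x < n | D x) sload A n lam samp i dir x.
  rewrite /sload /load -big_distrr /= leq_mul2l /= /damage exchange_big /=.
  apply: leq_sum => t _; rewrite /affected /hurt /visits.
  set tr := trail _ _ _ _ _ _.
  case: (_ < +oo)%E; last by [].
  case: hasP => // -[x xt Dx].
  have tl y : y \in tr -> y < n.
    rewrite /tr; elim: (hops i) (t : nat) (ltn_ord t) => [|k IH] u un /=.
      by rewrite inE => /eqP ->.
    by rewrite inE => /predU1P[->//|]; apply: IH; apply: par_lt.
  rewrite (bigD1 (Ordinal (tl x xt))) //=.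
  by apply: leq_trans (leq_addr _ _); rewrite -has_count has_pred1.
by apply: leq_add.
Qed.

(** The first [q] slots are charged trivially with [2 * n] entries each. In a later slot every
    affected entry accounts for more than [q] units of the counters of [D], which are capped by the
    potential argument. *)
Lemma total_damage_le q : q * total_damage <= 2 * n * q * q +
  (\sum_(x < n) D x) * cnt_cap n lam L.
Proof.
have h0 := n0.
have H1 : \sum_(i < n) i.+1 * (damage false i + damage true i) <=
  (\sum_(x < n) D x) * cnt_cap n lam L.
  apply: (@leq_trans (\sum_(x < n | D x) cnt A n lam samp n x)).
    have -> : \sum_(x < n | D x) cnt A n lam samp n x = \sum_(x < n | D x)
        \sum_(i < n) (sload A n lam samp i false x + sload A n lam samp i true x).
      by apply: eq_bigr => x _; rewrite cnt_sum.
    rewrite exchange_big /=; apply: leq_sum => i _; exact: damage_le.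
  rewrite big_distrl /= [leqRHS](bigID (fun x : 'I_n => D x)) /=.
  apply: leq_trans (leq_addr _ _); apply: leq_sum => x ->; rewrite mul1n.
  by apply: cnt_le => //; apply: bitlen_gt.
have dn i : damage false i + damage true i <= 2 * n.
  have H dir : damage dir i <= n.
    apply: (@leq_trans (\sum_(t < n) 1)); last by rewrite sum_nat_const card_ord muln1.
    by apply: leq_sum => t _; case: affected.
  by have := H false; have := H true; lia.
rewrite /total_damage big_distrr /=.
apply: (@leq_trans (\sum_(i < n) ((if i < q then 2 * n * q else 0) +
  i.+1 * (damage false i + damage true i)))).
  apply: leq_sum => i _; case: ltnP => iq.
    by have := dn i; nia.
  by rewrite add0n leq_mul2r (leqW iq) orbT.
rewrite big_split /= leq_add //; apply: leq_trans (sum_below _ _ _) _.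
by rewrite leq_mul2l geq_minr orbT.
Qed.

End Assembly.

(** * Probability *)

Section Sampling.

Lemma bval_inj l l' : size l = size l' -> bval l = bval l' -> l = l'.
Proof.
elim/last_ind: l l' => [|l b IH] l'; first by case: l'.
case/lastP: l' => [|l' b']; first by rewrite size_rcons.
rewrite !size_rcons !bval_rcons => -[hs] e.
have eb : b = b' by move: e; case: b; case: b'; lia.
by rewrite eb (IH l') //; move: e; rewrite eb; lia.
Qed.

Variables (n : nat).
Local Notation L := (bitlen n).
Local Notation N := (2 ^ L).

Lemma sample_lt r j : sample n r j < N.
Proof.
rewrite /sample; apply: leq_trans (bval_lt _) _; rewrite leq_exp2l // size_take.
by case: ltnP => // /ltnW.
Qed.

Definition sample_fun (r : (n * L).-tuple bool) : {ffun 'I_n -> 'I_N} :=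
  [ffun j : 'I_n => Ordinal (sample_lt r j)].

(** Injectivity suffices: only upper bounds on the number of bad coin sequences are transferred to
    the samples. *)
Lemma sample_fun_inj : injective sample_fun.
Proof.
move=> r r' e; apply: val_inj; apply: (@eq_from_nth _ false).
  by rewrite !size_tuple.
move=> k; rewrite size_tuple => hk.
have L0 : 0 < L by [].
have hj : k %/ L < n by rewrite ltn_divLR.
have bs (x : (n * L).-tuple bool) : size (take L (drop (k %/ L * L) x)) = L.
  rewrite size_takel // size_drop size_tuple leq_subRL; last first.
    by rewrite leq_mul2r ltnW ?orbT.
  by rewrite -mulSnr leq_mul2r hj orbT.
have : take L (drop (k %/ L * L) r) = take L (drop (k %/ L * L) r').
  apply: bval_inj; first by rewrite !bs.
  by have := congr1 (fun f : {ffun 'I_n -> 'I_N} => val (f (Ordinal hj))) e; rewrite !ffunE.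
move/(congr1 (fun l => nth false l (k %% L))).
by rewrite !nth_take ?ltn_mod // !nth_drop -divn_eq.
Qed.

Lemma card_avoid (Q : seq nat) : uniq Q -> all (gtn N) Q ->
  #|[pred x : 'I_N | (x : nat) \notin Q]| = N - size Q.
Proof.
move=> uQ aQ; set P := [pred x : 'I_N | (x : nat) \in Q].
have h : #|P| = size Q.
  pose s := pmap (insub : nat -> option 'I_N) Q.
  have us : uniq s by apply: pmap_sub_uniq.
  have ss : size s = size Q.
    by rewrite size_pmap_sub; apply/eqP; rewrite -all_count.
  rewrite -ss -(card_uniqP us); apply: eq_card => x.
  by rewrite mem_pmap_sub inE.
have hc : #|[predC P]| = #|[pred x : 'I_N | (x : nat) \notin Q]|.
  by apply: eq_card => x; rewrite !inE.
have e := cardC P; rewrite card_ord h hc in e.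
by rewrite -[in RHS]e addKn.
Qed.

Lemma card_miss (Q : seq nat) (J : nat) : uniq Q -> all (gtn N) Q -> J <= n ->
  #|[set r : (n * L).-tuple bool | [forall j : 'I_n, (j < J) ==> (sample n r j \notin Q)]]|
    <= (N - size Q) ^ J * N ^ (n - J).
Proof.
move=> uQ aQ Jn.
pose F (j : 'I_n) : pred 'I_N := [pred x : 'I_N | (j < J) ==> ((x : nat) \notin Q)].
have -> : (N - size Q) ^ J * N ^ (n - J) = #|family F|.
  rewrite card_family foldrE big_map big_enum /=.
  rewrite (eq_bigr (fun j : 'I_n => if j < J then N - size Q else N)); last first.
    move=> j _; rewrite /F; case: ltnP => _.
      by rewrite -card_avoid //; apply: eq_card => x; rewrite !inE.
    by rewrite -[RHS]card_ord; apply: eq_card.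
  rewrite -(big_mkord xpredT (fun j => if j < J then N - size Q else N)).
  rewrite (big_cat_nat (n := J)) //=; congr (_ * _).
    rewrite big_nat (eq_bigr (fun=> N - size Q)) -?big_nat ?prod_nat_const_nat ?subn0 //.
    by move=> i /andP[_ ->].
  rewrite big_nat (eq_bigr (fun=> N)) -?big_nat ?prod_nat_const_nat //.
  by move=> i /andP[h _]; rewrite ltnNge h.
rewrite -(card_imset _ sample_fun_inj); apply: subset_leq_card.
apply/subsetP => f /imsetP[r]; rewrite inE => /forallP hr ->.
apply/familyP => j; rewrite inE ffunE; exact: hr.
Qed.

End Sampling.

Section CoinProbability.
Variable R : realType.
Local Open Scope ring_scope.

(** The probability is a supremum, so one prefix length is enough; it will be the number [n * L] of
    coins that the preprocessing flips. *)
Lemma coin_prob_ge (E : seq bool -> Prop) m (x : R) :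
  x <= #|[pred r : m.-tuple bool | boolp.asbool (E r)]|%:R / 2 ^+ m -> x <= coin_prob R E.
Proof.
move=> h; apply: le_trans h _; apply: ub_le_sup; last by exists m.
exists 1 => _ [k _ <-]; rewrite ler_pdivrMr ?exprn_gt0 // mul1r -natrX ler_nat.
by apply: leq_trans (max_card _) _; rewrite card_tuple card_bool.
Qed.

Lemma coin_prob_ge0 (E : seq bool -> Prop) : 0 <= coin_prob R E.
Proof. by apply: (@coin_prob_ge E 0%N); rewrite divr_ge0. Qed.

Lemma coin_prob_sure (E : seq bool -> Prop) m : (forall r : m.-tuple bool, E r) ->
  1 <= coin_prob R E.
Proof.
move=> h; apply: (@coin_prob_ge E m).
rewrite ler_pdivlMr ?exprn_gt0 // mul1r -natrX ler_nat.
have -> : #|[pred r : m.-tuple bool | boolp.asbool (E r)]| = #|{: m.-tuple bool}|.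
  by apply: eq_card => r; rewrite !inE; apply/boolp.asboolP.
by rewrite card_tuple card_bool.
Qed.

Lemma coin_prob_union (E : seq bool -> Prop) m (I : finType) (B : I -> {set m.-tuple bool})
    (q : R) : (forall i, #|B i|%:R <= q * 2 ^+ m) ->
  (forall r : m.-tuple bool, (forall i, r \notin B i) -> E r) ->
  1 - #|I|%:R * q <= coin_prob R E.
Proof.
move=> hB hE; apply: (@coin_prob_ge E m).
rewrite ler_pdivlMr ?exprn_gt0 //.
set P := [pred r : m.-tuple bool | _].
have h : (2 ^ m <= #|P| + \sum_i #|B i|)%N.
  have -> : (2 ^ m = #|{: m.-tuple bool}|)%N by rewrite card_tuple card_bool.
  rewrite -(cardC P) leq_add2l.
  apply: (@leq_trans #|\bigcup_i B i|).
    apply: subset_leq_card; apply/subsetP => r; rewrite !inE => /boolp.asboolPn nE.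
    apply: contraT => hr; case: nE; apply: hE => i; apply: contra hr => hi.
    by apply/bigcupP; exists i.
  elim/big_rec2: _ => [|i x y _ IH]; first by rewrite cards0.
  by apply: leq_trans (leq_card_setU _ _) _; rewrite leq_add2l.
have h2 : (\sum_i #|B i|)%:R <= #|I|%:R * q * 2 ^+ m :> R.
  rewrite natr_sum; apply: le_trans (ler_sum _ (fun i _ => hB i)) _.
  by rewrite sumr_const -mulrA mulr_natl.
move: h; rewrite -(ler_nat R) natrD natrX; lra.
Qed.

End CoinProbability.

(** * Simple and shortest walks under non-negative weights *)

Section ShortestWalks.
Variables (R : realType) (n : nat) (w : nat -> nat -> \bar R) (D : pred nat).
Hypothesis w0 : forall u v, (0 <= w u v)%E.
Local Notation ok := (fun x => (x < n) && ~~ D x).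

(** If the start recurs in the simplified rest, everything before the recurrence is cut off, which
    does not lengthen the walk. *)
Lemma simple_walk s p : exists q, [/\ uniq (s :: q), last s q = last s p,
  (elen w s q <= elen w s p)%E & {subset q <= p}].
Proof.
elim: p s => [|v p IH] s; first by exists [::].
have [q [uq lq eq sq]] := IH v.
have le2 : (elen w v q <= elen w s (v :: p))%E.
  by apply: le_trans eq _; rewrite /= leeDr.
have subS x : x \in q -> x \in v :: p by move=> /sq; rewrite inE => ->; rewrite orbT.
have [sv|nsv] := boolP (s \in v :: q); last first.
  exists (v :: q); split=> //.
  - by rewrite cons_uniq nsv.
  - by rewrite /= leeD2l.
  - by move=> x; rewrite inE => /predU1P[->|/subS//]; rewrite inE eqxx.
move: sv; rewrite inE => /predU1P[e|sq'].
  by exists q; rewrite e in le2 *; split=> //.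
case/splitPr: sq' uq lq le2 subS => q1 q2 uq lq le2 subS.
exists q2; split.
- by move: uq; rewrite -cat_cons cat_uniq => /and3P[].
- by rewrite -[RHS]lq last_cat.
- apply: le_trans le2; rewrite elen_cat /= addeA leeDr // adde_ge0 //.
  exact: elen_ge0.
- by move=> x hx; apply: subS; rewrite mem_cat inE hx !orbT.
Qed.

(* Without any walk from [s] to [t], the condition on lengths is vacuous and [p]
   may be empty. *)
Lemma shortest_walk s t : s < n -> ~~ D s -> t < n -> ~~ D t ->
  exists p, [/\ uniq (s :: p), all ok (s :: p) &
    forall q, all ok (s :: q) -> last s q = t -> (elen w s q < +oo)%E ->
      last s p = t /\ (elen w s p <= elen w s q)%E].
Proof.
move=> sn Ds tn Dt.
(* Existence of a minimum comes from Bellman-Ford itself, run for [n] rounds outside [D]: simple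
   walks have fewer than [n] arcs. *)
have bound q : all ok (s :: q) -> last s q = t -> (lay n w D s n t <= elen w s q)%E.
  move=> hq lq; have [q' [uq lq' eq sq]] := simple_walk s q.
  have hq' : all ok (s :: q').
    apply/allP => x; rewrite inE => /predU1P[->|/sq hx]; first by rewrite sn Ds.
    by apply: (allP hq); rewrite inE hx orbT.
  apply: le_trans eq; rewrite -lq -lq'; apply: lay_complete => //; last by case/andP: hq'.
  apply: ltnW; have := uniq_leq_size uq (s2 := iota 0 n).
  rewrite size_iota; apply => x /(allP hq')/andP[xn _]; by rewrite mem_iota.
have [fin|inf] := boolP (lay n w D s n t < +oo)%E; last first.
  exists [::]; split=> //=; first by rewrite sn Ds.
  move=> q hq lq fq; exfalso; move/negP: inf; apply.
  by apply: le_lt_trans (bound q hq lq) fq.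
have [p [lp ep _ hp]] := lay_sound w0 sn Ds tn fin.
have [p' [up lp' ep' sp]] := simple_walk s p.
exists p'; split=> //.
  apply/allP => x; rewrite inE => /predU1P[->|/sp hx]; first by rewrite sn Ds.
  by apply: (allP hp); rewrite inE hx orbT.
move=> q hq lq _; split; first by rewrite lp'.
by apply: le_trans ep' _; rewrite ep; apply: bound.
Qed.

End ShortestWalks.

(** * From walks of numbers to paths of the graph without the deleted nodes *)

Section Graphs.
Variables (R : realType) (n : nat) (G : wdigraph R 'I_n) (D : {set 'I_n}).
Hypothesis G0 : nonneg_weights G.
Local Notation A := (adj_matrix G).
Local Notation w := (wdir A n false).

Definition deleted (v : nat) : bool :=
  if insub v : option 'I_n is Some x then x \in D else false.

Lemma deleted_ord (v : 'I_n) : deleted v = (v \in D).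
Proof. by rewrite /deleted valK. Qed.

Lemma indicator_deleted v : indicator D v = deleted v.
Proof. by rewrite /indicator /deleted; case: insub. Qed.

Lemma sum_deleted : \sum_(x < n) deleted x = #|D|.
Proof.
rewrite -sum1_card [RHS]big_mkcond /=; apply: eq_bigr => x _.
by rewrite deleted_ord; case: (_ \in _).
Qed.

Lemma adj_ge0 i : (0 <= A i)%E.
Proof.
rewrite /adj_matrix; case: insub => [u|//]; case: insub => [v|//].
by case: ifP => [a|_]; rewrite ?leey // lee_fin; apply: G0.
Qed.

Lemma adjE (u v : 'I_n) : w u v = if Defs.arc G u v then (wt G u v)%:E else +oo%E.
Proof.
have n0 : 0 < n by apply: leq_ltn_trans (ltn_ord u).
by rewrite /wdir /adj_matrix divnMDl // modnMDl divn_small // modn_small // addn0 !valK.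
Qed.

Local Notation sub := {x : 'I_n | x \notin D}.
Definition nodes (p : seq sub) : seq nat := [seq (val (val x) : nat) | x <- p].

Lemma nodes_ok p : all (fun x => (x < n) && ~~ deleted x) (nodes p).
Proof.
apply/allP => _ /mapP[x _ ->]; rewrite ltn_ord deleted_ord; exact: (valP x).
Qed.

Lemma elen_path (s : sub) p : path (Defs.arc (remove G D)) s p ->
  elen w (val (val s)) (nodes p) = (path_length (remove G D) s p)%:E.
Proof.
elim: p s => [|v p IH] s /=; first by rewrite /path_length big_nil.
move=> /andP[a hp]; rewrite IH // adjE a -EFinD.
by rewrite /path_length /= big_cons.
Qed.

(** Missing arcs have infinite weight and no weight is negative, so a finite length forces every arc
    to be present. *)
Lemma walk_path (s : sub) p : all (fun x => (x < n) && ~~ deleted x) p ->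
  (elen w (val (val s)) p < +oo)%E ->
  exists q, [/\ nodes q = p & path (Defs.arc (remove G D)) s q].
Proof.
elim: p s => [|v p IH] s /=; first by exists [::].
move=> /andP[/andP[vn Dv] hp] fin.
have hv : Ordinal vn \notin D by rewrite -deleted_ord.
pose v' : sub := exist _ (Ordinal vn) hv.
have e0 : (0 <= elen w v p)%E by apply: elen_ge0 => a b; apply: adj_ge0.
have w0 : (0 <= w (val (val s)) v)%E by apply: adj_ge0.
have f1 : (w (val (val s)) v < +oo)%E by apply: le_lt_trans fin; rewrite leeDl.
have f2 : (elen w v p < +oo)%E by apply: le_lt_trans fin; rewrite leeDr.
have [q [hq pq]] := IH v' hp f2.
exists (v' :: q); split; first by rewrite /= hq.
rewrite /= pq andbT; move: f1; rewrite -[v]/(val (Ordinal vn)) adjE.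
by case: ifP; rewrite ?ltxx.
Qed.

Lemma last_nodes (s : sub) p : last (val (val s) : nat) (nodes p) = val (val (last s p)).
Proof. by rewrite /nodes (last_map (fun x : sub => val (val x) : nat)). Qed.

Lemma is_dist_walks (s t : sub) (x : \bar R) : (0 <= x)%E ->
  ((x < +oo)%E -> exists p, [/\ last (val (val s) : nat) p = val (val t),
      elen w (val (val s)) p = x & all (fun x => (x < n) && ~~ deleted x) p]) ->
  (forall p, all (fun x => (x < n) && ~~ deleted x) p ->
     last (val (val s) : nat) p = val (val t) ->
     (elen w (val (val s)) p < +oo)%E -> (x <= elen w (val (val s)) p)%E) ->
  is_dist (remove G D) s t x.
Proof.
move=> x0 hs hc.
have lower q : path_from_to (remove G D) s t q ->
    (x <= (path_length (remove G D) s q)%:E)%E.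
  move=> /andP[pq /eqP lq]; rewrite -elen_path //; apply: hc.
  - exact: nodes_ok.
  - by rewrite last_nodes lq.
  - by rewrite elen_path // ltry.
case: x x0 hs hc lower => [r|//|//] _ hs hc lower; last first.
  by move=> q; apply/negP => /lower; rewrite leye_eq.
split; last by move=> q /lower; rewrite lee_fin.
have [p [lp ep ap]] := hs (ltry r).
have fin : (elen w (val (val s)) p < +oo)%E by rewrite ep ltry.
have [q [hq pq]] := walk_path ap fin.
exists q; last by apply: EFin_inj; rewrite -elen_path // hq.
rewrite /path_from_to pq /=; apply/eqP/val_inj/val_inj.
by rewrite -last_nodes hq.
Qed.

End Graphs.

(** * Numerical estimates *)

Section Estimates.
Variables (R : realType).
Local Open Scope ring_scope.
Local Notation expR := sequences.expR.

(** The [K] part of the word length yields [2 ^ lam], which absorbs the factors [lam]; what remains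
    is polynomial in [n] and bounded by [B ^ 5], well below [B ^ 12]. *)
Lemma fits_word_bound K n : (0 < n)%N ->
  fits (word_bound (K + 12) n) n (K * bitlen n) /\ (K < word_bound (K + 12) n)%N.
Proof.
move=> n0; set lam := (K * bitlen n)%N.
have -> : (word_bound (K + 12) n = 2 ^ lam * (2 ^ bitlen n) ^ 12)%N.
  by rewrite /word_bound mulnDl expnD -expnM [(_ * 12)%N]mulnC.
set X := (2 ^ lam)%N; set B := (2 ^ bitlen n)%N.
have hX : (lam.+1 <= X)%N by apply: ltn_expl.
have hB : (n.+1 <= B)%N by apply: bitlen_gt.
have B2 : (2 <= B)%N by lia.
have B0 : (0 < B)%N by lia.
have X0 : (0 < X)%N by lia.
have big y : (y <= X * B ^ 5)%N -> (y < X * B ^ 12)%N.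
  move=> hy; apply: leq_ltn_trans hy _.
  by rewrite ltn_mul2l X0 ltn_exp2l.
have e5 : (X * B ^ 5 = X * (B * (B * (B * (B * B)))))%N by rewrite !expnS expn0 muln1.
have nB : (n <= B)%N by lia.
have lX : (lam <= X)%N by lia.
have le2 a : (2 * a <= B * a)%N by rewrite leq_mul2r B2 orbT.
have up a : (a <= B * a)%N by rewrite leq_pmull.
have upX a : (a <= X * a)%N by rewrite leq_pmull.
have nX : (n * lam.+1 <= B * X)%N by apply: leq_mul.
split; last first.
  apply: big; apply: (@leq_trans lam); first by rewrite leq_pmulr.
  by apply: leq_trans lX _; rewrite leq_pmulr // expn_gt0 B0.
have nnX : (n * (n * lam.+1) <= B * (B * X))%N by apply: leq_mul.
have nnnX : (n * (n * (n * lam.+1)) <= B * (B * (B * X)))%N by apply: leq_mul.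
have nn : (n * n <= B * B)%N by apply: leq_mul.
have nnn : (n * (n * n) <= B * (B * B))%N by apply: leq_mul.
have nnnn : (n.+1 * (n * (n * n)) <= B * (B * (B * B)))%N by apply: leq_mul.
have c2 : (B * (B * X) <= B * (B * (B * X)))%N by apply: up.
have c3 : (B * (B * (B * X)) <= B * (B * (B * (B * X))))%N by apply: up.
have c4 : (B * (B * (B * (B * X))) <= B * (B * (B * (B * (B * X)))))%N by apply: up.
have c5 : (2 * (B * (B * X)) <= B * (B * (B * X)))%N by apply: le2.
have c6 : (2 * (B * (B * (B * X))) <= B * (B * (B * (B * X))))%N by apply: le2.
have c7 : (2 * (B * (B * (B * (B * X)))) <= B * (B * (B * (B * (B * X)))))%N by apply: le2.
have d1 : (B <= B * (B * X))%N by rewrite leq_pmulr // muln_gt0 B0.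
have d2 : (B * (B * (B * B)) <= B * (B * (B * (B * X))))%N.
  by rewrite !leq_mul2l leq_pmulr ?orbT.
split => //; try (apply: big; rewrite e5); try lia.
Qed.

Lemma ln_le_bitlen n : (0 < n)%N -> ln n%:R <= (bitlen n)%:R :> R.
Proof.
move=> n0; rewrite -[leRHS]expRK ler_ln ?posrE ?ltr0n ?expR_gt0 //.
rewrite -[_%:R in leRHS]mulr1 expRM_natl; apply: (@le_trans _ _ (2 ^+ bitlen n)).
  by rewrite -natrX ler_nat ltnW ?bitlen_gt.
apply: lerXn2r; rewrite ?nnegrE ?expR_ge0 //.
by have := expR_ge1Dx (1 : R).
Qed.

(** For [n >= 2] the bit length is at most [log2 n + 1], hence at most [2 * log2 n]. *)
Definition log_ratio : R := 2 / ln 2.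

Lemma ln2_gt0 : 0 < ln 2 :> R.
Proof. by apply: ln_gt0; rewrite ltr1n. Qed.

Lemma bitlen_le_ln n : (1 < n)%N -> (bitlen n)%:R <= log_ratio * ln n%:R :> R.
Proof.
move=> n1; have n0 : (0 < n)%N by lia.
have h2 : ln 2 <= ln n%:R :> R by rewrite ler_ln ?posrE ?ltr0n // ler_nat.
have h : (trunc_log 2 n)%:R * ln 2 <= ln n%:R :> R.
  rewrite mulr_natl -lnXn // ler_ln ?posrE ?exprn_gt0 ?ltr0n //.
  by rewrite -natrX ler_nat trunc_logP.
rewrite /log_ratio mulrAC ler_pdivlMr ?ln2_gt0 // /bitlen -natr1 mulrDl mul1r.
lra.
Qed.

(* [1 - m / N <= exp (- m / N)], and [m * J] is about [n * lam / 2] while [N <= 2 * n]. *)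
Lemma miss_prob (c : R) (b K n m : nat) : 0 <= c -> c <= b%:R -> K = (8 * (b + 2))%N ->
  (0 < n)%N -> (0 < m)%N -> (m <= n)%N ->
  let L := bitlen n in let J := ((n * (K * L)) %/ (2 * m))%N in (J <= n)%N ->
  ((2 ^ L - m) ^ J * (2 ^ L) ^ (n - J))%:R <= (n%:R ^+ 2 * n%:R `^ c)^-1 * 2 ^+ (n * L) :> R.
Proof.
move=> c0 cb hK n0 m0 mn L J Jn.
have L0 : (0 < L)%N by [].
have mN : (m <= 2 ^ L)%N by apply: leq_trans mn _; apply: ltnW; apply: bitlen_gt.
set N : R := 2 ^+ L.
have N0 : 0 < N by apply: exprn_gt0.
have eN : (2 ^ L)%:R = N by rewrite natrX.
have N2 : N <= 2 * n%:R by rewrite -eN -natrM ler_nat; apply: exp2_bitlen.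
have -> : ((2 ^ L - m) ^ J * (2 ^ L) ^ (n - J))%:R = (1 - m%:R / N) ^+ J * 2 ^+ (n * L) :> R.
  rewrite natrM !natrX natrB // eN mulnC exprM -/N.
  have -> : N - m%:R = (1 - m%:R / N) * N.
    by rewrite mulrBl mul1r divfK // gt_eqF.
  by rewrite exprMn -mulrA -exprD subnKC.
rewrite ler_pM2r ?exprn_gt0 //.
have h1 : (1 - m%:R / N) ^+ J <= expR (- (m%:R / N)) ^+ J.
  apply: lerXn2r; rewrite ?nnegrE ?expR_ge0 //.
    by rewrite subr_ge0 ler_pdivrMr // mul1r -eN ler_nat.
  exact: expR_ge1Dx.
apply: le_trans h1 _; rewrite -expRM_natl.
have n0R : (0 : R) < n%:R by rewrite ltr0n.
have -> : (n%:R ^+ 2 * n%:R `^ c)^-1 = expR (- ((c + 2) * ln n%:R)) :> R.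
  rewrite expRN mulrDl expRD; congr (_^-1); rewrite mulrC; congr (_ * _).
    by rewrite /powR gt_eqF.
  by rewrite expRM_natl lnK // posrE.
rewrite ler_expR mulrN lerN2.
have hJ : (n * (K * L) < (J.+1) * (2 * m))%N by apply: ltn_ceil; rewrite muln_gt0.
have hJR : n%:R * (K%:R * L%:R) <= (J%:R + 1) * (2 * m%:R) :> R.
  by rewrite natr1 -!natrM ler_nat ltnW.
have hKR : K%:R = 8 * (b%:R + 2) :> R by rewrite hK natrM natrD.
have hL : ln n%:R <= L%:R :> R by apply: ln_le_bitlen.
have L1 : (1 : R) <= L%:R by rewrite ler1n.
have mnR : m%:R <= n%:R :> R by rewrite ler_nat.
(* The factor 8 in [K] is spent here and below: one 2 on the denominator of [J], one on its
   rounding, and one on [N <= 2 * n]. *)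
have lower : n%:R * ((b%:R + 2) * L%:R) * 2 <= m%:R * J%:R :> R.
  have hx : 0 <= n%:R * ((b%:R + 2) * L%:R - 2) :> R.
    apply: mulr_ge0; first exact: ltW.
    have : 0 <= b%:R * L%:R :> R by rewrite -natrM.
    by lra.
  rewrite hKR in hJR; lra.
have ln0 : 0 <= ln n%:R :> R by apply: ln_ge0; rewrite ler1n.
have up : (c + 2) * ln n%:R <= (b%:R + 2) * L%:R.
  by apply: ler_pM => //; [rewrite addr_ge0 | rewrite lerD2r].
apply: le_trans up _.
rewrite mulrCA mulrA ler_pdivlMr //.
have x0 : 0 <= (b%:R + 2) * L%:R :> R by rewrite mulr_ge0 // addr_ge0.
have := ler_wpM2l x0 N2; lra.
Qed.

(** It gives [L <= 4 * sqrt n], by which the part [n ^ 2 * L ^ 2] of the deletion time that does not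
    depend on the damage is absorbed into [n ^ (5 / 2) * L]. *)
Lemma bitlen_sq n : (0 < n)%N -> (bitlen n * bitlen n <= 16 * n)%N.
Proof.
move=> n0; have h l : (l * l + 4 * l + 6 <= 8 * 2 ^ l)%N.
  by elim: l => // l IH; rewrite expnS; lia.
have := h (trunc_log 2 n); have := bitlen_le n0; rewrite /bitlen /=.
by set l := trunc_log 2 n; lia.
Qed.

Lemma cnt_cap_le K n : (0 < K)%N ->
  (cnt_cap n (K * bitlen n) (bitlen n) <= 36 * K * (n * n) * (bitlen n * bitlen n))%N.
Proof.
move=> K0; rewrite /cnt_cap /slot_cap; have L0 : (0 < bitlen n)%N by [].
move: (bitlen n) L0 => L L0.
have h1 : ((K * L).+1 <= 2 * (K * L))%N by nia.
have h2 : (2 * n * n * (K * L).+1 <= 4 * (n * n) * (K * L))%N.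
  apply: (@leq_trans (2 * n * n * (2 * (K * L)))%N); last by lia.
  by rewrite leq_mul2l h1 orbT.
set U := (2 * n * n * _)%N in h2 *.
have h3 : (4 * U * L.+1 + U <= 9 * (U * L))%N by nia.
apply: leq_trans h3 _.
have h4 : (U * L <= 4 * (n * n) * (K * L) * L)%N by rewrite leq_mul2r h2 orbT.
lia.
Qed.

Lemma delete_time (K n g TD : nat) (L := bitlen n) : (0 < K)%N -> (1 < n)%N -> (0 < g)%N ->
  (forall q, q * TD <= 2 * n * q * q + g * cnt_cap n (K * L) L)%N ->
  (400 * (n * n * (K * L * L + 1) + n * TD))%:R <=
    400 * (40 * K + 8)%:R * log_ratio * (n%:R `^ (5 / 2) * Num.sqrt g%:R * ln n%:R) :> R.
Proof.
move=> K0 n1 g0 hTD; have n0 : (0 < n)%N by lia.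
have L0 : (0 < L)%N by [].
set sn : R := Num.sqrt n%:R; set sg : R := Num.sqrt g%:R.
have sn1 : 1 <= sn by rewrite -sqrtr1 ler_sqrt // ler1n.
have sg1 : 1 <= sg by rewrite -sqrtr1 ler_sqrt // ler1n.
have en : n%:R = sn ^+ 2 by rewrite sqr_sqrtr.
have eg : g%:R = sg ^+ 2 by rewrite sqr_sqrtr.
have hL : L%:R <= log_ratio * ln n%:R :> R by apply: bitlen_le_ln.
have L1 : 1 <= L%:R :> R by rewrite ler1n.
have hLs : L%:R <= 4 * sn.
  rewrite -ler_sqr ?nnegrE ?mulr_ge0 //; try lra.
  rewrite exprMn -en -!natrX -natrM ler_nat.
  by have := bitlen_sq n0; rewrite -/L expnS expn1; lia.
have -> : n%:R `^ (5 / 2) = sn ^+ 5 :> R.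
  have -> : 5 / 2 = 2%:R + 2^-1 :> R by lra.
  rewrite powRD; last by rewrite pnatr_eq0 -lt0n n0 implybT.
  rewrite powR_mulrn // powR12_sqrt // -/sn [in LHS]en.
  by rewrite -exprM -exprSr.
(* The threshold [q = L * rho], with [rho] about [sqrt (n * g)], balances [2 * n * q] against
   [g * cnt_cap / q]: both become [n ^ (3 / 2) * sqrt g * L] up to constants. *)
set rho := (Num.truncn (sn * sg)).+1.
have r1 : sn * sg <= rho%:R by apply: ltW; apply: truncnS_gt.
have sng : 1 <= sn * sg by rewrite -[1]mulr1; apply: ler_pM.
have r2 : rho%:R <= 2 * (sn * sg).
  have : (Num.truncn (sn * sg))%:R <= sn * sg by rewrite truncn_le; lra.
  by rewrite /rho -natr1; lra.
have hTDR : TD%:R <= (4 + 36 * K%:R) * (sn ^+ 3 * sg * L%:R).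
  have hq := hTD (L * rho)%N.
  have hG : (g * cnt_cap n (K * L) L <= g * (36 * K * (n * n) * (L * L)))%N.
    by rewrite leq_mul2l; apply/orP; right; apply: cnt_cap_le.
  have hq2 : (L * rho * TD <= 2 * n * (L * rho) * (L * rho) + g * (36 * K * (n * n) * (L * L)))%N.
    by apply: leq_trans hq _; rewrite leq_add2l.
  move: hq2; rewrite -(ler_nat R) natrD !natrM en eg => hq2.
  have K0R : 0 <= K%:R :> R by [].
  have rho0 : 0 < rho%:R :> R by rewrite ltr0n.
  have Lr : 0 < L%:R * rho%:R :> R by rewrite mulr_gt0 // ltr0n.
  rewrite -(ler_pM2l Lr); apply: le_trans hq2 _.
  have a1 : 2 * sn ^+ 2 * (L%:R * rho%:R) * (L%:R * rho%:R) <=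
      L%:R * rho%:R * (4 * (sn ^+ 3 * sg * L%:R)).
    have -> : 2 * sn ^+ 2 * (L%:R * rho%:R) * (L%:R * rho%:R) =
      (L%:R * rho%:R) * (2 * sn ^+ 2 * L%:R * rho%:R) by ring.
    rewrite ler_pM2l //.
    have -> : 4 * (sn ^+ 3 * sg * L%:R) = 2 * sn ^+ 2 * L%:R * (2 * (sn * sg)) by ring.
    rewrite ler_wpM2l // !mulr_ge0 ?sqr_ge0 //; lra.
  have a2 : sg ^+ 2 * (36 * K%:R * (sn ^+ 2 * sn ^+ 2) * (L%:R * L%:R)) <=
      L%:R * rho%:R * (36 * K%:R * (sn ^+ 3 * sg * L%:R)).
    have -> : sg ^+ 2 * (36 * K%:R * (sn ^+ 2 * sn ^+ 2) * (L%:R * L%:R)) =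
      (36 * K%:R * sn ^+ 3 * sg * (L%:R * L%:R)) * (sn * sg) by ring.
    have -> : L%:R * rho%:R * (36 * K%:R * (sn ^+ 3 * sg * L%:R)) =
      (36 * K%:R * sn ^+ 3 * sg * (L%:R * L%:R)) * rho%:R by ring.
    rewrite ler_wpM2l // !mulr_ge0 ?exprn_ge0 //; lra.
  have -> : L%:R * rho%:R * ((4 + 36 * K%:R) * (sn ^+ 3 * sg * L%:R)) =
    L%:R * rho%:R * (4 * (sn ^+ 3 * sg * L%:R)) +
    L%:R * rho%:R * (36 * K%:R * (sn ^+ 3 * sg * L%:R)) by ring.
  exact: lerD.
have hA : n%:R * n%:R * (K%:R * L%:R * L%:R + 1) <= (4 * K%:R + 4) * (sn ^+ 5 * sg * L%:R).
  apply: (@le_trans _ _ (sn ^+ 4 * (K%:R + 1) * L%:R * L%:R)).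
    rewrite en; have -> : sn ^+ 2 * sn ^+ 2 = sn ^+ 4 by ring.
    have -> : sn ^+ 4 * (K%:R + 1) * L%:R * L%:R =
      sn ^+ 4 * (K%:R * L%:R * L%:R + L%:R * L%:R) by ring.
    by rewrite ler_wpM2l ?exprn_ge0 ?lerD2l ?mulr_ege1 //; lra.
  have -> : (4 * K%:R + 4) * (sn ^+ 5 * sg * L%:R) =
     (sn ^+ 4 * (K%:R + 1) * L%:R) * (4 * sn * sg) by ring.
  rewrite ler_wpM2l //.
    by rewrite !mulr_ge0 ?exprn_ge0 ?addr_ge0 //; lra.
  apply: le_trans hLs _; rewrite -[leLHS]mulr1 ler_wpM2l //; lra.
have hB : n%:R * TD%:R <= (4 + 36 * K%:R) * (sn ^+ 5 * sg * L%:R).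
  rewrite en; have -> : (4 + 36 * K%:R) * (sn ^+ 5 * sg * L%:R) =
    sn ^+ 2 * ((4 + 36 * K%:R) * (sn ^+ 3 * sg * L%:R)) by ring.
  by rewrite ler_wpM2l // sqr_ge0.
have -> : (400 * (n * n * (K * L * L + 1) + n * TD))%:R =
    400 * (n%:R * n%:R * (K%:R * L%:R * L%:R + 1) + n%:R * TD%:R) :> R.
  by rewrite natrM natrD !natrM natrD !natrM.
have -> : (40 * K + 8)%:R = 40 * K%:R + 8 :> R by rewrite natrD natrM.
have -> : 400 * (40 * K%:R + 8) * log_ratio * (sn ^+ 5 * sg * ln n%:R) =
  400 * ((40 * K%:R + 8) * (sn ^+ 5 * sg) * (log_ratio * ln n%:R)) by ring.
rewrite ler_wpM2l //; apply: le_trans (lerD hA hB) _.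
have -> : (4 * K%:R + 4) * (sn ^+ 5 * sg * L%:R) + (4 + 36 * K%:R) * (sn ^+ 5 * sg * L%:R)
   = (40 * K%:R + 8) * (sn ^+ 5 * sg) * L%:R by ring.
rewrite ler_wpM2l // !mulr_ge0 ?exprn_ge0 ?addr_ge0 ?mulr_ge0 //; lra.
Qed.

Lemma preprocess_time (K n : nat) (L := bitlen n) : (1 < n)%N ->
  ((80 * K + 300) * (n * n * n) * (L * L))%:R <=
    (80 * K + 300)%:R * log_ratio ^+ 2 * (n%:R ^+ 3 * ln n%:R ^+ 2) :> R.
Proof.
move=> n1; have hL : L%:R <= log_ratio * ln n%:R :> R by apply: bitlen_le_ln.
have h : L%:R ^+ 2 <= (log_ratio * ln n%:R) ^+ 2 :> R.
  by rewrite lerXn2r ?nnegrE //; apply: le_trans hL.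
have -> : ((80 * K + 300) * (n * n * n) * (L * L))%:R =
    (80 * K + 300)%:R * n%:R ^+ 3 * L%:R ^+ 2 :> R.
  by rewrite !natrM !expr2 !exprS expr0 mulr1 !mulrA.
have -> : (80 * K + 300)%:R * log_ratio ^+ 2 * (n%:R ^+ 3 * ln n%:R ^+ 2) =
   (80 * K + 300)%:R * n%:R ^+ 3 * (log_ratio * ln n%:R) ^+ 2 :> R by ring.
by rewrite ler_wpM2l // mulr_ge0 // exprn_ge0.
Qed.

End Estimates.

(** * Correctness with high probability, and the time bounds *)

Section Main.
Variables (R : realType) (K n : nat) (G : wdigraph R 'I_n).
Hypotheses (K0 : 0 < K) (n0 : 0 < n) (G0 : nonneg_weights G).
Local Notation A := (adj_matrix G).
Local Notation L := (bitlen n).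
Local Notation M := (word_bound (K + 12) n).
Local Notation ready := (@ready R n K A).
Local Notation w := (wdir A n false).

Let hF : fits M n (K * L). Proof. by case: (fits_word_bound K n0). Qed.
Let KM : K < M. Proof. by case: (fits_word_bound K n0). Qed.
Let A0 : forall i, (0 <= A i)%E. Proof. exact: adj_ge0. Qed.

Lemma preprocess_ready (r : (n * L).-tuple bool) :
  runs M (preprocess_prog K) (preprocess_start G r)
    ((80 * K + 300) * (n * n * n) * (L * L)) (ready r).
Proof. by apply: preprocess_runs => //; rewrite size_tuple. Qed.

(** Only word array 0 is replaced, which [ready] does not mention. *)
Lemma ready_delete_start r st (D : {set 'I_n}) : ready r st -> ready r (delete_start st D).
Proof.
case=> -[b1 b2 b3 b4 b5] P T hA; split=> //; split=> //.
by move=> dir j k t hj hk ht; rewrite -b4 //; case: dir.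
Qed.

Variable D : {set 'I_n}.
Local Notation ok := (fun x => (x < n) && ~~ deleted D x).

Lemma delete_start_runs r st : ready r st ->
  runs M (delete_prog K) (delete_start st D)
    (400 * (n * n * (K * L * L + 1) + n * @total_damage R n K A r (deleted D))) (fun st' =>
    exists N : bool -> nat -> nat -> \bar R,
      (forall dir i, i < n -> @repaired_row R n K A r (deleted D) dir i (N dir i)) /\
      forall s t, s < n -> t < n ->
        good_value n N s t (warr st' 1 (s * n + t)) /\
        forall j, j < n -> (warr st' 1 (s * n + t) <= newkey N s t j)%E).
Proof.
move=> h; apply: delete_runs => //; last exact: ready_delete_start.
by move=> v _; rewrite -indicator_deleted.
Qed.

(** The deterministic core: for each pair, a single prescribed shortest path has to be short or hit
    by an early sample. *)
Lemma outputs_correct r st (N : bool -> nat -> nat -> \bar R) (P : 'I_n * 'I_n -> seq nat) :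
  (forall dir i, i < n -> @repaired_row R n K A r (deleted D) dir i (N dir i)) ->
  (forall s t, s < n -> t < n ->
     good_value n N s t (warr st 1 (s * n + t)) /\
     forall j, j < n -> (warr st 1 (s * n + t) <= newkey N s t j)%E) ->
  (forall s t : 'I_n, s \notin D -> t \notin D -> let p := P (s, t) in
     [/\ uniq ((s : nat) :: p), all ok ((s : nat) :: p) &
       forall q, all ok ((s : nat) :: q) -> last (s : nat) q = t -> (elen w s q < +oo)%E ->
         last (s : nat) p = t /\ (elen w s p <= elen w s q)%E]) ->
  (forall s t : 'I_n, s \notin D -> t \notin D -> let p := (s : nat) :: P (s, t) in
     size p <= K * L \/
     exists2 j, j < (n * (K * L)) %/ (2 * size p) & sample n r j \in p) ->
  outputs_distances G D st.
Proof.
move=> hN hout hP hit s t; have [sn tn] := (ltn_ord (val s), ltn_ord (val t)).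
have [good low] := hout _ _ sn tn; apply: is_dist_walks => //.
- case: good => [->|[i hi ->]]; first exact: leey.
  rewrite /newkey adde_ge0 //.
  + have [V _] := hN true i hi.
    have [->|fv] := eqVneq (N true i (val s)) +oo%E; first exact: leey.
    rewrite -ltey in fv; have [p [_ <- _]] := row_sound V sn fv.
    by apply: elen_ge0; apply: wdir_ge0.
  + have [V _] := hN false i hi.
    have [->|fv] := eqVneq (N false i (val t)) +oo%E; first exact: leey.
    rewrite -ltey in fv; have [p [_ <- _]] := row_sound V tn fv.
    by apply: elen_ge0; apply: wdir_ge0.
- exact: (answer_sound A0 sn tn hN good).
- move=> q hq lq fq; have [up ap best] := hP (val s) (val t) (valP s) (valP t).
  have sok : ok (val s : nat) by rewrite /= sn deleted_ord (valP s).
  have [lp le] := best q (introT andP (conj sok hq)) lq fq.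
  apply: le_trans le.
  have aln : all (gtn n) ((val s : nat) :: P (val s, val t)).
    by apply: sub_all ap => x /andP[].
  have [i [hi hc hs ha]] := first_hit A hF KM up aln (hit _ _ (valP s) (valP t)).
  apply: (answer_complete A0 hi hN) => //; first by move=> j hj; rewrite lp; apply: low.
  apply/allP => y hy; have /andP[-> ->] := allP ap y hy; exact: (allP ha).
Qed.

Local Open Scope ring_scope.

Lemma distances_whp (c : R) (b : nat) : 0 <= c -> c <= b%:R -> K = (8 * (b + 2))%N ->
  1 - 1 / (n%:R `^ c) <= coin_prob R (fun r =>
    halts_with M (preprocess_prog K) (preprocess_start G r) (fun _ ds =>
      halts_with M (delete_prog K) (delete_start ds D) (fun _ st =>
        outputs_distances G D st))).
Proof.
move=> c0 cb hK; have w0 : forall u v, (0 <= w u v)%E by apply: wdir_ge0.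
pose good (st : 'I_n * 'I_n) (p : seq nat) := st.1 \notin D -> st.2 \notin D ->
  [/\ uniq ((st.1 : nat) :: p), all ok ((st.1 : nat) :: p) &
    forall q, all ok ((st.1 : nat) :: q) -> last (st.1 : nat) q = st.2 ->
      (elen w st.1 q < +oo)%E ->
      last (st.1 : nat) p = st.2 /\ (elen w st.1 p <= elen w st.1 q)%E].
(* The paths are chosen before the coins, from the graph and [D] alone, so the samples are
   independent of them. *)
have [P hP] : {P & forall st, good st (P st)}.
  apply: boolp.choice => -[s t]; have [/= sD|sD] := boolP (s \in D);
    first by exists [::] => /negP.
  have [/= tD|tD] := boolP (t \in D); first by exists [::] => _ /negP.
  have [p hp] := shortest_walk (D := deleted D) w0 (ltn_ord s)
    (etrans (congr1 negb (deleted_ord D s)) sD) (ltn_ord t)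
    (etrans (congr1 negb (deleted_ord D t)) tD).
  by exists p.
pose m (st : 'I_n * 'I_n) := size ((st.1 : nat) :: P st).
pose J st := ((n * (K * L)) %/ (2 * m st))%N.
pose far (st : 'I_n * 'I_n) := [&& st.1 \notin D, st.2 \notin D & (K * L < m st)%N].
(* The coins for which the first [J] samples all miss the path of the pair; short paths and pairs
   with a deleted end have no bad coins. *)
pose B (st : 'I_n * 'I_n) : {set (n * L).-tuple bool} := if far st then
  [set r : (n * L).-tuple bool | [forall j : 'I_n, (j < J st)%N ==>
     (sample n r j \notin (st.1 : nat) :: P st)]] else finset.set0.
have JJ st : far st -> (J st <= n)%N.
  case/and3P=> _ _ hm; rewrite -(@leq_pmul2r (m st)) //.
  have : (J st * (2 * m st) <= n * (K * L))%N by apply: leq_trunc_div.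
  by move: hm; rewrite /J; nia.
set q : R := (n%:R ^+ 2 * n%:R `^ c)^-1.
have hB st : #|B st|%:R <= q * 2 ^+ (n * L).
  rewrite /B; case: ifP => hf; last first.
    by rewrite cards0 mulr_ge0 ?exprn_ge0 // invr_ge0 mulr_ge0 ?exprn_ge0 ?powR_ge0.
  have [sD tD _] := and3P hf; have [up ap _] := hP st sD tD.
  have mn : (m st <= n)%N.
    rewrite -[leqRHS](size_iota 0); apply: uniq_leq_size => // x /(allP ap)/andP[xn _].
    by rewrite mem_iota.
  apply: le_trans (miss_prob c0 cb hK n0 (ltn0Sn _) mn (JJ st hf)).
  rewrite ler_nat; apply: card_miss => //; last exact: JJ.
  by apply: sub_all ap => x /andP[xn _]; apply: ltn_trans xn (bitlen_gt n).
(* The factor [n ^ 2] in [q] pays for the union over all pairs. *)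
have -> : 1 / n%:R `^ c = #|{: 'I_n * 'I_n}|%:R * q.
  rewrite card_prod !card_ord natrM /q invfM mulrA -expr2 divff ?mul1r //.
  by rewrite expf_eq0 pnatr_eq0 gtn_eqF.
apply: (coin_prob_union hB) => r hr.
have [t [ds [e1 _ rd]]] := preprocess_ready r.
have [t' [st' [e2 _ [N [hN hout]]]]] := delete_start_runs rd.
exists t, ds; split=> //; exists t', st'; split=> //.
apply: (outputs_correct hN hout (P := P)) => s u sD uD; first exact: (hP (s, u)).
have [hm|hm] := leqP (size ((s : nat) :: P (s, u))) (K * L); [by left | right].
have hf : far (s, u) by rewrite /far /= sD uD.
have := hr (s, u); rewrite /B hf inE negb_forall => /existsP[j].
by rewrite negb_imply negbK => /andP[hj sj]; exists j.
Qed.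

(** The number of steps is bounded for every outcome of the coins, so the probability is 1. *)
Lemma preprocess_fast : (1 < n)%N -> forall C, (80 * K + 300)%:R * log_ratio R ^+ 2 <= C ->
  1 <= coin_prob R (fun r =>
    halts_with M (preprocess_prog K) (preprocess_start G r) (fun t _ =>
      t%:R <= C * (n%:R ^+ 3 * ln n%:R ^+ 2))).
Proof.
move=> n1 C hC; apply: (@coin_prob_sure R _ (n * L)%N) => r.
have [t [ds [e1 ht _]]] := preprocess_ready r; exists t, ds; split=> //.
apply: (@le_trans _ _ ((80 * K + 300) * (n * n * n) * (L * L))%:R); first by rewrite ler_nat.
apply: le_trans (preprocess_time R K n1) _; rewrite ler_wpM2r // mulr_ge0 ?exprn_ge0 //.
by rewrite ln_ge0 // ler1n.
Qed.

Lemma delete_fast : (1 < n)%N -> D != finset.set0 ->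
  forall C, 400 * (40 * K + 8)%:R * log_ratio R <= C ->
  1 <= coin_prob R (fun r =>
    halts_with M (preprocess_prog K) (preprocess_start G r) (fun _ ds =>
      halts_with M (delete_prog K) (delete_start ds D) (fun t _ =>
        t%:R <= C * (n%:R `^ (5 / 2) * Num.sqrt #|D|%:R * ln n%:R)))).
Proof.
move=> n1 hD C hC; apply: (@coin_prob_sure R _ (n * L)%N) => r.
have [t [ds [e1 _ rd]]] := preprocess_ready r; exists t, ds; split=> //.
have [t' [st' [e2 ht _]]] := delete_start_runs rd; exists t', st'; split=> //.
have g0 : (0 < #|D|)%N by rewrite card_gt0.
have hTD q := total_damage_le r hF KM A0 (deleted D) q.
rewrite sum_deleted in hTD.
apply: (@le_trans _ _ _%:R); first by rewrite ler_nat; exact: ht.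
apply: le_trans (delete_time R K0 n1 g0 hTD) _.
rewrite ler_wpM2r // !mulr_ge0 ?powR_ge0 ?sqrtr_ge0 //.
by rewrite ln_ge0 // ler1n.
Qed.

End Main.

Local Open Scope ring_scope.

Theorem theorem2 (R : realType) (c : R) (hc : 1 <= c) :
  exists (preprocess delete : prog) (k : nat) (C : R),
  forall (n : nat) (G : wdigraph R 'I_n),
    (0 < n)%N -> nonneg_weights G ->
    let M := word_bound k n in
    1 - 1 / (n%:R `^ c) <= coin_prob R (fun r =>
      halts_with M preprocess (preprocess_start G r) (fun t _ =>
        t%:R <= C * (n%:R ^+ 3 * ln n%:R ^+ 2)))
    /\
    forall D : {set 'I_n}, D != set0 ->
      1 - 1 / (n%:R `^ c) <= coin_prob R (fun r =>
        halts_with M preprocess (preprocess_start G r) (fun _ ds =>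
          halts_with M delete (delete_start ds D) (fun t _ =>
            t%:R <= C * (n%:R `^ (5 / 2) * Num.sqrt #|D|%:R * ln n%:R))))
      /\
      1 - 1 / (n%:R `^ c) <= coin_prob R (fun r =>
        halts_with M preprocess (preprocess_start G r) (fun _ ds =>
          halts_with M delete (delete_start ds D) (fun _ st =>
            outputs_distances G D st))).
Proof.
have c0 : 0 <= c by apply: le_trans hc.
(* [K] depends on [c] only, so the programs, the word length and the constant are the same for all
   graphs. *)
pose b := Num.bound c; pose K := (8 * (b + 2))%N.
have cb : c <= b%:R by apply: ltW; apply: archi_boundP.
have K0 : (0 < K)%N by rewrite /K; lia.
pose C1 : R := (80 * K + 300)%:R * log_ratio R ^+ 2.
pose C2 : R := 400 * (40 * K + 8)%:R * log_ratio R.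
have r0 : 0 <= log_ratio R by rewrite divr_ge0 // ltW // ln2_gt0.
have C10 : 0 <= C1 by rewrite mulr_ge0 // exprn_ge0.
have C20 : 0 <= C2 by rewrite mulr_ge0 // mulr_ge0.
exists (preprocess_prog K), (delete_prog K), (K + 12)%N, (C1 + C2) => n G n0 G0 M.
have le1 : 1 - 1 / n%:R `^ c <= 1 by rewrite gerBl divr_ge0 // powR_ge0.
(* For [n = 1] both time bounds vanish with [ln n], so no run meets them; but the required
   probability is then 0. *)
have [n1|n1] := leqP n 1.
  have -> : 1 - 1 / n%:R `^ c = 0.
    by have -> : n = 1%N by [apply/eqP; rewrite eqn_leq n1]; rewrite powR1 divr1 subrr.
  by split=> [|D _]; [|split]; apply: coin_prob_ge0.
split; first by apply: le_trans le1 _; apply: preprocess_fast => //; rewrite lerDl.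
move=> D hD; split; last exact: distances_whp cb _.
by apply: le_trans le1 _; apply: delete_fast => //; rewrite lerDr.
Qed.
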